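(* Let $d\ge 1$, $l\in\mathbb{N}$, $\frac{2d}{d+1}<p<\infty$, $f\in\widehat{GM}{}^{d}\cap L^{p}(\mathbb{R}^{d})$, and $\widehat{f}(\xi)=F_0(|\xi|)\ge 0$. Then for all $t>0$ $$F_0(t)\lesssim t^{-d/p'}\,\Omega_l(f,1/t)_p .$$
   Context: General monotone functions: $\varphi$ on $(0,\infty)$ belongs to $GM$ if it is locally of bounded variation on $(0,\infty)$, vanishes at infinity, and for some constants $c>1$, $C>0$ depending on $\varphi$, $$\int_z^\infty|d\varphi(u)|\le C\int_{z/c}^\infty\frac{|\varphi(u)|}{u}\,du<\infty,\qquad z>0.$$ The class $\widehat{GM}{}^{d}$, $d\ge1$: all radial functions $f(x)=f_0(|x|)$, $x\in\mathbb{R}^d$, of the form $$f_0(z)=\frac{|S^{d-1}|}{(2\pi)^d}\int_0^\infty F_0(s)\,j_{d/2-1}(zs)\,s^{d-1}\,ds,\qquad z>0$$ (improper integral), where $F_0\in GM$ and $$\int_0^1 s^{d-1}|F_0(s)|\,ds+\int_1^\infty s^{(d-1)/2}\,|dF_0(s)|<\infty .$$ Here $j_\alpha(t)=\Gamma(\alpha+1)(t/2)^{-\alpha}J_\alpha(t)$ is the normalized Bessel function. The function $F_0$ is the radial component of the Fourier transform of $f$: $\widehat f(\xi)=F_0(|\xi|)$, with the convention $\widehat f(\xi)=\int_{\mathbb{R}^d}f(x)e^{i\xi x}\,dx$. Smoothness measure $\Omega_l(f,t)_p$: If $d=1$, then $\Omega_l(f,t)_p=\omega_l(f,t)_p=\sup_{|h|\le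 t}\|\Delta_h^l f\|_{L^p(\mathbb{R})}$, where $\Delta_hf(x)=f(x+h)-f(x)$ and $\Delta_h^l=\Delta_h^{l-1}\Delta_h$. If $d\ge2$, then $\Omega_l(f,t)_p=\|f-V_{l,t}f\|_{L^p(\mathbb{R}^d)}$, where $$V_{l,t}f(x)=\frac{-2}{\binom{2l}{l}}\sum_{j=1}^l(-1)^j\binom{2l}{l-j}V_{jt}f(x),\qquad V_tf(x)=\frac1{m_t}\int_{|y-x|=t}f(y)\,dy,$$ the latter being the average of $f$ over the sphere of radius $t$ centred at $x$ with respect to surface measure, normalized so that $V_t1=1$. $1/p+1/p'=1$. $A\lesssim B$ means $A\le KB$ with a constant $K>0$ depending only on $d,l,p$ and on the constants $c,C$ in the $GM$ condition for $F_0$ (in particular not on $t$). *)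

(* Defs.v *)
From HB Require Import structures.
From mathcomp Require Import all_boot all_order all_algebra.
From mathcomp Require Import all_classical all_reals all_analysis.

Set Implicit Arguments.
Unset Strict Implicit.
Unset Printing Implicit Defensive.
Import Order.TTheory GRing.Theory Num.Theory.
Import numFieldNormedType.Exports.

Local Open Scope classical_set_scope.
Local Open Scope ring_scope.

Definition measure_rV_display : measure_display. Proof. exact. Qed.

(* The sigma-algebra on R^n generated by the n coordinates, i.e. the Borel one. *)
Section measurable_rV.
Context {R : realType} (n : nat).

Let coord : 'I_n -> 'rV[R]_n -> measurableTypeR R := fun i x => x ord0 i.

Let rV_set0 : g_sigma_preimage coord set0.
Proof. exact: sigma_algebra0. Qed.

Let rV_setC A : g_sigma_preimage coord A -> g_sigma_preimage coord (~` A).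
Proof. exact: sigma_algebraC. Qed.

Let rV_bigcup (F : _^nat) : (forall i, g_sigma_preimage coord (F i)) ->
  g_sigma_preimage coord (\bigcup_i (F i)).
Proof. exact: sigma_algebra_bigcup. Qed.

HB.instance Definition _ := @isMeasurable.Build measure_rV_display
  'rV[R]_n (g_sigma_preimage coord) rV_set0 rV_setC rV_bigcup.

End measurable_rV.

Lemma measurable_coord (R : realType) n (i : 'I_n) :
  measurable_fun [set: 'rV[R]_n] (fun x => x ord0 i).
Proof.
move=> _ Y mY; rewrite setTI; apply: sub_sigma_algebra => /=.
rewrite -bigcup_seq/=; exists i => /=; first by rewrite mem_index_enum.
by exists Y => //; rewrite setTI.
Qed.

Lemma measurable_fun_coordP d (T : measurableType d) (R : realType) n
    (f : T -> 'rV[R]_n) :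
  (forall i, measurable_fun [set: T] (fun x => f x ord0 i)) ->
  measurable_fun [set: T] f.
Proof.
move=> mf; apply: (@measurability _ _ _ _ _ _
  (\big[setU/set0]_(i < n) preimage_set_system setT
     (fun x : 'rV[R]_n => x ord0 i : measurableTypeR R) measurable)) => //.
move=> _ [B + <-]; rewrite -bigcup_seq/= => -[i _ [C mC <-]].
by rewrite !setTI; have := mf i measurableT C mC; rewrite setTI.
Qed.

Section lebesgue_rV.
Context {R : realType} (n : nat).

Definition cons_rV (p : measurableTypeR R * 'rV[R]_n) : 'rV[R]_n.+1 :=
  \row_i oapp (p.2 ord0) p.1 (unlift ord0 i).

Definition uncons_rV (x : 'rV[R]_n.+1) : measurableTypeR R * 'rV[R]_n :=
  (x ord0 ord0, \row_i x ord0 (lift ord0 i)).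

Lemma cons_rVK : cancel cons_rV uncons_rV.
Proof.
move=> [a v]; rewrite /uncons_rV /cons_rV !mxE unlift_none/=; congr pair.
by apply/rowP => i; rewrite !mxE liftK.
Qed.

Lemma measurable_cons_rV : measurable_fun [set: _] cons_rV.
Proof.
apply: measurable_fun_coordP => i; apply: (eq_measurable_fun
    (fun p : measurableTypeR R * 'rV[R]_n => oapp (p.2 ord0) p.1 (unlift ord0 i))).
  by move=> p _; rewrite mxE.
case: (unlift ord0 i) => [j|]/=; last exact: measurable_fst.
exact: (measurableT_comp (measurable_coord j) measurable_snd).
Qed.

Lemma measurable_uncons_rV : measurable_fun [set: _] uncons_rV.
Proof.
apply: measurable_fun_pair; first exact: measurable_coord.
apply: measurable_fun_coordP => i; apply: (eq_measurable_fun
    (fun x : 'rV[R]_n.+1 => x ord0 (lift ord0 i))).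
  by move=> x _; rewrite mxE.
exact: measurable_coord.
Qed.

Variable mu : {sigma_finite_measure set 'rV[R]_n -> \bar R}.

Definition lebesgue_cons : set 'rV[R]_n.+1 -> \bar R :=
  pushforward (lebesgue_measure \x mu)%E cons_rV.

HB.instance Definition _ := Measure.copy lebesgue_cons
  (measure_function_pushforward__canonical__measure_function_Measure
     (lebesgue_measure \x mu)%E measurable_cons_rV).

Let sigma_finite_lebesgue_cons : sigma_finite setT lebesgue_cons.
Proof.
have [F TF Foo] : sigma_finite setT (lebesgue_measure \x mu)%E.
  by case: (lebesgue_integral_fubini.measure_function_Measure_isSigmaFinite__to__measure_function_isSigmaFinite
    lebesgue_measure mu).
exists (fun k => uncons_rV @^-1` F k).
  by rewrite -preimage_bigcup -TF preimage_setT.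
move=> k; have [mF Fk] := Foo k; split.
  by rewrite -[X in measurable X]setTI; exact: measurable_uncons_rV.
rewrite /lebesgue_cons /pushforward -comp_preimage.
by rewrite (_ : _ @^-1` _ = F k)//; apply/seteqP; split => p /=; rewrite cons_rVK.
Qed.

HB.instance Definition _ := Measure_isSigmaFinite.Build _ _ _ lebesgue_cons
  sigma_finite_lebesgue_cons.

End lebesgue_rV.

(* n-dimensional Lebesgue measure, as the n-fold product of lebesgue_measure *)
Fixpoint lebesgue_rV {R : realType} n :
    {sigma_finite_measure set 'rV[R]_n -> \bar R} :=
  match n with
  | 0 => \d_(0 : 'rV[R]_0)
  | n.+1 => lebesgue_cons (lebesgue_rV n)
  end.
Arguments lebesgue_rV {R} n.

(* the Euclidean norm; the library norm `|x| on 'rV is the sup norm *)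
Definition enorm {R : realType} n (x : 'rV[R]_n) : R :=
  Num.sqrt (\sum_(i < n) x ord0 i ^+ 2).

Section surface_measure.
Context {R : realType} (n : nat).

Definition unit_ball : set 'rV[R]_n := [set x | enorm x <= 1].

Definition direction (x : 'rV[R]_n) : 'rV[R]_n := (enorm x)^-1 *: x.

Lemma measurable_enorm :
  measurable_fun [set: 'rV[R]_n] (fun x => enorm x).
Proof.
apply: (eq_measurable_fun
    (fun x : 'rV[R]_n => (\sum_(i < n) x ord0 i ^+ 2) `^ 2^-1)).
  by move=> x _; rewrite powR12_sqrt//; apply: sumr_ge0 => i _; exact: sqr_ge0.
apply: (measurableT_comp (measurable_realfun.measurable_powR _)).
apply: measurable_sum => i; apply: measurable_realfun.measurable_funX; exact: measurable_coord.
Qed.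

Lemma measurable_unit_ball : measurable unit_ball.
Proof.
rewrite (_ : unit_ball = setT `&` (fun x => enorm x) @^-1` `]-oo, 1]).
  exact: measurable_enorm.
by rewrite setTI; apply/seteqP; split => x; rewrite /unit_ball /= in_itv.
Qed.

Lemma measurable_direction : measurable_fun [set: _] direction.
Proof.
apply: measurable_fun_coordP => i; apply: (eq_measurable_fun
    (fun x : 'rV[R]_n => enorm x `^ (-1) * x ord0 i)).
  by move=> x _; rewrite mxE powR_inv1// sqrtr_ge0.
apply: measurable_realfun.measurable_funM; last exact: measurable_coord.
exact: (measurableT_comp (measurable_realfun.measurable_powR _) measurable_enorm).
Qed.

(* The surface measure sigma of the unit sphere S^(n-1), carried by the ambient
   space: sigma A = n * |{x in the unit ball : x/|x| in A}|.  The junk value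
   direction 0 = 0 only concerns a null set, for n >= 1. *)
Definition surface_measure : set 'rV[R]_n -> \bar R :=
  mscale n%:R%:nng (measure_function_pushforward__canonical__measure_function_Measure
     (mrestr (lebesgue_rV n) measurable_unit_ball) measurable_direction).

HB.instance Definition _ := Measure.on surface_measure.

End surface_measure.
Arguments surface_measure {R} n.

Section special_functions.
Context {R : realType}.
Implicit Types a z t : R.

Definition Gamma a : R :=
  \int[lebesgue_measure]_(s in `]0, +oo[) (s `^ (a - 1) * expR (- s)).

(* J_a(t) for t > 0 *)
Definition besselJ a t : R := limn (series (fun k : nat =>
  (-1) ^+ k / (k`!%:R * Gamma (k%:R + a + 1)) * (t / 2) `^ (k.*2%:R + a))).

Definition besselj a t : R := Gamma (a + 1) * (t / 2) `^ (- a) * besselJ a t.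

End special_functions.

Section general_monotone.
Context {R : realType}.
Implicit Types (F g : R -> R) (a b z c C : R).
Local Open Scope ereal_scope.

(* \int_z^oo |dF| *)
Definition tail_variation F z : \bar R :=
  ereal_sup [set total_variation z b F | b in `[z, +oo[].

(* \int_a^b g |dF| for g >= 0: the supremum over the partitions
   a = x_0 < ... < x_m = b of the lower Darboux-Stieltjes sums
   \sum_i (inf_[x_i, x_(i+1)] g) * total_variation x_i x_(i+1) F. *)
Definition int_variation g F a b : \bar R :=
  ereal_sup [set \sum_(i < size s)
      (inf [set g x | x in `[nth b (a :: s) i, nth b s i]])%:E
        * total_variation (nth b (a :: s) i) (nth b s i) F
    | s in [set s | itv_partition a b s]].

(* \int_a^oo g |dF| *)
Definition tail_int_variation g F a : \bar R :=
  ereal_sup [set int_variation g F a b | b in `[a, +oo[].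

(* the class GM on ]0, +oo[, with constants c and C; the values of F on
   ]-oo, 0] play no role *)
Definition general_monotone c C F :=
  [/\ forall a b, (0 < a)%R -> (a <= b)%R -> bounded_variation a b F,
      F s @[s --> +oo%R] --> 0%R &
      forall z, (0 < z)%R ->
        let I := \int[lebesgue_measure]_(u in `](z / c)%R, +oo[) (`|F u| / u)%:E in
        tail_variation F z <= C%:E * I /\ I < +oo].

End general_monotone.

Section GMhat.
Context {R : realType} (d : nat).
Implicit Types (c C : R) (F : R -> R) (f : 'rV[R]_d -> R).

(* |S^(d-1)| *)
Definition sphere_area : R := fine (surface_measure d [set: 'rV[R]_d]).

(* f belongs to the hatted class GM^d, F being the radial component of its
   Fourier transform and c, C the constants of the GM condition for F.  The
   formula says nothing about f at the origin. *)
Definition GMhat c C F f :=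
  [/\ general_monotone c C F,
      (\int[lebesgue_measure]_(s in `]0%R, 1%R]) (s ^+ d.-1 * `|F s|)%:E
        + tail_int_variation (fun s => s `^ (d.-1%:R / 2))%R F 1%R < +oo)%E &
      exists2 f0 : R -> R, (forall x : 'rV[R]_d, x != 0 -> f x = f0 (enorm x)) &
        forall z : R, 0 < z ->
          sphere_area / (2 * pi) ^+ d *
            (\int[lebesgue_measure]_(s in `]0, N])
               (F s * besselj (d%:R / 2 - 1) (z * s) * s ^+ d.-1))
          @[N --> +oo] --> f0 z].

End GMhat.

Section smoothness.
Context {R : realType} (d : nat).
Implicit Types (f : 'rV[R]_d -> R) (x h : 'rV[R]_d) (t p : R) (l : nat).

Definition difference h f x : R := f (x + h) - f x.

Definition modulus_of_smoothness l f t p : \bar R :=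
  ereal_sup [set 'N[lebesgue_rV d]_p%:E[EFin \o iter l (difference h) f]%E
            | h in [set h | enorm h <= t]].

(* \int_{|y - x| = t} f(y) dy against surface measure, with y = x + t w *)
Definition sphere_integral f x t : R :=
  t ^+ d.-1 * \int[surface_measure d]_w f (x + t *: w).

Definition sphere_mean t f x : R :=
  (sphere_integral (cst 1) x t)^-1 * sphere_integral f x t.

Definition sphere_mean_comb l t f x : R :=
  (- 2) / 'C(2 * l, l)%:R *
    \sum_(1 <= j < l.+1) (-1) ^+ j * 'C(2 * l, l - j)%:R
      * sphere_mean (j%:R * t) f x.

Definition Omega l f t p : \bar R :=
  if d == 1%N then modulus_of_smoothness l f t p
  else 'N[lebesgue_rV d]_p%:E[EFin \o (f \- sphere_mean_comb l t f)%R]%E.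

End smoothness.

(* Main.v *)
Require Import Defs.
From HB Require Import structures.
From mathcomp Require Import all_boot all_order all_algebra.
From mathcomp Require Import all_classical all_reals all_analysis.
From mathcomp Require Import measurable_realfun ring lra.

Set Implicit Arguments.
Unset Strict Implicit.
Unset Printing Implicit Defensive.
Import Order.TTheory GRing.Theory Num.Theory.
Import numFieldNormedType.Exports.

Local Open Scope classical_set_scope.
Local Open Scope ring_scope.

(** The function f is tested against Gaussians.  Truncating the Fourier integral of
f at N and letting N tend to infinity gives, for every a > 0 and y,
  \int f(x) e^(-a |x-y|^2) dx = kappa \int_0^oo F(s) W_a(s) j(s |y|) ds,
  W_a(s) = (pi/a)^(d/2) e^(-s^2/4a) s^(d-1);
the limit is dominated once the Gaussian is multiplied by (1 - e^(-k |x|^2))^d, and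
this factor is removed by letting k tend to infinity.  Replacing f by its l-th
difference (d = 1, followed by a second l-th difference in y) or by f - V_(l,1/t) f
(d >= 2, y = 0) inserts under the right-hand integral a nonnegative multiplier that
is bounded below for s in [T, 2T], T >= t/c: it is (2 - 2 cos(sh))^l with h = 1/(cT),
respectively the spherical mean of (2 - 2 cos)^l up to a constant, which by Jensen is
at least (2 - 2 j(s/t))^l up to that constant.  Since F >= 0, Hoelder's inequality
with a = T^2 bounds \int_T^2T F(s)/s ds by a multiple of T^(-d/p') Omega_l(f,1/t)_p.
Summing over T = 2^k t/c, and using F(t) <= \int_t^oo |dF| <= C \int_(t/c)^oo F(s)/s ds,
gives the claim. *)

(** f is only an improper integral, so no pointwise inversion is at hand; Gaussians have positive
    transforms, which keeps the sign of F usable after integration. The truncated integrals are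
    bounded uniformly in N by parts against F: the weight s^((d-1)/2) on |dF| matches the decay
    j'(v) = O(v^(-(d-1)/2)), which an energy argument on Bessel's equation provides. The resulting
    bound, of order |x|^(-d-1) near 0 in the form used, is not integrable there; hence the damping.
    Expanded binomially, the damped Gaussian is a sum of Gaussians with parameters a + k i, and
    those with i > 0 contribute nothing in the limit. For d = 1 one l-th difference alone produces
    (e^(ish) - 1)^l, which has no sign; the second one, with step -h, turns it into its squared
    modulus and costs only 2^l. There h must follow the block, since cos returns to 1; for d >= 2
    the radius 1/t serves all blocks, because j stays away from 1 on [1/c, oo). With a = T^2 the
    weight W_a(s) is comparable to 1/s on [T, 2T], so the blocks add up to the integral in the GM
    condition. *)

(** * Affine changes of variables in R^n *)

Section affine_change.
Context {R : realType}.
Implicit Types (r : R).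
Local Notation leb := (@lebesgue_measure R).
Local Open Scope ereal_scope.

Let aff r v : measurableTypeR R -> measurableTypeR R := fun x => (r * x + v)%R.

Let measurable_aff r v : measurable_fun setT (aff r v).
Proof.
apply: (@measurable_funD _ _ _ _ (fun x => r * x)%R) => //.
exact: measurable_funM.
Qed.

(** The image of Lebesgue measure under x -> r x + v determines, after scaling, a measure giving
    every interval its length, and Lebesgue measure is the only such measure. *)
Lemma ge0_integral_affine1 r v (h : R -> \bar R) : (0 < r)%R ->
  measurable_fun setT h -> (forall x, 0 <= h x) ->
  \int[leb]_x h x = r%:E * \int[leb]_x h (r * x + v)%R.
Proof.
move=> r0 mh h0; have r00 := ltW r0.
pose pf : {measure set (measurableTypeR R) -> \bar R} :=
  measure_function_pushforward__canonical__measure_function_Measure leb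
    (measurable_aff r v).
transitivity (\int[mscale (NngNum r00) pf]_x h x).
  apply: eq_measure_integral => A mA _.
  apply: (@lebesgue_measure_unique R (mscale (NngNum r00) pf)) => //.
  move=> _ [[a b] _ <-] /=.
  rewrite /mscale/= /pushforward.
  rewrite (_ : aff r v @^-1` _ = `](a - v) / r, (b - v) / r]%classic)%R; last first.
    apply/seteqP; split => x /=; rewrite !in_itv/= /aff ltr_pdivrMr// ler_pdivlMr//;
      by rewrite ltrBlDr lerBrDr (mulrC r).
  rewrite !lebesgue_measure_itv/= !lte_fin ltr_pM2r ?invr_gt0// ltrD2r.
  case: ifPn => ab; last by rewrite mule0.
  by rewrite -!EFinD -EFinM; congr EFin; field; rewrite gt_eqF.
rewrite ge0_integral_mscale//= ge0_integral_pushforward//.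
Qed.

Lemma ge0_integral_cons n (h : 'rV[R]_n.+1 -> \bar R) :
  measurable_fun setT h -> (forall x, 0 <= h x) ->
  \int[lebesgue_rV n.+1]_x h x =
  \int[leb]_a \int[lebesgue_rV n]_x h (cons_rV (a, x)).
Proof.
move=> mh h0.
have mc := @measurable_cons_rV R n.
transitivity (\int[(leb \x lebesgue_rV n)%E]_p h (cons_rV p)).
  by rewrite [LHS](ge0_integral_pushforward mc (leb \x lebesgue_rV n)%E measurableT).
by rewrite fubini_tonelli1//; exact: measurableT_comp.
Qed.

Lemma measurable_affine_rV n r (v : 'rV[R]_n) :
  measurable_fun setT (fun x : 'rV[R]_n => (r *: x + v)%R).
Proof.
apply: measurable_fun_coordP => i.
apply: (eq_measurable_fun (fun x : 'rV[R]_n => r * x ord0 i + v ord0 i)%R).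
  by move=> x _; rewrite !mxE.
apply: measurable_funD => //; apply: measurable_funM => //.
exact: measurable_coord.
Qed.

(** Induction on the dimension: Tonelli peels off the first coordinate, which is the one-dimensional
    case, and the induction hypothesis handles the remaining ones, the translation being split
    accordingly. *)
Lemma ge0_integral_affine n r (v : 'rV[R]_n) (h : 'rV[R]_n -> \bar R) :
  (0 < r)%R -> measurable_fun setT h -> (forall x, 0 <= h x) ->
  \int[lebesgue_rV n]_x h x = (r ^+ n)%:E * \int[lebesgue_rV n]_x h (r *: x + v)%R.
Proof.
move=> r0; elim: n v h => [|n IH] v h mh h0.
  rewrite expr0 mul1e; apply: eq_integral => x _.
  by congr h; apply/rowP; case.
have mc : measurable_fun setT (h \o @cons_rV R n).
  exact: (measurableT_comp mh (@measurable_cons_rV R n)).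
have mha := measurableT_comp mh (measurable_affine_rV r v).
rewrite !ge0_integral_cons//.
set v' : 'rV[R]_n := (\row_i v ord0 (lift ord0 i))%R.
have consE (a : R) x : (r *: cons_rV (a, x) + v = cons_rV (r * a + v ord0 ord0, r *: x + v') :> 'rV__)%R.
  apply/rowP => i; rewrite !mxE; case: unliftP => [j|] ->/=; by rewrite ?mxE.
have IHa (a : measurableTypeR R) : \int[lebesgue_rV n]_x h (cons_rV (a, x)) =
    (r ^+ n)%:E * \int[lebesgue_rV n]_x h (cons_rV (a, r *: x + v')%R).
  apply: (IH v' (fun x => h (cons_rV (a, x)))) => //.
  by apply: (measurableT_comp mc); exact: measurable_pair1.
under eq_integral do rewrite IHa.
pose G (a : measurableTypeR R) := \int[lebesgue_rV n]_x h (cons_rV (a, r *: x + v')%R).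
have mG : measurable_fun setT G.
  apply: (@measurable_fun_fubini_tonelli_F _ _ (measurableTypeR R) _ _ (lebesgue_rV n)
    (fun p => h (cons_rV (p.1, r *: p.2 + v')%R))) => //.
  apply: (measurableT_comp mc (g := fun p : measurableTypeR R * 'rV[R]_n => (p.1, r *: p.2 + v')%R)).
  apply: measurable_fun_pair; first exact: measurable_fst.
  exact: (measurableT_comp (measurable_affine_rV r v') measurable_snd).
have G0 a : 0 <= G a by apply: integral_ge0.
rewrite ge0_integralZl//; last 2 first.
- by move=> a _; exact: G0.
- by rewrite lee_fin exprn_ge0// ltW.
rewrite (ge0_integral_affine1 (v ord0 ord0) r0 mG)// muleA -EFinM -exprSr.
by congr (_ * _); apply: eq_integral => a _; apply: eq_integral => x _; rewrite consE.
Qed.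

Lemma integrable_affine n r (v : 'rV[R]_n) (h : 'rV[R]_n -> R) : (0 < r)%R ->
  (lebesgue_rV n).-integrable setT (EFin \o h) ->
  (lebesgue_rV n).-integrable setT (EFin \o (fun x => h (r *: x + v)%R)).
Proof.
move=> r0 /integrableP[mh ih].
have mha := measurable_affine_rV r v.
apply/integrableP; split; first exact: (measurableT_comp mh).
rewrite (ge0_integral_affine v (h := fun x => `|(h x)%:E|) r0)// in ih; last first.
  exact: measurableT_comp.
apply: contraTT ih; rewrite -!leNgt !leye_eq => /eqP ->.
by rewrite gt0_muley// lte_fin exprn_gt0.
Qed.

Lemma Rintegral_affine n r (v : 'rV[R]_n) (h : 'rV[R]_n -> R) : (0 < r)%R ->
  (lebesgue_rV n).-integrable setT (EFin \o h) ->
  (\int[lebesgue_rV n]_x h x = r ^+ n * \int[lebesgue_rV n]_x h (r *: x + v))%R.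
Proof.
move=> r0 ih; have iha := integrable_affine v r0 ih.
have mh : measurable_fun setT (EFin \o h) by case/integrableP : ih.
rewrite /Rintegral [in LHS]integralE [in RHS]integralE.
have rn : (0 < r ^+ n)%R by rewrite exprn_gt0.
rewrite (ge0_integral_affine v (h := (EFin \o h)^\+) r0)//; last exact: measurable_funepos.
rewrite (ge0_integral_affine v (h := (EFin \o h)^\-) r0)//; last exact: measurable_funeneg.
have Ep : \int[lebesgue_rV n]_x (EFin \o h)^\+ (r *: x + v)%R =
    \int[lebesgue_rV n]_x (EFin \o (fun x => h (r *: x + v)%R))^\+ x.
  by apply: eq_integral => x _; rewrite !funeposE.
have En : \int[lebesgue_rV n]_x (EFin \o h)^\- (r *: x + v)%R =
    \int[lebesgue_rV n]_x (EFin \o (fun x => h (r *: x + v)%R))^\- x.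
  by apply: eq_integral => x _; rewrite !funenegE.
move: (integrable_fin_num measurableT iha); rewrite integralE => fn.
rewrite Ep En -muleBr//; first by rewrite fineM.
by apply: fin_num_adde_defl; rewrite fin_numN; exact: (integrable_neg_fin_num measurableT iha).
Qed.

End affine_change.

(** * Real-valued integrals: dominated convergence and Fubini *)

Section Rintegral_extra.
Context d (T : measurableType d) (R : realType) (mu : {measure set T -> \bar R}).
Implicit Types (D : set T) (f g : T -> R).

Lemma dominated_Rintegral_cvg D (fs : nat -> T -> R) f g : measurable D ->
  (forall k, measurable_fun D (fs k)) ->
  (forall x, D x -> fs ^~ x @ \oo --> f x) ->
  mu.-integrable D (EFin \o g) ->
  (forall k x, D x -> `|fs k x| <= g x) ->
  mu.-integrable D (EFin \o f) /\
  (fun k => \int[mu]_(x in D) fs k x) @ \oo --> \int[mu]_(x in D) f x.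
Proof.
move=> mD mfs fsf ig fsg.
have mf : measurable_fun D f by apply: (measurable_fun_cvg mfs).
have [|||//|//|if_ _ ifs] := @dominated_convergence _ T R mu D mD
    (fun k => EFin \o fs k) (EFin \o f) (EFin \o g).
- by move=> k; apply/measurable_EFinP.
- exact/measurable_EFinP.
- apply: aeW => x Dx; apply/fine_cvgP; split; first by near=> k.
  exact: fsf.
- by apply: aeW => x k Dx; rewrite lee_fin; exact: fsg.
split=> //; apply: fine_cvg; rewrite fineK//.
exact: integrable_fin_num.
Unshelve. all: by end_near. Qed.

Lemma Rintegral_indic D f : \int[mu]_(x in D) f x = \int[mu]_x (\1_D x * f x).
Proof.
rewrite Rintegral_mkcond; congr fine; apply: eq_integral => x _.
by rewrite patchE indicE; case: ifPn => _; rewrite ?mul1r ?mul0r.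
Qed.

Lemma integrable_indic_mul D f : measurable D ->
  mu.-integrable D (EFin \o f) <-> mu.-integrable setT (EFin \o (fun x => \1_D x * f x)).
Proof.
move=> mD; rewrite (integrable_mkcond _ mD); split; apply: eq_integrable => // x _ /=;
  rewrite patchE indicE; by case: ifPn => _; rewrite ?mul1r ?mul0r.
Qed.

Lemma integrable_le D f g : measurable D -> measurable_fun D f ->
  mu.-integrable D (EFin \o g) -> (forall x, D x -> `|f x| <= g x) ->
  mu.-integrable D (EFin \o f).
Proof.
move=> mD mf ig fg; apply: (le_integrable mD _ _ ig); first exact/measurable_EFinP.
by move=> x Dx; rewrite lee_fin (le_trans (fg x Dx))// ler_norm.
Qed.

Lemma integrable_measurable D f : mu.-integrable D (EFin \o f) -> measurable_fun D f.
Proof. by move=> /measurable_int/measurable_EFinP. Qed.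

Lemma integrable_mulC D f (k : R) : measurable D -> mu.-integrable D (EFin \o f) ->
  mu.-integrable D (EFin \o (fun x => k * f x)).
Proof. by move=> mD ih; apply: (eq_integrable mD _ _ _ (integrableZl mD k ih)). Qed.

Lemma EFin_Rintegral D f : measurable D -> mu.-integrable D (EFin \o f) ->
  (\int[mu]_(x in D) (f x)%:E)%E = (\int[mu]_(x in D) f x)%:E.
Proof. by move=> mD ih; rewrite /Rintegral fineK//; exact: (integrable_fin_num mD ih). Qed.

Lemma Rintegral_sum D (I : Type) (s : seq I) (F : I -> T -> R) : measurable D ->
  (forall i, mu.-integrable D (EFin \o F i)) ->
  mu.-integrable D (EFin \o (fun x => \sum_(i <- s) F i x)) /\
  \int[mu]_(x in D) (\sum_(i <- s) F i x) = \sum_(i <- s) \int[mu]_(x in D) F i x.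
Proof.
move=> mD iF; elim: s => [|i s [IH1 IH2]].
  split; first by apply: (eq_integrable mD _ _ _ (integrable0 mu D)) => x _ /=; rewrite big_nil.
  under eq_Rintegral do rewrite big_nil.
  by rewrite big_nil /Rintegral integral0.
split.
  apply: (eq_integrable mD _ _ _ (integrableD mD (iF i) IH1)) => x _ /=.
  by rewrite big_cons.
rewrite big_cons -IH2 -RintegralD//.
by apply: eq_Rintegral => x _; rewrite big_cons.
Qed.

End Rintegral_extra.

Section Rfubini.
Context d1 d2 (T1 : measurableType d1) (T2 : measurableType d2) (R : realType).
Variable m1 : {sigma_finite_measure set T1 -> \bar R}.
Variable m2 : {sigma_finite_measure set T2 -> \bar R}.
Implicit Types f : T1 * T2 -> R.

Lemma integrable_prod_le f g h : measurable_fun setT f ->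
  m1.-integrable setT (EFin \o g) -> m2.-integrable setT (EFin \o h) ->
  (forall x y, `|f (x, y)| <= g x * h y) ->
  (m1 \x m2)%E.-integrable setT (EFin \o f).
Proof.
move=> mf ig ih fgh.
apply/integrable12ltyP; first exact/measurable_EFinP.
have mh := integrable_measurable ih; have mg := integrable_measurable ig.
pose H := (\int[m2]_y `|(h y)%:E|)%E.
have Hfin : H \is a fin_num.
  have /integrableP[_ lty] := ih.
  by rewrite ge0_fin_numE//; exact: integral_ge0.
apply: (@le_lt_trans _ _ (\int[m1]_x (`|(g x)%:E| * H))%E); last first.
  rewrite ge0_integralZr//; last 2 first.
  - by apply: measurableT_comp => //; exact/measurable_EFinP.
  - exact: integral_ge0.
  have /integrableP[_ lty] := ig.
  rewrite -(fineK Hfin) -(fineK (x := (\int[m1]_x _)%E)) -?EFinM ?ltry//.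
  by rewrite ge0_fin_numE//; exact: integral_ge0.
apply: ge0_le_integral => //.
- by move=> x _; exact: integral_ge0.
- apply: (measurable_fun_fubini_tonelli_F (fun z => `|(f z)%:E|)%E) => //.
  by apply: measurableT_comp => //; exact/measurable_EFinP.
- apply: emeasurable_funM => //; apply: measurableT_comp => //; exact/measurable_EFinP.
- move=> x _; rewrite -ge0_integralZl//; last 1 first.
  - by apply: measurableT_comp => //; exact/measurable_EFinP.
  apply: ge0_le_integral => //.
  + apply: measurableT_comp => //; apply/measurable_EFinP.
    exact: (measurableT_comp mf (measurable_pair1 x)).
  + apply: measurable_funeM.
    by apply: measurableT_comp => //; exact/measurable_EFinP.
  + by move=> y _; rewrite lee_fin -normrM (le_trans (fgh x y))// ler_norm.
Qed.

(** The real-valued inner integral agrees with the extended one only off the null set where a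
    section fails to be integrable; this is enough for the outer integrals. *)
Lemma Rintegral_fubini f : (m1 \x m2)%E.-integrable setT (EFin \o f) ->
  m1.-integrable setT (EFin \o (fun x => \int[m2]_y f (x, y))) /\
  \int[m1]_x \int[m2]_y f (x, y) = \int[m2]_y \int[m1]_x f (x, y).
Proof.
move=> intf.
have iF := integrable_fubini_F intf.
have mF : measurable_fun setT (fubini_F m2 (EFin \o f)) by case/integrableP : iF.
have mG : measurable_fun setT (fubini_G m1 (EFin \o f)) by apply: (measurable_fubini_G intf).
have aeF : {ae m1, forall x, setT x -> fubini_F m2 (EFin \o f) x = (\int[m2]_y f (x, y))%:E}.
  have := ae_integrable1 intf; apply: filterS => x /= ix _.
  exact: EFin_Rintegral.
have aeG : {ae m2, forall y, setT y -> fubini_G m1 (EFin \o f) y = (\int[m1]_x f (x, y))%:E}.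
  have := ae_integrable2 intf; apply: filterS => x /= ix _.
  exact: EFin_Rintegral.
have mF' : measurable_fun setT (EFin \o (fun x => \int[m2]_y f (x, y))).
  by apply/measurable_EFinP; exact: (measurableT_comp (fine_measurable measurableT) mF).
have mG' : measurable_fun setT (EFin \o (fun y => \int[m1]_x f (x, y))).
  by apply/measurable_EFinP; exact: (measurableT_comp (fine_measurable measurableT) mG).
split.
  apply/integrableP; split=> //.
  have /integrableP[_] := iF; congr (_ < _)%E.
  apply: ae_eq_integral => //; [exact: measurableT_comp|exact: measurableT_comp|].
  by apply: filterS aeF => x /= E _; rewrite E.
have E1 := ae_eq_integral _ _ measurableT mF mF' aeF.
have E2 := ae_eq_integral _ _ measurableT mG mG' aeG.
by rewrite /Rintegral -E1 -E2; congr fine; exact: Fubini.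
Qed.

End Rfubini.

(** * Everywhere convergent power series *)

Section entire_series.
Context {R : realType}.
Implicit Types (a : R^nat) (x : R).

Definition entire a := forall x, cvgn (pseries a x).

Lemma entire_geometric_bound a (K : R) : entire a ->
  exists2 B : R, 0 <= B & forall k, `|a k * K ^+ k| <= B.
Proof.
move=> ea; have [M [_ MB]] := cvg_series_bounded (ea K).
exists (`|M| + 1) => [|k]; first by rewrite addr_ge0.
apply: MB => //.
by rewrite (le_lt_trans (ler_norm _))// ltrDl.
Qed.

Lemma entire_diffs a : entire a -> entire (pseries_diffs a).
Proof.
move=> ea x; apply: normed_cvg.
(* The factor 4 leaves room for k + 1 <= 2^k: the k-th term of the differentiated series is then at
   most (B / K) 2^(-k). *)
set K : R := 4 * (`|x| + 1).
have x1 : 0 < `|x| + 1 by rewrite ltr_wpDl.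
have K0 : 0 < K by rewrite mulr_gt0.
have [B B0 aB] := entire_geometric_bound K ea.
apply: (@series_le_cvg _ _ (geometric (B / K) 2^-1)) => [k|k|k|].
- by rewrite /= normr_ge0.
- by rewrite /= mulr_ge0// ?divr_ge0 ?exprn_ge0// ltW.
- rewrite /pseries_diffs /= !normrM normr_nat normrX.
  have xK : `|x| <= K / 4 by rewrite /K mulrC mulKf// lerDl.
  have ak : `|a k.+1| <= B / K ^+ k.+1.
    by rewrite ler_pdivlMr ?exprn_gt0// -[K in K ^+ _](gtr0_norm K0) -normrX -normrM.
  have k2 : (k.+1%:R : R) <= 2 ^+ k by rewrite -natrX ler_nat ltn_expl.
  apply: (@le_trans _ _ (2 ^+ k * (B / K ^+ k.+1) * (K / 4) ^+ k)).
    by rewrite ler_pM// ?mulr_ge0// ?ler_pM// lerXn2r// nnegrE// divr_ge0// ltW.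
  rewrite le_eqVlt; apply/orP; left; apply/eqP.
  rewrite exprS expr_div_n exprVn (_ : (4 : R) ^+ k = 2 ^+ k * 2 ^+ k); last first.
    by rewrite -exprMn -natrM.
  by field; rewrite gt_eqF//= !expf_neq0// gt_eqF.
- apply: is_cvg_geometric_series.
  by rewrite ger0_norm ?invr_ge0// invf_lt1// ltr1n.
Qed.

Lemma is_derive_pseries a x : entire a ->
  is_derive x (1 : R) (fun y => limn (pseries a y)) (limn (pseries (pseries_diffs a) x)).
Proof.
move=> ea; apply: (@pseries_snd_diffs _ _ (`|x| + 1)); [exact: ea|exact: entire_diffs| |].
- by do 2 apply: entire_diffs.
- by rewrite (lt_le_trans _ (ler_norm _))// ltrDl.
Qed.

(** The value at 0 gives [a 0]. The differentiated series vanishes identically as well, so the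
    induction hypothesis, general in [a], applies to it and yields the next coefficient. *)
Lemma pseries_eq0 a : (forall x, pseries a x @ \oo --> (0 : R)) -> forall k, a k = 0.
Proof.
move=> a0 k; elim: k a a0 => [|k IH] a a0.
  have /cvg_lim <- // := a0 0.
  apply/esym/cvg_lim => //; rewrite -(cvg_shiftn 1)/=.
  apply: cvg_near_cst; near=> m.
  rewrite /pseries /series/= addn1 big_nat_recl//= expr0 mulr1 big1 ?addr0// => i _.
  by rewrite expr0n mulr0.
have ea : entire a by move=> x; apply/cvg_ex; exists 0; exact: a0.
have : pseries_diffs a k = 0.
  apply: IH => x; have := is_derive_pseries x ea.
  rewrite (_ : (fun y => _) = cst 0); last by apply/funext => y; exact/cvg_lim.
  move=> [_]; rewrite derive_cst => E.
  rewrite [X in _ --> X]E; exact: entire_diffs.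
by move=> /eqP; rewrite mulf_eq0 pnatr_eq0/= => /eqP.
Unshelve. all: by end_near. Qed.

End entire_series.

(** * Normalized Bessel functions as entire functions of v^2 *)

Section bessel_series.
Context {R : realType} (n : nat).
Implicit Types (q v : R).

(* In dimension n + 1 the normalized Bessel function is j_((n-1)/2) v = bP (v^2),
   with [bP] entire; [bP1] and [bP2] are the derivatives of [bP]. *)
Fixpoint bcoef (k : nat) : R :=
  if k is k'.+1 then - bcoef k' / (k%:R * (4 * k'%:R + 2 * n.+1%:R)) else 1.

Arguments bcoef : simpl never.

Lemma bcoefS k : bcoef k.+1 = - bcoef k / (k.+1%:R * (4 * k%:R + 2 * n.+1%:R)).
Proof. by []. Qed.

Definition bP q : R := limn (pseries bcoef q).
Definition bP1 q : R := limn (pseries (pseries_diffs bcoef) q).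
Definition bP2 q : R := limn (pseries (pseries_diffs (pseries_diffs bcoef)) q).

Lemma bcoef_denom_gt0 k : 0 < 4 * k%:R + 2 * n.+1%:R :> R.
Proof. by rewrite ltr_wpDl// ?mulr_ge0// mulr_gt0. Qed.

Lemma bcoef_le k : `|bcoef k| <= k`!%:R^-1.
Proof.
elim: k => [|k IH]; first by rewrite fact0 normr1 invr1.
have d1 : 1 <= 4 * k%:R + 2 * n.+1%:R :> R.
  by rewrite -!natrM -natrD ler1n addn_gt0 muln_gt0 orbT.
rewrite bcoefS normrM normrN normfV normrM normr_nat (ger0_norm (le_trans ler01 d1)).
rewrite factS natrM [X in _ <= X]invfM [X in _ <= X]mulrC ler_pM//.
by rewrite invfM ler_piMr// invf_le1// (lt_le_trans ltr01 d1).
Qed.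

Lemma entire_bcoef : entire bcoef.
Proof.
move=> x; apply: normed_cvg.
apply: (@series_le_cvg _ _ (exp_coeff `|x|)) => [k|k|k|].
- by rewrite /= normr_ge0.
- exact: exp_coeff_ge0.
- by rewrite /= normrM normrX mulrC ler_wpM2l ?exprn_ge0// bcoef_le.
- exact: is_cvg_series_exp_coeff.
Qed.

Lemma is_derive_bP q : is_derive q (1 : R) bP (bP1 q).
Proof. exact: (is_derive_pseries q entire_bcoef). Qed.

Lemma is_derive_bP1 q : is_derive q (1 : R) bP1 (bP2 q).
Proof. exact: (is_derive_pseries q (entire_diffs entire_bcoef)). Qed.

(** This is Bessel's equation j'' + (n/v) j' + j = 0 in the variable q = v^2. *)
Lemma bP_ode q : 4 * q * bP2 q + 2 * n.+1%:R * bP1 q + bP q = 0.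
Proof.
have e0 := entire_bcoef; have e1 := entire_diffs e0; have e2 := entire_diffs e1.
(* The factor q raises the degree by one, so N terms of the second derivative go with N + 1 terms of
   the other two series; the combination is then exactly 0 for every N. *)
have : (fun N => 4 * q * pseries (pseries_diffs (pseries_diffs bcoef)) q N +
    2 * n.+1%:R * pseries (pseries_diffs bcoef) q (N + 1)%N + pseries bcoef q (N + 1)%N) @ \oo
   --> 4 * q * bP2 q + 2 * n.+1%:R * bP1 q + bP q.
  apply: cvgD; first apply: cvgD.
  - by apply: cvgMr; exact: (e2 q).
  - by apply: cvgMr; rewrite (cvg_shiftn 1 (pseries (pseries_diffs bcoef) q)); exact: (e1 q).
  - by rewrite (cvg_shiftn 1 (pseries bcoef q)); exact: (e0 q).
move=> /cvg_lim <- //.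
rewrite (_ : (fun _ => _) = cst 0) ?lim_cst//; apply/funext => N /=.
rewrite /pseries /series/= addn1; elim: N => [|N IH].
  rewrite big_nil mulr0 add0r !big_nat1 /pseries_diffs/= !expr0 bcoefS mulr0 add0r.
  rewrite /bcoef.
  by field; rewrite ?pnatr_eq0 /=.
rewrite big_nat_recr//= [in X in _ + X + _]big_nat_recr//= [in X in _ + _ + X]big_nat_recr//=.
have d0 k : (4 * k%:R + 2 * n.+1%:R != 0 :> R) by rewrite gt_eqF ?bcoef_denom_gt0.
have E : bcoef N.+1 = - (N.+2%:R * (4 * N.+1%:R + 2 * n.+1%:R)) * bcoef N.+2.
  have d1 := d0 N.+1.
  have k1 : N.+2%:R != 0 :> R by rewrite pnatr_eq0.
  rewrite (bcoefS N.+1); move: (bcoef N.+1) d1 k1 => b d1 k1.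
  by rewrite !mulNr mulrN opprK mulrC divfK// mulf_neq0.
set A2 := (X in 4 * q * X + _ + _) in IH; set A1 := (X in _ + 2 * n.+1%:R * X + _) in IH.
set A0 := (X in _ + X) in IH.
rewrite -/A1 -/A0 /pseries_diffs E exprS -/(pseries_diffs _ _).
rewrite (_ : \sum_(0 <= i < N) _ = A2)//.
rewrite (_ : pseries_diffs bcoef N.+1 = N.+2%:R * bcoef N.+2)//.
apply: etrans (_ : _ = 4 * q * A2 + 2 * n.+1%:R * A1 + A0) IH.
by rewrite -!(natr1 N.+1) -!(natr1 N); ring.
Qed.

End bessel_series.

(** * Differentiation rules and the mean value theorem *)

Section calculus.
Context {R : realType}.
Implicit Types (f g : R -> R) (x a b : R).

Lemma is_derive_add f g x a b : is_derive x (1 : R) f a -> is_derive x (1 : R) g b ->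
  is_derive x (1 : R) (fun y => f y + g y) (a + b).
Proof. exact: is_deriveD. Qed.

Lemma is_derive_mul f g x a b : is_derive x (1 : R) f a -> is_derive x (1 : R) g b ->
  is_derive x (1 : R) (fun y => f y * g y) (a * g x + f x * b).
Proof.
by move=> df dg; apply: is_derive_eq; rewrite /GRing.scale/= addrC mulrC.
Qed.

Lemma is_derive_mulC f k x a : is_derive x (1 : R) f a ->
  is_derive x (1 : R) (fun y => k * f y) (k * a).
Proof. by move=> df; apply: is_deriveZ. Qed.

Lemma is_derive_opp f x a : is_derive x (1 : R) f a ->
  is_derive x (1 : R) (fun y => - f y) (- a).
Proof. exact: is_deriveN. Qed.

Lemma is_derive_exprn k x : is_derive x (1 : R) (fun y => y ^+ k) (k%:R * x ^+ k.-1).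
Proof.
rewrite (_ : (fun y : R => y ^+ k) = id ^+ k); last first.
  by apply/funext => y; rewrite exprfctE.
apply: is_derive_eq.
by rewrite /GRing.scale/= mulr1.
Qed.

Lemma is_derive_chain f g x a b : is_derive (g x) (1 : R) f a -> is_derive x (1 : R) g b ->
  is_derive x (1 : R) (fun y => f (g y)) (a * b).
Proof. exact: is_derive1_comp. Qed.

Lemma is_derive_continuous f x a : is_derive x (1 : R) f a -> {for x, continuous f}.
Proof. by move=> [df _]; apply: differentiable_continuous; exact/derivable1_diffP. Qed.

Lemma is_derive_within f df (A : set R) : (forall x, A x -> is_derive x (1 : R) f (df x)) ->
  {within A, continuous f}.
Proof.
move=> h; apply: continuous_in_subspaceT => x /set_mem/h.
exact: is_derive_continuous.
Qed.

Lemma mean_value f df a b : a < b ->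
  (forall x, a <= x <= b -> is_derive x (1 : R) f (df x)) ->
  exists2 c, a < c < b & f b - f a = df c * (b - a).
Proof.
move=> ab h; have [|| c] := @MVT _ f df a b ab.
- by move=> x; rewrite in_itv/= => /andP[ax xb]; apply: h; rewrite !ltW.
- by apply: (@is_derive_within _ df) => x /=; rewrite in_itv/=; exact: h.
by rewrite in_itv/=; exists c.
Qed.

Lemma derive_le0_nincr f df a b : a <= b ->
  (forall x, a <= x <= b -> is_derive x (1 : R) f (df x)) ->
  (forall x, a <= x <= b -> df x <= 0) -> f b <= f a.
Proof.
rewrite le_eqVlt => /predU1P[->//|ab] h h0; have [c /andP[ac cb] E] := mean_value ab h.
by rewrite -subr_le0 E mulr_le0_ge0 ?h0 ?ltW// ?subr_gt0// !ltW.
Qed.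

End calculus.

(** * Energy estimates for Bessel's equation *)

Section bessel_energy.
Context {R : realType} (n : nat).
Implicit Types (q v : R).
Local Notation bP := (@bP R n).
Local Notation bP1 := (@bP1 R n).
Local Notation bP2 := (@bP2 R n).

Definition bj v : R := bP (v ^+ 2).
Definition bj1 v : R := 2 * v * bP1 (v ^+ 2).
Definition bj2 v : R := 2 * bP1 (v ^+ 2) + 4 * v ^+ 2 * bP2 (v ^+ 2).

Lemma is_derive_bj v : is_derive v (1 : R) bj (bj1 v).
Proof.
apply: is_derive_eq.
  exact: (is_derive_chain (g := fun y => y ^+ 2) (is_derive_bP n (v ^+ 2)) (is_derive_exprn 2 v)).
by rewrite /bj1 /= expr1 mulrC.
Qed.

Lemma is_derive_bj1 v : is_derive v (1 : R) bj1 (bj2 v).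
Proof.
apply: is_derive_eq.
  exact: (is_derive_mul (is_derive_mulC (f := id) 2 (is_derive_id v (1 : R)))
    (is_derive_chain (g := fun y => y ^+ 2) (is_derive_bP1 n (v ^+ 2)) (is_derive_exprn 2 v))).
by rewrite /bj2 /=; ring.
Qed.

Lemma bj_ode v : bj2 v = - bj v - 2 * n%:R * bP1 (v ^+ 2).
Proof.
have := bP_ode n (v ^+ 2); rewrite /bj2 /bj -natr1 => /eqP E.
by apply/eqP; rewrite -subr_eq0 -[X in _ == X](eqP E); apply/eqP; ring.
Qed.

(** By Bessel's equation the derivative of this quantity is -2 (n/v) j'^2, so it never increases. It
    yields |j| <= 1 and |j'| <= 1 and, for n > 0, a gap between j and 1 away from the origin. *)
Definition energy v : R := bj v ^+ 2 + bj1 v ^+ 2.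

Lemma is_derive_energy v :
  is_derive v (1 : R) energy (- (8 * n%:R * v * bP1 (v ^+ 2) ^+ 2)).
Proof.
apply: is_derive_eq.
  apply: is_derive_add.
    exact: (is_derive_chain (is_derive_exprn 2 (bj v)) (is_derive_bj v)).
  exact: (is_derive_chain (is_derive_exprn 2 (bj1 v)) (is_derive_bj1 v)).
by rewrite /= !expr1 bj_ode /bj1; ring.
Qed.

Lemma bP0 : bP 0 = 1.
Proof.
apply/cvg_lim => //; rewrite -(cvg_shiftn 1)/=.
apply: cvg_near_cst; near=> m.
rewrite /pseries /series/= addn1 big_nat_recl//= expr0 mulr1 big1 ?addr0// => i _.
by rewrite expr0n mulr0.
Unshelve. all: by end_near. Qed.

Lemma energy0 : energy 0 = 1.
Proof. by rewrite /energy /bj /bj1 expr0n/= bP0 mulr0 mul0r expr0n addr0 expr1n. Qed.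

Lemma energy_nincr v w : 0 <= v -> v <= w -> energy w <= energy v.
Proof.
move=> v0 vw; apply: (derive_le0_nincr vw (fun x _ => is_derive_energy x)) => x /andP[vx _].
by rewrite oppr_le0 mulr_ge0 ?sqr_ge0// mulr_ge0 ?(le_trans v0 vx)// mulr_ge0.
Qed.

Lemma energy_le1 v : 0 <= v -> energy v <= 1.
Proof. by move=> v0; rewrite -energy0 energy_nincr. Qed.

Lemma bP_le1 q : 0 <= q -> `|bP q| <= 1.
Proof.
move=> q0; have := energy_le1 (sqrtr_ge0 q).
rewrite /energy /bj sqr_sqrtr// => E.
have : bP q ^+ 2 <= 1 by rewrite (le_trans _ E)// lerDl sqr_ge0.
by rewrite -[X in X <= 1]real_normK ?num_real// expr_le1.
Qed.

Lemma bj1_le1 v : 0 <= v -> bj1 v ^+ 2 <= 1.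
Proof. by move=> v0; rewrite (le_trans _ (energy_le1 v0))// lerDr sqr_ge0. Qed.

Lemma bP1_0 : bP1 0 = - (2 * n.+1%:R)^-1.
Proof.
have := bP_ode n (0 : R); rewrite mulr0 mul0r add0r bP0 => /eqP.
rewrite addr_eq0 => /eqP E; apply: (@mulfI _ (2 * n.+1%:R)).
  by rewrite mulf_neq0 ?pnatr_eq0.
by rewrite E mulrN divff// mulf_neq0 ?pnatr_eq0.
Qed.

(** Since [bP1] is negative at 0, j' does not vanish just to the right of 0; the energy therefore
    drops strictly on a small interval [0, x] and cannot grow back. *)
Lemma energy_lt1 v : (0 < n)%N -> 0 < v -> energy v < 1.
Proof.
move=> n0 v0.
have b0 : bP1 0 < 0 by rewrite bP1_0 oppr_lt0 invr_gt0 mulr_gt0.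
have cb : {for 0, continuous bP1} by exact: is_derive_continuous (is_derive_bP1 n _).
have [e /= e0 eb] : \forall x \near nbhs (0 : R), bP1 x < 0.
  by move: cb => /cvgr_lt; exact.
(* The bound x <= 1 gives c^2 <= c for the mean value point c < x, so that c^2 stays in the
   neighbourhood where [bP1] is negative. *)
pose x := Num.min v (Num.min 1 (e / 2)).
have x0 : 0 < x by rewrite !lt_min v0 ltr01 divr_gt0.
have xv : x <= v by rewrite ge_min lexx.
have x1 : x <= 1 by rewrite !ge_min lexx orbT.
have xe : x <= e / 2 by rewrite !ge_min lexx !orbT.
rewrite (le_lt_trans (energy_nincr (ltW x0) xv))//.
have [c /andP[c0 cx]] := mean_value x0 (fun x _ => is_derive_energy x).
rewrite energy0 subr0 => E; rewrite -subr_lt0 E pmulr_llt0// oppr_lt0.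
have bc : bP1 (c ^+ 2) < 0.
  apply: eb; rewrite /= sub0r normrN ger0_norm ?sqr_ge0//.
  rewrite (@le_lt_trans _ _ (e / 2))//; last by rewrite ltr_pdivrMr// ltr_pMr// ltr1n.
  rewrite (le_trans _ xe)// expr2 (le_trans _ (ltW cx))// ler_piMl// ltW//.
  exact: lt_le_trans cx x1.
apply: mulr_gt0; last by rewrite exprn_even_gt0//= lt_eqF.
by rewrite !mulr_gt0 ?ltr0n.
Qed.

(** Source of the lower bound on the multiplier when d >= 2. In dimension one (n = 0) j is the
    cosine and no such gap exists. *)
Lemma bj_le1B v0 : (0 < n)%N -> 0 < v0 ->
  exists2 delta : R, 0 < delta & forall v, v0 <= v -> bj v <= 1 - delta.
Proof.
move=> n0 v00; exists ((1 - energy v0) / 2).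
  by rewrite divr_gt0// subr_gt0 energy_lt1.
move=> v v0v; have E := energy_nincr (ltW v00) v0v.
have : bj v ^+ 2 <= energy v0 by rewrite (le_trans _ E)// lerDl sqr_ge0.
have : 0 <= (bj v - 1) ^+ 2 by rewrite sqr_ge0.
rewrite sqrrB1; lra.
Qed.

(* Multiplied by [expR (n / v)], this quantity is nonincreasing for large v. *)
Definition energy2 v : R :=
  v ^+ n * (bj v ^+ 2 + bj1 v ^+ 2) + n%:R * (v ^+ n * v^-1 * (bj v * bj1 v)).

Lemma is_derive_energy2 v : 0 < v ->
  is_derive v (1 : R) energy2 (- (n%:R * (v ^+ n / v ^+ 2 * (bj v * bj1 v)))).
Proof.
move=> v0; have vn0 : v != 0 by rewrite gt_eqF.
apply: is_derive_eq.
  apply: is_derive_add.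
    apply: is_derive_mul; first exact: is_derive_exprn.
    exact: is_derive_energy.
  apply: is_derive_mulC; apply: is_derive_mul; last first.
    apply: is_derive_mul; [exact: is_derive_bj|exact: is_derive_bj1].
  apply: is_derive_mul; first exact: is_derive_exprn.
  exact: (@is_deriveV _ id v 1 1 vn0 (is_derive_id v 1)).
have -> : n%:R * v ^+ n.-1 = n%:R * v ^+ n / v.
  by case: (n) => [|k]; rewrite ?mul0r//= exprSr mulrA mulfK.
by rewrite /energy /GRing.scale/= bj_ode /bj1; field.
Qed.

(** Once n/v <= 1, the cross term (n/v) j j' is in absolute value at most half of j^2 + j'^2. *)
Lemma energy2_ge v : n.+1%:R <= v -> v ^+ n * (bj v ^+ 2 + bj1 v ^+ 2) <= 2 * energy2 v.
Proof.
move=> nv; have v0 : 0 < v by rewrite (lt_le_trans _ nv).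
have vn0 : 0 <= v ^+ n by rewrite exprn_ge0// ltW.
suff : 0 <= v ^+ n * ((bj v ^+ 2 + bj1 v ^+ 2) + 2 * (n%:R / v) * (bj v * bj1 v)).
  rewrite [X in 0 <= X -> _](_ : _ =
    2 * energy2 v - v ^+ n * (bj v ^+ 2 + bj1 v ^+ 2)); first by rewrite subr_ge0.
  by rewrite /energy2; field; rewrite gt_eqF.
apply: mulr_ge0 => //.
have : 0 <= n%:R / v <= 1.
  by rewrite divr_ge0 ?(ltW v0)// ler_pdivrMr// mul1r (le_trans _ nv)// ler_nat.
move: (n%:R / v) => r /andP[r0 r1].
rewrite (_ : _ + _ = r * (bj v + bj1 v) ^+ 2 + (1 - r) * (bj v ^+ 2 + bj1 v ^+ 2)).
  by rewrite addr_ge0// mulr_ge0 ?sqr_ge0 ?subr_ge0// addr_ge0// sqr_ge0.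
by ring.
Qed.

Lemma energy2_bounded : exists2 B : R, 0 < B & forall v, n.+1%:R <= v -> energy2 v <= B.
Proof.
pose T v : R := energy2 v * expR (n%:R * v^-1).
pose dT v : R := - (n%:R * (v ^+ n / v ^+ 2 * (bj v * bj1 v))) * expR (n%:R * v^-1) +
  energy2 v * (expR (n%:R * v^-1) * (n%:R * (- v ^- 2 * 1))).
have dTE v : 0 < v -> is_derive v (1 : R) T (dT v).
  move=> v0; apply: is_derive_mul; first exact: is_derive_energy2.
  apply: (is_derive_chain (g := fun y => n%:R * y^-1)); apply: is_derive_mulC.
  by apply: (@is_deriveV _ id v 1 1 _ (is_derive_id v 1)); rewrite gt_eqF.
exists (`|T n.+1%:R| + 1); first by rewrite ltr_wpDl.
move=> v nv; have n0 : 0 < n.+1%:R :> R by rewrite ltr0n.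
have v0 : 0 < v by rewrite (lt_le_trans _ nv).
have E0 : 0 <= energy2 v.
  rewrite -(@pmulr_rge0 _ 2)// (le_trans _ (energy2_ge nv))//.
  by rewrite mulr_ge0 ?exprn_ge0 ?(ltW v0)// addr_ge0// sqr_ge0.
have TE : energy2 v <= T v.
  by rewrite /T ler_peMr// -expR0 ler_expR divr_ge0// ltW.
rewrite (le_trans TE)// (@le_trans _ _ (T n.+1%:R))//; last first.
  by rewrite (le_trans (ler_norm _))// lerDl.
apply: (derive_le0_nincr nv) => x /andP[nx xv].
  by apply: dTE; rewrite (lt_le_trans _ nx).
have x0 : 0 < x by rewrite (lt_le_trans _ nx).
(* The last factor is nonnegative: 2 [energy2 x] >= x^n (j^2 + j'^2) >= -2 x^n j j'. *)
rewrite (_ : dT x = - (n%:R / x ^+ 2 * expR (n%:R * x^-1)) *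
    (energy2 x + x ^+ n * (bj x * bj1 x))); last first.
  by rewrite /dT; field; rewrite gt_eqF.
rewrite mulNr oppr_le0 mulr_ge0//.
  by rewrite mulr_ge0 ?expR_ge0// divr_ge0// exprn_ge0// ltW.
have := energy2_ge nx.
have xn0 : 0 <= x ^+ n by rewrite exprn_ge0// ltW.
have : 0 <= x ^+ n * (bj x + bj1 x) ^+ 2 by rewrite mulr_ge0 ?sqr_ge0.
have -> : x ^+ n * (bj x + bj1 x) ^+ 2 =
  x ^+ n * (bj x ^+ 2 + bj1 x ^+ 2) + 2 * (x ^+ n * (bj x * bj1 x)) by ring.
lra.
Qed.

(** The classical decay j'(v) = O(v^(-n/2)). For large v it is read off from [energy2]; below n + 1
    the bound |j'| <= 1 is enough. *)
Lemma bj1_decay : exists2 B : R, 0 < B & forall v, 0 <= v -> v ^+ n * bj1 v ^+ 2 <= B.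
Proof.
have [B B0 EB] := energy2_bounded.
exists (n.+1%:R ^+ n + 2 * B); first by rewrite ltr_wpDl// mulr_gt0.
move=> v v0; have [nv|vn] := leP n.+1%:R v.
  rewrite (@le_trans _ _ (2 * B))//; last by rewrite lerDr exprn_ge0.
  rewrite (@le_trans _ _ (2 * energy2 v)) ?ler_pM2l ?EB//.
  by rewrite (le_trans _ (energy2_ge nv))// ler_wpM2l ?exprn_ge0// lerDr sqr_ge0.
rewrite (@le_trans _ _ (n.+1%:R ^+ n))//; last by rewrite lerDl mulr_ge0// ltW.
rewrite -[leRHS]mulr1; apply: ler_pM.
- exact: exprn_ge0.
- exact: sqr_ge0.
- by rewrite lerXn2r ?nnegrE// ltW.
- exact: bj1_le1.
Qed.

End bessel_energy.

(** * Fundamental theorem of calculus and exhaustion of the half-line *)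

Section ftc.
Context {R : realType}.
Local Notation leb := (@lebesgue_measure R).
Implicit Types (f F : R -> R) (a b : R).

Lemma continuous_itv_integrable f a b : {within `[a, b], continuous f} ->
  leb.-integrable `[a, b] (EFin \o f).
Proof. by move=> cf; apply: continuous_compact_integrable => //; exact: segment_compact. Qed.

Lemma FTC_itv f F a b : a < b -> (forall x, a <= x <= b -> is_derive x (1 : R) F (f x)) ->
  {within `[a, b], continuous f} ->
  (\int[leb]_(x in `[a, b]) (f x)%:E = (F b - F a)%:E)%E.
Proof.
move=> ab dF cf; rewrite (continuous_FTC2 ab cf (F := F)).
- by rewrite EFinB.
- split.
  + by move=> x; rewrite in_itv/= => /andP[ax xb]; have [] := dF x _; rewrite ?ltW.
  + apply: cvg_at_right_filter; apply: (@is_derive_continuous R F a (f a)).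
    by apply: dF; rewrite lexx ltW.
  + apply: cvg_at_left_filter; apply: (@is_derive_continuous R F b (f b)).
    by apply: dF; rewrite lexx ltW.
- move=> x; rewrite in_itv/= => /andP[ax xb]; rewrite derive1E.
  by have /dF[_ ->] : a <= x <= b by rewrite !ltW.
Qed.

Lemma RFTC_itv f F a b : a < b -> (forall x, a <= x <= b -> is_derive x (1 : R) F (f x)) ->
  {within `[a, b], continuous f} ->
  \int[leb]_(x in `[a, b]) f x = F b - F a.
Proof. by move=> ab dF cf; rewrite /Rintegral (FTC_itv ab dF cf). Qed.

Definition exhaust (k : nat) : set R := `[k.+1%:R^-1, k.+1%:R]%classic.

Lemma ge0_integral_exhaust (f : R -> \bar R) : measurable_fun (`]0, +oo[ : set R) f ->
  (forall x, 0 < x -> (0 <= f x)%E) ->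
  (fun k => \int[leb]_(x in exhaust k) f x)%E @ \oo --> (\int[leb]_(x in `]0%R, +oo[) f x)%E.
Proof.
move=> mf f0.
have sub k : exhaust k `<=` `]0, +oo[.
  move=> x; rewrite /exhaust /= !in_itv/= andbT => /andP[kx _].
  by rewrite (lt_le_trans _ kx).
have -> : `]0, +oo[%classic = \bigcup_k exhaust k.
  apply/seteqP; split => [x|x [k _]]; last exact: sub.
  rewrite /= in_itv/= andbT => x0.
  have x1 := truncnS_gt (Num.max x x^-1).
  exists (Num.truncn (Num.max x x^-1)) => //.
  rewrite /exhaust /= in_itv/=; move: x1; rewrite gt_max => /andP[x1 x2].
  rewrite (ltW x1) andbT invf_ple ?posrE//.
  exact: ltW.
apply: ge0_nondecreasing_set_cvg_integral.
- move=> k l kl; apply/subsetPset => x; rewrite /exhaust /= !in_itv/= => /andP[kx xk].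
  by rewrite (le_trans _ kx) ?lef_pV2 ?posrE ?ler_nat ?ltnS// (le_trans xk)// ler_nat ltnS.
- by move=> k; exact: measurable_itv.
- by move=> k; exact: measurable_funS mf.
- by move=> k x /sub/=; rewrite in_itv/= andbT; exact: f0.
Qed.

End ftc.

(** * The Gamma function at half-integers *)

Section gamma.
Context {R : realType}.
Local Notation leb := (@lebesgue_measure R).
Implicit Types (x s : R).

(** Extended-valued, because in [Gamma] a divergent integral would be replaced by the value 0 of
    [fine]; finiteness is established afterwards, at half-integers. *)
Definition eGamma x : \bar R :=
  (\int[leb]_(s in `]0%R, +oo[) (s `^ (x - 1) * expR (- s))%:E)%E.

Lemma fine_eGamma x : fine (eGamma x) = Gamma x. Proof. by []. Qed.

Lemma gamma_integrand_ge0 x s : 0 <= s `^ x * expR (- s).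
Proof. by rewrite mulr_ge0 ?powR_ge0 ?expR_ge0. Qed.

Lemma measurable_gamma_integrand x (D : set R) : measurable D ->
  measurable_fun D (fun s => s `^ x * expR (- s)).
Proof.
move=> mD; apply: measurable_funTS; apply: measurable_funM; first exact: measurable_powR.
by apply: measurableT_comp.
Qed.

Lemma eGamma_ge0 x : (0 <= eGamma x)%E.
Proof. by apply: integral_ge0 => s _; rewrite lee_fin gamma_integrand_ge0. Qed.

Lemma is_derive_expRN s : is_derive s (1 : R) (fun s => expR (- s)) (- expR (- s)).
Proof.
have := is_derive_chain (g := -%R) (is_derive_expR (- s)) (is_derive_opp (f := id) (is_derive_id s (1 : R))).
by rewrite mulrN mulr1.
Qed.

Lemma continuous_gamma_integrand x a b : 0 < a ->
  {within `[a, b], continuous (fun s => s `^ x * expR (- s))}.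
Proof.
move=> a0; apply: (@is_derive_within _ _ (fun s => x * s `^ (x - 1) * expR (- s) + s `^ x * - expR (- s))).
move=> s; rewrite /= in_itv/= => /andP[as_ _].
apply: is_derive_mul; last exact: is_derive_expRN.
by apply: is_derive1_powR; rewrite (lt_le_trans a0).
Qed.

Lemma expr_expRN_le (N k : nat) : k.+1%:R ^+ N * expR (- k.+1%:R) <= N.+1`!%:R * k.+1%:R^-1 :> R.
Proof.
have k0 : 0 < k.+1%:R :> R by rewrite ltr0n.
have := expR_ge1Dxn N (ltW k0).
rewrite expRN => h; rewrite ler_pdivrMr ?expR_gt0// mulrAC ler_pdivlMr// -exprSr.
rewrite mulrC -ler_pdivrMr ?ltr0n ?fact_gt0//.
by rewrite (le_trans _ h)// lerDr.
Qed.

Lemma powR_expRN_cvg0 x :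
  (fun k => k.+1%:R `^ x * expR (- k.+1%:R) : R) @ \oo --> (0 : R).
Proof.
set N := (Num.truncn x).+1.
have xN : x <= N%:R by rewrite ltW// truncnS_gt.
apply: (@squeeze_cvgr _ _ _ _ (cst 0) (fun k => N.+1`!%:R * k.+1%:R^-1)).
- apply: nearW => k; rewrite gamma_integrand_ge0/=.
  rewrite (le_trans _ (expr_expRN_le N k))// ler_wpM2r ?expR_ge0//.
  by rewrite -powR_mulrn// ler_powR// ler1n.
- exact: cvg_cst.
- rewrite -[X in _ --> X](mulr0 (N.+1`!%:R)); apply: cvgMr; exact: cvg_harmonic.
Qed.

Lemma powR_inv_cvg0 x : 0 < x ->
  (fun k => k.+1%:R^-1 `^ x * expR (- k.+1%:R^-1) : R) @ \oo --> (0 : R).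
Proof.
move=> x0; apply: (@squeeze_cvgr _ _ _ _ (cst 0) (fun k => k.+1%:R^-1 `^ x)).
- apply: nearW => k; rewrite gamma_integrand_ge0/= ler_piMr ?powR_ge0//.
- exact: cvg_cst.
- have /cvg_at_rightP := powR_cvg0 x0; apply; split => [k|]; first by rewrite invr_gt0.
  exact: cvg_harmonic.
Qed.

(** Integration by parts on compact intervals, both boundary terms tending to 0. The identity [E] is
    written without subtracting integrals, so the limit may be taken before the integrals are known
    to be finite. *)
Lemma eGammaS x : 0 < x -> (eGamma (x + 1) = x%:E * eGamma x)%E.
Proof.
move=> x0.
pose f s : R := s `^ x * expR (- s); pose g s : R := s `^ (x - 1) * expR (- s).
(* For k = 0 the interval is the single point 1, to which the fundamental theorem of calculus does
   not apply. *)
have E k : (0 < k)%N -> (\int[leb]_(s in exhaust k) (f s)%:E + (f k.+1%:R - f k.+1%:R^-1)%:E =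
    x%:E * \int[leb]_(s in exhaust k) (g s)%:E)%E.
  move=> k0.
  have kk : k.+1%:R^-1 < k.+1%:R :> R.
    rewrite (@lt_trans _ _ 1)// ?ltr1n// invf_lt1 ?ltr0n// ltr1n//.
  have ki : 0 < k.+1%:R^-1 :> R by rewrite invr_gt0.
  have If := continuous_itv_integrable (@continuous_gamma_integrand x _ k.+1%:R ki).
  have Ig := continuous_itv_integrable (@continuous_gamma_integrand (x - 1) _ k.+1%:R ki).
  have cf : {within `[k.+1%:R^-1, k.+1%:R : R], continuous (fun s => x * g s - f s)}.
    move=> s; apply: cvgB; first apply: cvgMr.
      exact: continuous_gamma_integrand.
    exact: continuous_gamma_integrand.
  rewrite /exhaust -(FTC_itv kk _ cf (F := f)); last first.
    move=> s /andP[ks _]; have s0 : 0 < s by rewrite (lt_le_trans _ ks).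
    have := is_derive_mul (is_derive1_powR x s0) (is_derive_expRN s).
    by congr is_derive; rewrite /g /f; ring.
  rewrite -integralZl//.
  under [in X in (_ + X)%E]eq_integral do rewrite EFinB EFinM.
  rewrite integralB//; last first.
    by apply: integrableZl; [exact: measurable_itv|exact: Ig].
  by rewrite addeC subeK// integrable_fin_num.
have c1 := ge0_integral_exhaust (f := EFin \o f).
have c2 := ge0_integral_exhaust (f := EFin \o g).
have {}c1 : (fun k => \int[leb]_(s in exhaust k) (f s)%:E + (f k.+1%:R - f k.+1%:R^-1)%:E)%E
    @ \oo --> (eGamma (x + 1) + 0)%E.
  apply: cvgeD; first by rewrite fin_num_adde_defl.
    rewrite /eGamma addrK; apply: c1.
      by apply/measurable_EFinP; exact: measurable_gamma_integrand.
    by move=> s _; rewrite lee_fin gamma_integrand_ge0.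
  apply/fine_cvgP; split; first exact: nearW.
  rewrite -[X in _ --> X](subr0 0); apply: cvgB; first exact: powR_expRN_cvg0.
  exact: powR_inv_cvg0.
have {}c2 : (fun k => x%:E * \int[leb]_(s in exhaust k) (g s)%:E)%E @ \oo --> (x%:E * eGamma x)%E.
  apply: cvgeZl => //; apply: c2.
    by apply/measurable_EFinP; exact: measurable_gamma_integrand.
  by move=> s _; rewrite lee_fin gamma_integrand_ge0.
rewrite adde0 in c1; apply: cvg_unique c1 _; first exact: ereal_hausdorff.
apply: cvg_trans c2; apply: near_eq_cvg; exists 1%N => // k /= k1.
by rewrite E.
Qed.

Lemma eGamma1 : eGamma 1 = 1%E.
Proof.
pose g s : R := s `^ (1 - 1) * expR (- s).
have c2 := ge0_integral_exhaust (f := EFin \o g).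
have {}c2 : (fun k => \int[leb]_(s in exhaust k) (g s)%:E)%E @ \oo --> eGamma 1.
  apply: c2; first by apply/measurable_EFinP; exact: measurable_gamma_integrand.
  by move=> s _; rewrite lee_fin gamma_integrand_ge0.
apply: cvg_unique c2 _; first exact: ereal_hausdorff.
have c : (fun k => (expR (- k.+1%:R^-1) - expR (- k.+1%:R) : R)%:E) @ \oo --> 1%E.
  apply/fine_cvgP; split; first exact: nearW.
  rewrite [X in _ --> X](_ : _ = expR (- 0) - 0); last by rewrite subr0 oppr0 expR0.
  apply: cvgB.
    exact: (cvg_comp (fun k => - k.+1%:R^-1) expR (cvgN cvg_harmonic) (@continuous_expR R (- 0))).
  have := powR_expRN_cvg0 0; apply: cvg_trans; apply: near_eq_cvg.
  by apply: nearW => k /=; rewrite powRr0 mul1r.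
apply: cvg_trans c; apply: near_eq_cvg; exists 1%N => // k /= k1.
have kk : k.+1%:R^-1 < k.+1%:R :> R.
  by rewrite (@lt_trans _ _ 1)// ?ltr1n// invf_lt1 ?ltr0n// ltr1n.
transitivity (- expR (- k.+1%:R : R) - - expR (- k.+1%:R^-1))%:E; first by rewrite opprK addrC.
apply/esym/(@FTC_itv R g (fun s => - expR (- s)) _ _ kk).
- move=> s /andP[ks _]; have := is_derive_opp (is_derive_expRN s).
  by rewrite opprK /g subrr powRr0 mul1r.
- by apply: continuous_gamma_integrand; rewrite invr_gt0.
Qed.

(** Since sqrt s <= 1 + s, Gamma(3/2) is at most Gamma(1) + Gamma(2); the functional equation brings
    this back to 1/2. *)
Lemma eGamma_half_lty : (eGamma 2^-1 < +oo)%E.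
Proof.
have E : (eGamma (2^-1 + 1) = 2^-1%:E * eGamma 2^-1)%E by rewrite eGammaS// invr_gt0.
have : (eGamma (2^-1 + 1) < +oo)%E.
  apply: (@le_lt_trans _ _ (eGamma 1 + eGamma (1 + 1))%E).
    rewrite /eGamma -ge0_integralD//; first last.
    - by apply/measurable_EFinP; exact: measurable_gamma_integrand.
    - by move=> s _; rewrite lee_fin gamma_integrand_ge0.
    - by apply/measurable_EFinP; exact: measurable_gamma_integrand.
    - by move=> s _; rewrite lee_fin gamma_integrand_ge0.
    apply: ge0_le_integral => //.
    - by move=> s _; rewrite lee_fin gamma_integrand_ge0.
    - by apply/measurable_EFinP; exact: measurable_gamma_integrand.
    - apply/measurable_EFinP; apply: measurable_funD; exact: measurable_gamma_integrand.
    - move=> s /=; rewrite in_itv/= andbT => s0.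
      rewrite lee_fin -mulrDl ler_wpM2r ?expR_ge0// !addrK subrr powRr0 powRr1 ?ltW//.
      rewrite powR12_sqrt ?ltW//.
      have := sqr_sqrtr (ltW s0); have := sqrtr_ge0 s; nra.
  by rewrite eGammaS// eGamma1 mule1 -EFinD ltry.
rewrite E; have := eGamma_ge0 2^-1; case: (eGamma _) => [r| |]//= _; first by rewrite !ltry.
by rewrite gt0_muley ?lte_fin ?invr_gt0.
Qed.

Lemma eGamma_gt0 x : 1 <= x -> (0 < eGamma x)%E.
Proof.
move=> x1; apply: (@lt_le_trans _ _ (\int[leb]_(s in `[1%R, 2%R]) (expR (- 2))%:E)%E).
  rewrite integral_cst//= lebesgue_measure_itv/= lte_fin ltr1n/= -EFinB -EFinM lte_fin.
  by rewrite mulr_gt0 ?expR_gt0//; lra.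
apply: (@le_trans _ _ (\int[leb]_(s in `[1%R, 2%R]) (s `^ (x - 1) * expR (- s))%:E)%E).
  apply: ge0_le_integral => //.
  - by apply/measurable_EFinP; exact: measurable_gamma_integrand.
  - move=> s /=; rewrite in_itv/= => /andP[s1 s2].
    rewrite lee_fin -[leLHS]mul1r ler_pM ?expR_ge0// ?ler_expR ?lerN2//.
    by rewrite -[X in X <= _](powRr0 s) ler_powR// subr_ge0.
apply: ge0_subset_integral => //.
- by apply/measurable_EFinP; exact: measurable_gamma_integrand.
- by move=> s _; rewrite lee_fin gamma_integrand_ge0.
- by move=> s /=; rewrite !in_itv/= andbT => /andP[s1 _]; rewrite (lt_le_trans _ s1).
Qed.

Lemma eGamma_half j : (eGamma (j.+1%:R / 2) < +oo)%E.
Proof.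
elim/ltn_ind: j => -[_|[_|j IH]].
- by rewrite div1r eGamma_half_lty.
- by rewrite divff// eGamma1 ltry.
have -> : j.+3%:R / 2 = j.+1%:R / 2 + 1 :> R by rewrite -addn2 natrD; field.
rewrite eGammaS ?divr_gt0//; have := IH j (leqW (leqnn _)); have := eGamma_ge0 (j.+1%:R / 2).
by case: (eGamma _) => [r| |]//= _ _; rewrite -EFinM ltry.
Qed.

Lemma eGamma_halfE j : eGamma (j.+1%:R / 2) = (Gamma (j.+1%:R / 2))%:E.
Proof. by rewrite -fine_eGamma fineK// ge0_fin_numE ?eGamma_ge0 ?eGamma_half. Qed.

Lemma Gamma_halfS j : Gamma (j.+1%:R / 2 + 1) = j.+1%:R / 2 * Gamma (j.+1%:R / 2 : R).
Proof.
by rewrite -fine_eGamma eGammaS ?divr_gt0// eGamma_halfE -EFinM.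
Qed.

(** [eGamma_gt0] asks for an argument at least 1, hence the detour through the shifted value. *)
Lemma Gamma_half_gt0 j : 0 < Gamma (j.+1%:R / 2 : R).
Proof.
have h : 0 < Gamma (j.+1%:R / 2 + 1 : R).
  have := @eGamma_gt0 (j.+1%:R / 2 + 1).
  rewrite (_ : j.+1%:R / 2 + 1 = j.+3%:R / 2); last by rewrite -(addn2 j.+1) natrD; field.
  rewrite eGamma_halfE lte_fin; apply.
  by rewrite ler_pdivlMr// mul1r ler_nat.
by move: h; rewrite Gamma_halfS pmulr_rgt0// divr_gt0.
Qed.

End gamma.

(** * Agreement with the series defining the Bessel functions *)

Section besselj_series.
Context {R : realType} (n : nat).
Local Notation alpha := (n.+1%:R / 2 - 1 : R).

Let half_index i : i%:R + alpha + 1 = (n + i.*2).+1%:R / 2 :> R.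
Proof. by rewrite -addSn natrD -mul2n natrM; field. Qed.

(** The functional equation of Gamma turns the explicit coefficients of the series of J into the
    recursion satisfied by [bcoef]. *)
Lemma bcoef_Gamma k : (-1) ^+ k / (k`!%:R * Gamma (k%:R + alpha + 1)) * Gamma (alpha + 1) / 4 ^+ k =
  bcoef n k :> R.
Proof.
have gE := half_index.
elim: k => [|k IH].
  have g0 := Gamma_half_gt0 (R := R) n.
  rewrite !expr0 fact0 add0r subrK divr1 mul1r mul1r mulVf//.
  by rewrite gt_eqF.
rewrite bcoefS -IH.
have -> : k.+1%:R + alpha + 1 = (k%:R + alpha + 1) + 1 by rewrite -natr1; ring.
have -> : alpha + 1 = 0%:R + alpha + 1 by rewrite add0r.
rewrite !gE Gamma_halfS addn0 factS natrM !exprS.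
have g0 := Gamma_half_gt0 (R := R) (n + k.*2).
have E2 : (n + k.*2).+1%:R = 2 * k%:R + n.+1%:R :> R.
  by rewrite -addSn natrD -mul2n natrM; ring.
rewrite E2 in g0 *.
have d0 := bcoef_denom_gt0 (R := R) n k.
have d1 : 0 < 2 * k%:R + n.+1%:R :> R by rewrite ltr_wpDl// mulr_ge0.
have F0 : k`!%:R != 0 :> R by rewrite pnatr_eq0 -lt0n fact_gt0.
have Q0 : 4 ^+ k != 0 :> R by rewrite expf_neq0// pnatr_eq0.
move: (Gamma _) g0 (k`!%:R) (4 ^+ k) F0 Q0 => G g0 F Q F0 Q0.
field; rewrite !nat1r.
by rewrite F0 Q0 (gt_eqF d0) (gt_eqF d1) (gt_eqF g0) pnatr_eq0.
Qed.

Lemma besseljE v : 0 < v -> besselj alpha v = bP n (v ^+ 2).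
Proof.
move=> v0; have v20 : 0 < v / 2 by rewrite divr_gt0.
rewrite /besselj /besselJ /bP.
have c := @entire_bcoef R n (v ^+ 2).
have -> : series (fun k : nat => (-1) ^+ k / (k`!%:R * Gamma (k%:R + alpha + 1)) *
    (v / 2) `^ (k.*2%:R + alpha)) = (fun N => (Gamma (alpha + 1) * (v / 2) `^ (- alpha))^-1 *
      pseries (bcoef n) (v ^+ 2) N).
  apply/funext => N; rewrite /pseries /series/= mulr_sumr; apply: eq_bigr => k _.
  rewrite -bcoef_Gamma powRD; last by apply/implyP => _; rewrite gt_eqF.
  rewrite powRN powR_mulrn ?ltW// -mul2n exprM expr_div_n.
  have p0 : (v / 2) `^ alpha != 0 by rewrite gt_eqF// powR_gt0.
  have g0 : Gamma (alpha + 1) != 0 by rewrite subrK gt_eqF// Gamma_half_gt0.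
  have -> : (2 : R) ^+ 2 = 4 by rewrite expr2 -natrM.
  have G0 : Gamma (k%:R + alpha + 1) != 0 by rewrite half_index gt_eqF// Gamma_half_gt0.
  have F0 : k`!%:R != 0 :> R by rewrite pnatr_eq0 -lt0n fact_gt0.
  have Q0 : 4 ^+ k != 0 :> R by rewrite expf_neq0// pnatr_eq0.
  rewrite expr_div_n.
  move: (Gamma (k%:R + _ + 1)) (k`!%:R) (4 ^+ k) G0 F0 Q0 => G F Q G0 F0 Q0.
  by field; rewrite G0 F0 Q0 p0 g0.
have p0 : (v / 2) `^ alpha != 0 by rewrite gt_eqF// powR_gt0.
have g0 : Gamma (alpha + 1) != 0 by rewrite subrK gt_eqF// Gamma_half_gt0.
set K := Gamma (alpha + 1) * _.
have cM : (fun N => K^-1 * pseries (bcoef n) (v ^+ 2) N) @ \oo -->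
    K^-1 * limn (pseries (bcoef n) (v ^+ 2)) by apply: cvgMr; exact: c.
rewrite (cvg_lim _ cM)//.
by rewrite /K mulVKf// mulf_neq0// powRN invr_neq0.
Qed.

End besselj_series.

(** * Termwise integration of exponential-type series *)

Section gaussian_moments.
Context {R : realType}.
Local Notation leb := (@lebesgue_measure R).

Lemma series_mulC (c : R) (u : R^nat) :
  series (fun k => c * u k) = fun N => c * series u N.
Proof. by apply/funext => N; rewrite /series mulr_sumr. Qed.

Lemma series_even (b : R^nat) (l : R) : series b @ \oo --> l ->
  series (fun k => if odd k then 0 else b k./2) @ \oo --> l.
Proof.
move=> bl; set e := fun k => _.
have E N : series e N = series b (uphalf N).
  elim: N => [|N IH]; first by rewrite /series/= !big_nil.
  rewrite /series/= big_nat_recr//= -[X in X + _]/(series e N) IH /e.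
  rewrite uphalf_half; case: (odd N) => /=; first by rewrite addr0 add1n.
  by rewrite add0n /series/= big_nat_recr.
rewrite (_ : series e = series b \o uphalf); last by apply/funext => N; rewrite E.
apply: (cvg_comp uphalf (series b) _ bl) => A [N _ NA].
exists N.*2 => // k /= Nk; apply: NA => /=.
by rewrite -(doubleK N) (leq_trans (half_leq Nk))// uphalf_half leq_addl.
Qed.

Lemma exp_partial_sum_le (b : R^nat) (t : R) N : (forall k, `|b k| <= 1) ->
  `|\sum_(0 <= k < N) b k * (t ^+ k / k`!%:R)| <= expR t + expR (- t).
Proof.
move=> b1; apply: (@le_trans _ _ (expR `|t|)); last first.
  by case: (ler0P t) => _; rewrite ?lerDl ?lerDr expR_ge0.
rewrite (le_trans (ler_norm_sum _ _ _))//.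
apply: (@le_trans _ _ (series (exp_coeff `|t|) N)).
  rewrite /series/=; apply: ler_sum => k _.
  apply: (@le_trans _ _ `|t ^+ k / k`!%:R|); first by rewrite normrM ler_piMl.
  by rewrite normrM normrX [X in _ * X]ger0_norm.
apply: nondecreasing_cvgn_le; last exact: is_cvg_series_exp_coeff.
apply/nondecreasing_seqP => k; rewrite /series/= big_nat_recr//= lerDl.
by rewrite exp_coeff_ge0.
Qed.

(** Serves for exp, cos and sin alike, for Gaussian integrals as well as on the sphere: coefficients
    of modulus at most 1 keep every partial sum below e^X + e^(-X), which dominates the exchange of
    sum and integral. *)
Lemma Rintegral_exp_series d (T : measurableType d) (mu : {measure set T -> \bar R})
    (b : R^nat) (B : R -> R) (X g : T -> R) :
  (forall k, `|b k| <= 1) ->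
  (forall t, series (fun k => b k * (t ^+ k / k`!%:R)) @ \oo --> B t) ->
  measurable_fun setT X -> (forall x, 0 <= g x) -> measurable_fun setT g ->
  mu.-integrable setT (EFin \o (fun x => (expR (X x) + expR (- X x)) * g x)) ->
  (forall k, mu.-integrable setT (EFin \o (fun x => X x ^+ k * g x))) /\
  mu.-integrable setT (EFin \o (fun x => B (X x) * g x)) /\
  series (fun k => b k * ((\int[mu]_x (X x ^+ k * g x)) / k`!%:R)) @ \oo -->
    \int[mu]_x (B (X x) * g x).
Proof.
move=> b1 bB mX g0 mg ig.
have F0 k : 0 < k`!%:R :> R by rewrite ltr0n fact_gt0.
have mXk k : measurable_fun setT (fun x => X x ^+ k * g x).
  by apply: measurable_funM => //; exact: measurable_funX.
have iX k : mu.-integrable setT (EFin \o (fun x => X x ^+ k * g x)).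
  apply: (integrable_le measurableT (mXk k) (integrable_mulC k`!%:R measurableT ig)) => x _.
  rewrite normrM [X in _ * X](ger0_norm (g0 x)) mulrA ler_wpM2r//.
  (* The coefficient sequence concentrated at k bounds the single monomial X^k / k!. *)
  have := @exp_partial_sum_le (fun i => (i == k)%:R) (X x) k.+1 _.
  rewrite big_nat_recr//= eqxx mul1r big1_seq ?add0r; last first.
    move=> i /=; rewrite mem_index_iota => /andP[_ ik].
    by rewrite ltn_eqF ?mul0r.
  rewrite normrM normfV [X in _ / X]ger0_norm ?(ltW (F0 k))// ler_pdivrMr// mulrC; apply => i.
  by case: eqP => _; rewrite ?normr1 ?normr0.
split=> //.
pose fs N x := \sum_(0 <= k < N) b k * (X x ^+ k / k`!%:R) * g x.
have E N x : fs N x = (\sum_(0 <= k < N) b k * (X x ^+ k / k`!%:R)) * g x.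
  by rewrite mulr_suml.
have ifs k : mu.-integrable setT (EFin \o (fun x => b k * (X x ^+ k / k`!%:R) * g x)).
  apply: (eq_integrable measurableT _ _ _ (integrable_mulC (b k / k`!%:R) measurableT (iX k))) => x _ /=.
  by congr EFin; ring.
have iE k : \int[mu]_x (b k * (X x ^+ k / k`!%:R) * g x) =
    b k * ((\int[mu]_x (X x ^+ k * g x)) / k`!%:R).
  transitivity (\int[mu]_x (b k / k`!%:R * (X x ^+ k * g x))); last first.
    by rewrite RintegralZl// mulrAC mulrA.
  by apply: eq_Rintegral => x _; move: (k`!%:R^-1) => c; ring.
have [] := @dominated_Rintegral_cvg _ T R mu setT fs (fun x => B (X x) * g x)
    (fun x => (expR (X x) + expR (- X x)) * g x) measurableT _ _ ig _.
- move=> N; apply: (integrable_measurable (mu := mu)).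
  by have [] := Rintegral_sum (index_iota 0 N) measurableT ifs.
- move=> x _; rewrite (_ : fs ^~ x = fun N => series (fun k => b k * (X x ^+ k / k`!%:R)) N * g x).
    by apply: cvgMl; exact: bB.
  by apply/funext => N; rewrite E.
- move=> N x _; rewrite E normrM [X in _ * X](ger0_norm (g0 x)) ler_wpM2r//.
  exact: exp_partial_sum_le.
move=> iB cB; split=> //; apply: cvg_trans cB; apply: near_eq_cvg; apply: nearW => N /=.
have [_ ->] := Rintegral_sum (index_iota 0 N) measurableT ifs.
by rewrite /series/=; apply: eq_bigr => k _; rewrite iE.
Qed.

End gaussian_moments.

(** * The Gaussian in R^n *)

Section gaussian.
Context {R : realType} {n : nat}.
Implicit Types (x u v : 'rV[R]_n).
Local Notation leb := (@lebesgue_measure R).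
Local Notation lebn := (@lebesgue_rV R n).

Definition nsq x : R := \sum_(i < n) x ord0 i ^+ 2.
Definition dot u x : R := \sum_(i < n) u ord0 i * x ord0 i.
Definition gauss x : R := expR (- nsq x).

Lemma nsq_ge0 x : 0 <= nsq x.
Proof. by apply: sumr_ge0 => i _; exact: sqr_ge0. Qed.

Lemma nsqD x v : nsq (x + v) = nsq x + 2 * dot v x + nsq v.
Proof.
rewrite /nsq /dot mulr_sumr -!big_split/=; apply: eq_bigr => i _.
by rewrite !mxE; ring.
Qed.

Lemma nsqZ r x : nsq (r *: x) = r ^+ 2 * nsq x.
Proof. by rewrite /nsq mulr_sumr; apply: eq_bigr => i _; rewrite !mxE exprMn. Qed.

Lemma dotZl r u x : dot (r *: u) x = r * dot u x.
Proof. by rewrite /dot mulr_sumr; apply: eq_bigr => i _; rewrite !mxE mulrA. Qed.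

Lemma dotZr r u x : dot u (r *: x) = r * dot u x.
Proof. by rewrite /dot mulr_sumr; apply: eq_bigr => i _; rewrite !mxE mulrCA. Qed.

Lemma dotDr u x v : dot u (x + v) = dot u x + dot u v.
Proof. by rewrite /dot -big_split/=; apply: eq_bigr => i _; rewrite !mxE mulrDr. Qed.

Lemma dotC u x : dot u x = dot x u.
Proof. by rewrite /dot; apply: eq_bigr => i _; rewrite mulrC. Qed.

Lemma enorm_sqr x : enorm x ^+ 2 = nsq x.
Proof. by rewrite sqr_sqrtr// nsq_ge0. Qed.

Lemma enorm_ge0 x : 0 <= enorm x.
Proof. exact: sqrtr_ge0. Qed.

Lemma enormZ r x : 0 <= r -> enorm (r *: x) = r * enorm x.
Proof.
move=> r0; rewrite /enorm -/(nsq _) nsqZ sqrtrM ?sqr_ge0//.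
by rewrite sqrtr_sqr ger0_norm.
Qed.

Lemma measurable_nsq : measurable_fun setT nsq.
Proof.
by apply: measurable_sum => i; apply: measurable_funX; exact: measurable_coord.
Qed.

Lemma measurable_dot u : measurable_fun setT (dot u).
Proof.
by apply: measurable_sum => i; apply: measurable_funM => //; exact: measurable_coord.
Qed.

Lemma measurable_gauss : measurable_fun setT gauss.
Proof. by apply: measurableT_comp => //; apply: measurableT_comp => //; exact: measurable_nsq. Qed.

Lemma gauss_ge0 x : 0 <= gauss x. Proof. exact: expR_ge0. Qed.

End gaussian.

Lemma nsq_cons {R : realType} n (a : measurableTypeR R) (x : 'rV[R]_n) :
  nsq (cons_rV (a, x)) = a ^+ 2 + nsq x.
Proof.
rewrite /nsq big_ord_recl !mxE unlift_none/=; congr (_ + _).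
by apply: eq_bigr => i _; rewrite mxE liftK.
Qed.

Lemma integral_gauss {R : realType} n :
  (\int[lebesgue_rV n]_x (gauss x : R)%:E = (Num.sqrt pi ^+ n)%:E)%E.
Proof.
elim: n => [|n IH].
  rewrite expr0 /= integral_dirac//=.
    by rewrite diracT mul1e /gauss /nsq big_ord0 oppr0 expR0.
  by apply/measurable_EFinP; exact: measurable_gauss.
rewrite ge0_integral_cons; first last.
- by move=> x; rewrite lee_fin gauss_ge0.
- by apply/measurable_EFinP; exact: measurable_gauss.
transitivity (\int[@lebesgue_measure R]_a ((gauss_fun a)%:E * (Num.sqrt pi ^+ n)%:E))%E.
  apply: eq_integral => a _; rewrite -IH -ge0_integralZl//.
  - by apply: eq_integral => x _; rewrite /gauss nsq_cons opprD expRD EFinM.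
  - by apply/measurable_EFinP; exact: measurable_gauss.
  - by move=> x _; rewrite lee_fin gauss_ge0.
  - by rewrite lee_fin gauss_fun_ge0.
rewrite ge0_integralZr//.
- by rewrite integralT_gauss -EFinM -exprS.
- by apply/measurable_EFinP; exact: measurable_gauss_fun.
- by move=> x _; rewrite lee_fin gauss_fun_ge0.
Qed.

(** * Moments and Fourier transform of the Gaussian *)

Section gaussian_transforms.
Context {R : realType} {n : nat}.
Implicit Types (x u v : 'rV[R]_n).
Local Notation lebn := (@lebesgue_rV R n).
Local Notation G0 := (Num.sqrt pi ^+ n : R).

Lemma integrable_gauss : lebn.-integrable setT (EFin \o gauss).
Proof.
apply/integrableP; split; first by apply/measurable_EFinP; exact: measurable_gauss.
under eq_integral do rewrite /= ger0_norm ?gauss_ge0//.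
by rewrite integral_gauss ltry.
Qed.

Lemma gauss_shift u x : expR (dot u x) * gauss x =
  expR (nsq u / 4) * gauss (1 *: x - 2^-1 *: u).
Proof.
rewrite /gauss -!expRD; congr expR.
by rewrite scale1r -scaleNr nsqD nsqZ dotZl; field.
Qed.

Lemma integrable_gauss_mgf u : lebn.-integrable setT (EFin \o (fun x => expR (dot u x) * gauss x)).
Proof.
have := integrable_mulC (expR (nsq u / 4)) measurableT
  (integrable_affine (- (2^-1 *: u)) ltr01 integrable_gauss).
by apply: eq_integrable => // x _ /=; rewrite gauss_shift.
Qed.

Lemma gauss_mgf u : \int[lebn]_x (expR (dot u x) * gauss x) = G0 * expR (nsq u / 4).
Proof.
under eq_Rintegral do rewrite gauss_shift.
have ia := integrable_affine (- (2^-1 *: u)) ltr01 integrable_gauss.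
rewrite RintegralZl// mulrC; congr (_ * _).
have := Rintegral_affine (- (2^-1 *: u)) ltr01 integrable_gauss.
by rewrite expr1n mul1r => <-; rewrite /Rintegral integral_gauss.
Qed.

Lemma integrable_gauss_cosh u : lebn.-integrable setT
  (EFin \o (fun x => (expR (dot u x) + expR (- dot u x)) * gauss x)).
Proof.
apply: (eq_integrable measurableT _ _ _
  (integrableD measurableT (integrable_gauss_mgf u) (integrable_gauss_mgf (- 1 *: u)))) => x _ /=.
by rewrite dotZl mulN1r -EFinD mulrDl.
Qed.

Lemma expr_series (t : R) : series (fun k => cst 1 k * (t ^+ k / k`!%:R)) @ \oo --> expR t.
Proof.
rewrite (_ : (fun k => _) = exp_coeff t); first exact: is_cvg_series_exp_coeff.
by apply/funext => i; rewrite mul1r.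
Qed.

Lemma integrable_gauss_moment u k : lebn.-integrable setT (EFin \o (fun x => dot u x ^+ k * gauss x)).
Proof.
have [||+ _] := @Rintegral_exp_series R _ _ lebn (cst 1) expR (dot u) gauss
  _ expr_series (measurable_dot _) _ measurable_gauss (integrable_gauss_cosh _); last exact.
- by move=> i; rewrite normr1.
- exact: gauss_ge0.
Qed.

(** Both sides are the k-th coefficient, in powers of r, of the integral of e^(r u.x) against the
    Gaussian, which [gauss_mgf] gives in closed form; the coefficients are unique by
    [pseries_eq0]. *)
Lemma gauss_moment u k : \int[lebn]_x (dot u x ^+ k * gauss x) / k`!%:R =
  if odd k then 0 else G0 * ((nsq u / 4) ^+ k./2 / k./2`!%:R).
Proof.
pose h k := \int[lebn]_x (dot u x ^+ k * gauss x) / k`!%:R.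
pose e k := if odd k then 0 else G0 * ((nsq u / 4) ^+ k./2 / k./2`!%:R).
apply/eqP; rewrite -subr_eq0; apply/eqP.
apply: (pseries_eq0 (a := fun k => h k - e k)) => r.
have [||_ [_]] := @Rintegral_exp_series R _ _ lebn (cst 1) expR (dot (r *: u)) gauss
  _ expr_series (measurable_dot _) _ measurable_gauss (integrable_gauss_cosh _).
- by move=> i; rewrite normr1.
- exact: gauss_ge0.
rewrite gauss_mgf nsqZ => c1.
have {}c1 : pseries h r @ \oo --> G0 * expR (r ^+ 2 * nsq u / 4).
  apply: cvg_trans c1; apply: near_eq_cvg; apply: nearW => N; congr (series _ N).
  apply/funext => i; rewrite /= mul1r /h mulrAC.
  congr (_ / _); rewrite [RHS]mulrC -RintegralZl//; last exact: integrable_gauss_moment.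
  by apply: eq_Rintegral => x _; rewrite dotZl exprMn mulrA.
have c2 : pseries e r @ \oo --> G0 * expR (r ^+ 2 * nsq u / 4).
  have /series_even : series (fun k => G0 * exp_coeff (r ^+ 2 * nsq u / 4) k) @ \oo -->
      G0 * expR (r ^+ 2 * nsq u / 4).
    rewrite series_mulC.
    by apply: cvgMr; exact: is_cvg_series_exp_coeff.
  apply: cvg_trans; apply: near_eq_cvg; apply: nearW => N; congr (series _ N).
  apply/funext => i; rewrite /= /e; case: ifPn => oi; first by rewrite mul0r.
  have -> : r ^+ i = (r ^+ 2) ^+ i./2 by rewrite -exprM mul2n even_halfK.
  rewrite /exp_coeff/= (_ : r ^+ 2 * nsq u / 4 = r ^+ 2 * (nsq u / 4)); last by rewrite mulrA.
  by rewrite exprMn; move: (_`!%:R^-1) => F; ring.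
rewrite (_ : pseries _ r = fun N => pseries h r N - pseries e r N).
  by rewrite -[X in _ --> X](subrr (G0 * expR (r ^+ 2 * nsq u / 4))); apply: cvgB.
apply/funext => N; rewrite /pseries /series/= -sumrB.
by apply: eq_bigr => i _; rewrite mulrBl.
Qed.

Definition cos_sgn (k : nat) : R := (~~ odd k)%:R * (-1) ^ k./2.
Definition sin_sgn (k : nat) : R := (odd k)%:R * (-1) ^+ k.-1./2.

Lemma cos_sgn_le1 k : `|cos_sgn k| <= 1.
Proof. by rewrite /cos_sgn normrM -exprnP normrX normrN1 expr1n mulr1; case: (odd k); rewrite ?normr0 ?normr1. Qed.

Lemma sin_sgn_le1 k : `|sin_sgn k| <= 1.
Proof. by rewrite /sin_sgn normrM normrX normrN1 expr1n mulr1; case: (odd k); rewrite ?normr0 ?normr1. Qed.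

Lemma cos_series (t : R) : series (fun k => cos_sgn k * (t ^+ k / k`!%:R)) @ \oo --> cos t.
Proof.
rewrite unlock /= (_ : (fun k => _) = cos_coeff t); first exact: is_cvg_series_cos_coeff.
by apply/funext => k; rewrite /cos_coeff/= mulrA.
Qed.

Lemma sin_series (t : R) : series (fun k => sin_sgn k * (t ^+ k / k`!%:R)) @ \oo --> sin t.
Proof.
rewrite unlock /= (_ : (fun k => _) = sin_coeff t); first exact: is_cvg_series_sin_coeff.
by apply/funext => k; rewrite /sin_coeff/= mulrA.
Qed.

(** Termwise integration of the cosine series replaces the substitution of an imaginary argument
    into [gauss_mgf]. *)
Lemma gauss_cos u : \int[lebn]_x (cos (dot u x) * gauss x) = G0 * expR (- (nsq u / 4)).
Proof.
have [_ [_]] := @Rintegral_exp_series R _ _ lebn cos_sgn cos (dot u) gauss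
  cos_sgn_le1 cos_series (measurable_dot _) gauss_ge0 measurable_gauss (integrable_gauss_cosh _).
move=> /cvg_lim <- //; apply/cvg_lim => //.
have /series_even : series (fun k => G0 * exp_coeff (- (nsq u / 4)) k) @ \oo -->
      G0 * expR (- (nsq u / 4)).
  rewrite series_mulC.
  by apply: cvgMr; exact: is_cvg_series_exp_coeff.
apply: cvg_trans; apply: near_eq_cvg; apply: nearW => N; congr (series _ N).
apply/funext => i; rewrite gauss_moment /cos_sgn; case: (odd i); first by rewrite mulr0.
transitivity (G0 * ((- (nsq u / 4)) ^+ i./2 / i./2`!%:R)) => //.
by rewrite /= -exprnP [(- (nsq u / 4)) ^+ _]exprNn; move: (_`!%:R^-1) => F; ring.
Qed.

Lemma gauss_sin u : \int[lebn]_x (sin (dot u x) * gauss x) = 0.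
Proof.
have [_ [_]] := @Rintegral_exp_series R _ _ lebn sin_sgn sin (dot u) gauss
  sin_sgn_le1 sin_series (measurable_dot _) gauss_ge0 measurable_gauss (integrable_gauss_cosh _).
move=> /cvg_lim <- //; apply/cvg_lim => //.
rewrite (_ : series _ = cst 0); first exact: cvg_cst.
apply/funext => N; rewrite /series/= big1// => i _.
by rewrite gauss_moment /sin_sgn; case: (odd i); rewrite ?mulr0 ?mul0r.
Qed.

End gaussian_transforms.

(** * Surface measure and integrals over the ball *)

Section surface_integral.
Context {R : realType} (n : nat).
Implicit Types (x u v : 'rV[R]_n).
Local Notation leb := (@lebesgue_measure R).
Local Notation lebn := (@lebesgue_rV R n).
Local Notation B := (@unit_ball R n).
Local Open Scope ereal_scope.

Lemma ge0_integral_mrestr d (T : measurableType d) (mu : {measure set T -> \bar R})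
    (D : set T) (mD : measurable D) (h : T -> \bar R) :
  measurable_fun setT h -> (forall z, 0 <= h z) ->
  \int[mrestr mu mD]_z h z = \int[mu]_(z in D) h z.
Proof.
move=> mh h0; rewrite -(setUv D) ge0_integral_setU//; last 3 first.
- exact: measurableC.
- by rewrite setUv.
- by rewrite disj_set2E setICr.
rewrite (eq_measure_integral mu); last by move=> A mA AD; rewrite /= /mrestr setIidl.
rewrite [X in _ + X](eq_measure_integral mzero) ?integral_measure_zero ?adde0//.
move=> A mA AD; rewrite /= /mrestr (_ : A `&` D = set0) ?measure0//.
by apply/seteqP; split => z // [/AD].
Qed.

Lemma ge0_integral_surface (h : 'rV[R]_n -> \bar R) :
  measurable_fun setT h -> (forall x, 0 <= h x) ->
  \int[surface_measure n]_w h w = n%:R%:E * \int[lebn]_(x in B) h (direction x).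
Proof.
move=> mh h0; have md := @measurable_direction R n.
rewrite /surface_measure ge0_integral_mscale//=; congr (_ * _).
rewrite [LHS](ge0_integral_pushforward md (mrestr lebn (@measurable_unit_ball R n)) measurableT)//.
rewrite ge0_integral_mrestr//; first exact: (measurableT_comp mh md).
by move=> z; exact: h0.
Qed.

(** The Gaussian is at least 1/e on the unit ball and has a finite integral. *)
Lemma unit_ball_lty : lebn B < +oo.
Proof.
have mB := @measurable_unit_ball R n.
have : \int[lebn]_(x in B) (expR (- 1))%:E < +oo.
  apply: (@le_lt_trans _ _ (\int[lebn]_x (gauss x)%:E)); last by rewrite integral_gauss ltry.
  apply: (@le_trans _ _ (\int[lebn]_(x in B) (gauss x)%:E)).
    apply: ge0_le_integral => //.
    - by apply/measurable_EFinP/measurable_funTS; exact: measurable_gauss.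
    - move=> x Bx; rewrite lee_fin ler_expR lerN2 -enorm_sqr -[leRHS](expr1n _ 2).
      by rewrite lerXn2r ?nnegrE ?enorm_ge0.
  apply: ge0_subset_integral => //.
  - by apply/measurable_EFinP; exact: measurable_gauss.
  - by move=> x _; rewrite lee_fin gauss_ge0.
rewrite integral_cst//; apply: contraTT; rewrite -!leNgt !leye_eq => /eqP E.
by rewrite [X in _ * X]E gt0_muley// lte_fin expR_gt0.
Qed.

Lemma surface_lty : surface_measure n [set: 'rV[R]_n] < +oo.
Proof.
have := @ge0_integral_surface (cst 1) _ _; rewrite integral_cst// mul1e => ->//.
rewrite integral_cst//; last exact: measurable_unit_ball.
by rewrite mul1e; apply: lte_mul_pinfty => //; exact: unit_ball_lty.
Qed.

(** A substitute for polar coordinates: Tonelli exchanges x and s, and the ball of radius [rho s] is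
    scaled to the unit ball, where the Jacobian and the homogeneity of G together give the power n +
    j. *)
Lemma layer_cake j (G : 'rV[R]_n -> R) (phi rho : R -> R) :
  measurable_fun setT G -> (forall x, (0 <= G x)%R) ->
  (forall r x, (0 < r)%R -> (G (r *: x) = r ^+ j * G x)%R) ->
  measurable_fun setT phi -> (forall s, (0 <= phi s)%R) ->
  measurable_fun setT rho -> (forall s, (0 < s)%R -> (0 < rho s)%R) ->
  \int[lebn]_x ((G x)%:E * \int[leb]_(s in `]0%R, +oo[) (phi s * ((enorm x <= rho s)%R)%:R)%:E) =
  (\int[lebn]_(x in B) (G x)%:E) * \int[leb]_(s in `]0%R, +oo[) (phi s * rho s ^+ (n + j))%:E.
Proof.
move=> mG G0 GZ mphi phi0 mrho rho0; have mB := @measurable_unit_ball R n.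
pose D : set (measurableTypeR R) := `]0%R, +oo[%classic.
have mD : measurable D by exact: measurable_itv.
pose psi s : R := (\1_D s * phi s)%R.
have psi0 s : (0 <= psi s)%R by rewrite mulr_ge0.
have mpsi : measurable_fun setT psi by apply: measurable_funM => //; exact: measurable_indic.
pose ind (z : 'rV[R]_n * measurableTypeR R) : R := ((enorm z.1 <= rho z.2)%R)%:R.
have mind : measurable_fun setT ind.
  rewrite (_ : ind = \1_[set z | (enorm z.1 <= rho z.2)%R]); last first.
    by apply/funext => z; rewrite /ind indicE; congr (nat_of_bool _)%:R; apply/idP/idP; rewrite inE.
  apply: measurable_indic; rewrite -[X in measurable X]setTI.
  apply: measurable_fun_le => //.
    exact: (measurableT_comp (@measurable_enorm R n) measurable_fst).
  exact: (measurableT_comp mrho measurable_snd).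
have ind0 z : (0 <= ind z)%R by rewrite ler0n.
pose f (z : 'rV[R]_n * measurableTypeR R) : \bar R := (G z.1 * (psi z.2 * ind z))%:E.
have mf : measurable_fun setT f.
  apply/measurable_EFinP; apply: measurable_funM.
    exact: (measurableT_comp mG measurable_fst).
  apply: measurable_funM => //; exact: (measurableT_comp mpsi measurable_snd).
have f0 z : 0 <= f z by rewrite lee_fin mulr_ge0// mulr_ge0.
have indicI (g : R -> R) : \int[leb]_(s in D) (g s)%:E = \int[leb]_s (\1_D s * g s)%:E.
  rewrite integral_mkcond; apply: eq_integral => s _.
  by rewrite patchE indicE; case: ifPn => _; rewrite ?mul1r ?mul0r.
transitivity (\int[lebn]_x \int[leb]_s f (x, s)).
  apply: eq_integral => x _; rewrite indicI -ge0_integralZl//.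
  - by apply: eq_integral => s _; rewrite -EFinM; congr EFin; rewrite /= /psi; ring.
  - apply/measurable_EFinP; apply: measurable_funM; first exact: measurable_indic.
    by apply: measurable_funM => //; exact: (measurableT_comp mind (measurable_pair1 x)).
  - by move=> s _; rewrite lee_fin mulr_ge0// mulr_ge0.
  - by rewrite lee_fin.
rewrite (fubini_tonelli f)//.
have A0 : 0 <= \int[lebn]_(x in B) (G x)%:E by apply: integral_ge0 => x _; rewrite lee_fin.
have indicB (g : 'rV[R]_n -> R) : \int[lebn]_(x in B) (g x)%:E = \int[lebn]_x (\1_B x * g x)%:E.
  rewrite integral_mkcond; apply: eq_integral => x _.
  by rewrite patchE indicE; case: ifPn => _; rewrite ?mul1r ?mul0r.
rewrite indicI -ge0_integralZl//; first last.
- move=> s _; rewrite lee_fin indicE; case: (boolP (s \in D)) => sD; last by rewrite mul0r.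
  rewrite mul1r mulr_ge0// exprn_ge0// ltW// rho0//.
  by move: sD; rewrite inE /D/= in_itv/= andbT.
- apply/measurable_EFinP; apply: measurable_funM; first exact: measurable_indic.
  by apply: measurable_funM => //; exact: measurable_funX.
apply: eq_integral => s _.
case: (boolP (s \in D)) => sD; last first.
  rewrite indicE (negbTE sD) mul0r mule0 integral0_eq// => x _.
  by rewrite /f /psi /= indicE (negbTE sD) !mul0r mulr0.
have s0 : (0 < s)%R by move: sD; rewrite inE /D/= in_itv/= andbT.
have r0 := rho0 s s0.
have mfs : measurable_fun setT (fun x => f (x, s)) by exact: (measurableT_comp mf (measurable_pair2 s)).
rewrite (ge0_integral_affine 0 r0 mfs)//.
have E x : f ((rho s *: x + 0)%R, s) = (phi s * rho s ^+ j)%:E * (\1_B x * G x)%:E.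
  have eB : (enorm (rho s *: x) <= rho s)%R = (x \in B).
    rewrite (enormZ _ (ltW r0)) -[X in (_ <= X)%R]mulr1 ler_pM2l//.
    by apply/idP/idP; rewrite inE.
  rewrite /f/= addr0 GZ// /psi /ind/= eB !indicE sD mul1r -EFinM; congr EFin.
  by ring.
under eq_integral do rewrite E.
rewrite ge0_integralZl//; first last.
- by rewrite lee_fin mulr_ge0// exprn_ge0// ltW.
- by move=> x _; rewrite lee_fin mulr_ge0.
- by apply/measurable_EFinP; apply: measurable_funM => //; exact: measurable_indic.
rewrite -indicB indicE sD mul1r muleA -EFinM muleC; congr (_ * _%:E).
by rewrite exprD; ring.
Qed.

Lemma integral_tail (phi : R -> R) (t : R) : (0 <= t)%R -> measurable_fun setT phi ->
  \int[leb]_(s in `]0%R, +oo[) (phi s * ((t <= s)%R)%:R)%:E = \int[leb]_(s in `[t, +oo[) (phi s)%:E.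
Proof.
rewrite le_eqVlt => /predU1P[<-|t0] mphi.
  rewrite -integral_itv_obnd_cbnd; last by apply/measurable_EFinP; exact: measurable_funTS.
  by apply: eq_integral => s; rewrite inE/= in_itv/= andbT => /ltW ->; rewrite mulr1.
rewrite [LHS]integral_mkcond [RHS]integral_mkcond; apply: eq_integral => s _; rewrite !patchE.
have -> : (s \in `[t, +oo[%classic) = (t <= s)%R.
  by apply/idP/idP; rewrite inE/= in_itv/= andbT.
have -> : (s \in `]0%R, +oo[%classic) = (0 < s)%R.
  by apply/idP/idP; rewrite inE/= in_itv/= andbT.
case: (boolP (t <= s)%R) => ts; last by rewrite mulr0; case: ifP.
by rewrite (lt_le_trans t0 ts) mulr1.
Qed.

(** Layer cake for e^(-|x|^2), the integral of e^(-s) over s >= |x|^2, hence [rho] = sqrt. *)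
Lemma integral_homog_gauss j (G : 'rV[R]_n -> R) :
  measurable_fun setT G -> (forall x, (0 <= G x)%R) ->
  (forall r x, (0 < r)%R -> (G (r *: x) = r ^+ j * G x)%R) ->
  \int[lebn]_x (G x * gauss x)%:E = (\int[lebn]_(x in B) (G x)%:E) * eGamma ((n + j)%:R / 2 + 1).
Proof.
move=> mG G0 GZ.
have mphi : measurable_fun setT (fun s : R => expR (- s)) by exact: measurableT_comp.
have := @layer_cake j G (fun s => expR (- s)) Num.sqrt mG G0 GZ mphi _ _ _.
have -> : \int[leb]_(s in `]0%R, +oo[) (expR (- s) * Num.sqrt s ^+ (n + j))%:E =
    eGamma ((n + j)%:R / 2 + 1).
  apply: eq_integral => s; rewrite inE/= in_itv/= andbT => s0.
  by rewrite addrK mulrC [(_%:R / 2)%R]mulrC powRrM powR12_sqrt ?ltW// powR_mulrn ?sqrtr_ge0.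
move=> <-.
- apply: eq_integral => x _; rewrite EFinM; congr (_ * _).
  transitivity (\int[leb]_(s in `]0%R, +oo[) (expR (- s) * ((nsq x <= s)%R)%:R)%:E); last first.
    apply: eq_integral => s; rewrite inE/= in_itv/= andbT => s0.
    congr ((_ * (nat_of_bool _)%:R)%:E)%R.
    by rewrite -enorm_sqr -{1}(sqr_sqrtr (ltW s0)) ler_sqr ?nnegrE ?sqrtr_ge0 ?enorm_ge0.
  rewrite integral_tail ?nsq_ge0//.
  have cE : continuous (fun s : R => expR (- s)).
    by move=> s; exact: is_derive_continuous (is_derive_expRN s).
  rewrite (@ge0_continuous_FTC2y R (fun s => expR (- s)) (fun s => - expR (- s))%R (nsq x) 0).
  + by rewrite /gauss EFinN oppeK add0e.
  + by move=> s _; exact: expR_ge0.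
  + exact: continuous_subspaceT.
  + by rewrite -oppr0; apply: cvgN; exact: cvgr_expR.
  + by move=> s _; have [] := is_derive_opp (is_derive_expRN s).
  + by apply: cvg_at_right_filter; apply: cvgN; exact: cE.
  + by move=> s _; rewrite derive1E; have [_ ->] := is_derive_opp (is_derive_expRN s); rewrite opprK.
- by move=> s; exact: expR_ge0.
- apply: continuous_measurable_fun => s; exact: sqrt_continuous.
- by move=> s s0; rewrite sqrtr_gt0.
Qed.

(** Layer cake for 1 - |x|^j, the integral of j s^(j-1) over [|x|, 1]. It relates integrals over
    directions to integrals over the solid ball. *)
Lemma integral_homog_ball j (G : 'rV[R]_n -> R) : (0 < j)%N ->
  measurable_fun setT G -> (forall x, (0 <= G x)%R) ->
  (forall r x, (0 < r)%R -> (G (r *: x) = G x)%R) ->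
  \int[lebn]_(x in B) (G x * (1 - enorm x ^+ j))%:E =
  (\int[lebn]_(x in B) (G x)%:E) * (j%:R / (n + j)%:R)%:E.
Proof.
move=> j0 mG G0 GZ.
pose phi (s : R) : R := (\1_`[0%R, 1%R] s * (j%:R * s ^+ j.-1))%R.
have mphi : measurable_fun setT phi.
  apply: measurable_funM; first exact: measurable_indic.
  by apply: measurable_funM => //; exact: measurable_funX.
have phi0 s : (0 <= phi s)%R.
  rewrite /phi indicE; case: (boolP (s \in _)) => [|_]; last by rewrite mul0r.
  by rewrite inE/= in_itv/= => /andP[s0 _]; rewrite mul1r mulr_ge0// exprn_ge0.
have int_pow (k : nat) (t : R) : (0 < k)%N -> (0 <= t)%R -> (t <= 1)%R ->
    \int[leb]_(s in `[t, 1%R]) (k%:R * s ^+ k.-1)%:E = (1 - t ^+ k)%:E.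
  move=> k0 t0; rewrite le_eqVlt => /predU1P[->|t1].
    by rewrite set_itv1 integral_set1 expr1n subrr.
  rewrite -[in RHS](expr1n R k); apply: (@FTC_itv R (fun s => k%:R * s ^+ k.-1)%R (fun s => s ^+ k)%R _ _ t1).
    by move=> s _; exact: is_derive_exprn.
  by apply: continuous_subspaceT => s; apply: cvgMr; exact: exprn_continuous.
have indicP t (g : R -> R) : (0 <= t)%R ->
    \int[leb]_(s in `[t, +oo[) (\1_`[0%R, 1%R] s * g s)%:E = \int[leb]_(s in `[t, 1%R]) (g s)%:E.
  move=> t0; rewrite [LHS]integral_mkcond [RHS]integral_mkcond.
  apply: eq_integral => s _; rewrite !patchE indicE.
  have -> : (s \in `[t, +oo[%classic) = (t <= s)%R.
    by apply/idP/idP; rewrite inE/= in_itv/= andbT.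
  have -> : (s \in `[t, 1%R]%classic) = (t <= s <= 1)%R.
    by apply/idP/idP; rewrite inE/= in_itv/=.
  have -> : (s \in `[0%R, 1%R]%classic) = (0 <= s <= 1)%R.
    by apply/idP/idP; rewrite inE/= in_itv/=.
  case: (boolP (t <= s)%R) => //= ts; rewrite (le_trans t0 ts)/=.
  by case: ifP => _; rewrite ?mul1r ?mul0r.
have GZ0 r x : (0 < r)%R -> (G (r *: x) = r ^+ 0 * G x)%R by move=> r0; rewrite expr0 mul1r GZ.
have := @layer_cake 0 G phi id mG G0 GZ0 mphi phi0 (@measurable_id _ _ _) (fun s s0 => s0).
have -> : \int[leb]_(s in `]0%R, +oo[) (phi s * id s ^+ (n + 0))%:E = (j%:R / (n + j)%:R)%:E.
  have mpn : measurable_fun setT (fun s : R => phi s * s ^+ (n + 0))%R.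
    by apply: measurable_funM => //; exact: measurable_funX.
  rewrite integral_itv_obnd_cbnd; last by apply/measurable_EFinP; exact: measurable_funTS.
  transitivity (\int[leb]_(s in `[0%R, +oo[)
      (\1_`[0%R, 1%R] s * ((j%:R / (n + j)%:R) * ((n + j)%:R * s ^+ (n + j).-1)))%:E).
    apply: eq_integral => s _; congr EFin; rewrite /phi -!mulrA; congr (_ * _)%R.
    have nj : ((n + j)%:R != 0 :> R)%R by rewrite pnatr_eq0 addn_eq0 negb_and -!lt0n j0 orbT.
    rewrite addn0 (_ : (n + j).-1 = j.-1 + n)%N; last by case: (j) j0 => // k _; rewrite addnS addnC.
    by rewrite mulKf// exprD.
  rewrite indicP//; under eq_integral do rewrite EFinM.
  rewrite integralZl//.
    by rewrite int_pow ?addn_gt0 ?j0 ?orbT// expr0n addn_eq0 (gtn_eqF j0) andbF subr0 mule1.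
  by apply: continuous_itv_integrable; apply: continuous_subspaceT => s; apply: cvgMr; exact: exprn_continuous.
move=> <-.
rewrite integral_mkcond; apply: eq_integral => x _; rewrite patchE.
rewrite integral_tail ?enorm_ge0// indicP ?enorm_ge0//.
case: ifPn => [|xB].
  rewrite inE /unit_ball/= => x1.
  by rewrite int_pow ?enorm_ge0// EFinM.
rewrite set_itv_ge ?integral_set0 ?mule0//.
move: xB; apply: contra; rewrite bnd_simp => x1.
by rewrite inE.
Qed.

End surface_integral.

Section finite_surface.
Context {R : realType} (n : nat).

Lemma fin_num_fun_surface : fin_num_fun (@surface_measure R n).
Proof. by apply: lty_fin_num_fun; exact: surface_lty. Qed.

HB.instance Definition _ := Measure_isFinite.Build _ _ _ (@surface_measure R n)
  fin_num_fun_surface.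

End finite_surface.

(** * Moments and Fourier transform of the sphere *)

Section sphere_means.
Context {R : realType} (n : nat).
Implicit Types (x u v w : 'rV[R]_n.+1).
Local Notation leb := (@lebesgue_measure R).
Local Notation lebn := (@lebesgue_rV R n.+1).
Local Notation B := (@unit_ball R n.+1).
Local Notation sigma := (@surface_measure R n.+1).
Local Notation G0 := (Num.sqrt pi ^+ n.+1 : R).
Local Notation area := (@sphere_area R n.+1).

Lemma coord_le_enorm x i : `|x ord0 i| <= enorm x.
Proof.
rewrite -ler_sqr ?nnegrE ?enorm_ge0// enorm_sqr real_normK ?num_real// /nsq (bigD1 i)//=.
by rewrite lerDl sumr_ge0// => k _; exact: sqr_ge0.
Qed.

Lemma dot_le u x : `|dot u x| <= (\sum_i `|u ord0 i|) * enorm x.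
Proof.
rewrite /dot (le_trans (ler_norm_sum _ _ _))// mulr_suml; apply: ler_sum => i _.
by rewrite normrM ler_wpM2l// coord_le_enorm.
Qed.

Lemma enorm_direction_le1 x : enorm (direction x) <= 1.
Proof.
rewrite /direction enormZ ?invr_ge0 ?enorm_ge0//.
by have [->|x0] := eqVneq (enorm x) 0; rewrite ?mulr0// mulVf.
Qed.

Lemma dot_direction_le u x : `|dot u (direction x)| <= \sum_i `|u ord0 i|.
Proof.
rewrite (le_trans (dot_le _ _))// ler_piMr ?enorm_direction_le1//.
by apply: sumr_ge0 => i _.
Qed.

Lemma bounded_ball_integrable (h : 'rV[R]_n.+1 -> R) (C : R) : measurable_fun setT h ->
  (forall x, B x -> `|h x| <= C) -> lebn.-integrable B (EFin \o h).
Proof.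
move=> mh hC; have mB := @measurable_unit_ball R n.+1.
apply: (integrable_le (g := cst C) mB) => //; first exact: measurable_funTS.
apply/integrableP; split; first exact/measurable_EFinP/measurable_cst.
rewrite [X in (X < _)%E](_ : _ = (`|C|%:E * lebn B)%E); last by rewrite -integral_cst.
by rewrite lte_mul_pinfty// ?lee_fin//; exact: unit_ball_lty.
Qed.

Lemma Rintegral_surface_even (k : nat) u :
  \int[sigma]_w (dot u w ^+ k.*2) = n.+1%:R * \int[lebn]_(x in B) (dot u (direction x) ^+ k.*2).
Proof.
rewrite /Rintegral ge0_integral_surface; first last.
- by move=> w; rewrite lee_fin exprn_even_ge0// odd_double.
- by apply/measurable_EFinP; apply: measurable_funX; exact: measurable_dot.
rewrite fineM// -/(Rintegral _ _ _).
have mD := measurable_funX k.*2 (measurableT_comp (measurable_dot u) (@measurable_direction R n.+1)).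
have := bounded_ball_integrable (C := (\sum_i `|u ord0 i|) ^+ k.*2) mD _.
move=> /(_ _)/(integrable_fin_num (@measurable_unit_ball R n.+1)); apply => x _.
by rewrite normrX lerXn2r ?nnegrE// ?dot_direction_le// (le_trans _ (dot_direction_le u 0)).
Qed.

(** Apply [integral_homog_ball] to G(x) = (u.x/|x|)^(2k), for which G(x) |x|^(2k) = (u.x)^(2k), and
    solve for the integral of G. The case k = 0, excluded there, is immediate. *)
Lemma sphere_ball_moment (k : nat) u :
  n.+1%:R * \int[lebn]_(x in B) (dot u (direction x) ^+ k.*2) =
  (n.+1 + k.*2)%:R * \int[lebn]_(x in B) (dot u x ^+ k.*2).
Proof.
have mB := @measurable_unit_ball R n.+1.
case: k => [|k].
  by rewrite addn0; congr (_ * _); apply: eq_Rintegral => x _; rewrite !expr0.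
set j := k.+1.*2.
pose Gd x := dot u (direction x) ^+ j.
have mGd : measurable_fun setT Gd.
  exact: measurable_funX j (measurableT_comp (measurable_dot u) (@measurable_direction R n.+1)).
have Gd0 x : 0 <= Gd x by rewrite exprn_even_ge0// odd_double.
have GdZ r x : 0 < r -> Gd (r *: x) = Gd x.
  move=> r0; rewrite /Gd /direction enormZ ?ltW// scalerA invfM mulrAC mulVf ?mul1r//.
  by rewrite gt_eqF.
have := integral_homog_ball (j := j) isT mGd Gd0 GdZ.
have iGd : lebn.-integrable B (EFin \o Gd).
  apply: (bounded_ball_integrable (C := (\sum_i `|u ord0 i|) ^+ j) mGd) => x _.
  by rewrite normrX lerXn2r ?nnegrE// ?dot_direction_le// (le_trans _ (dot_direction_le u 0)).
have GE x : Gd x * enorm x ^+ j = dot u x ^+ j.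
  have [x0|x0] := eqVneq (enorm x) 0.
    rewrite x0 expr0n mulr0; apply/esym/eqP; rewrite expf_eq0/=.
    by rewrite -normr_le0 (le_trans (dot_le u x))// x0 mulr0.
  rewrite /Gd /direction dotZr -exprMn mulrAC mulVf ?mul1r//.
have iG : lebn.-integrable B (EFin \o (fun x => dot u x ^+ j)).
  apply: (bounded_ball_integrable (C := (\sum_i `|u ord0 i|) ^+ j)).
    by apply: measurable_funX; exact: measurable_dot.
  move=> x Bx; rewrite normrX lerXn2r ?nnegrE// ?(le_trans (dot_le u x)) ?ler_piMr//.
    by apply: sumr_ge0.
  by apply: sumr_ge0.
rewrite (EFin_Rintegral mB iGd) -EFinM.
under eq_integral do rewrite mulrBr mulr1 GE.
have iB : lebn.-integrable B (EFin \o (fun x => Gd x - dot u x ^+ j)).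
  by apply: (eq_integrable mB _ _ _ (integrableB mB iGd iG)).
rewrite (EFin_Rintegral mB iB) => -[].
rewrite RintegralB// -/(Gd _).
set D := \int[lebn]_(x in B) Gd x; set A := \int[lebn]_(x in B) _ => E.
have nj : (n.+1 + j)%:R != 0 :> R by rewrite pnatr_eq0.
have {E} : (D - A) * (n.+1 + j)%:R = D * j%:R.
  by rewrite E -mulrA divfK.
rewrite natrD => E.
apply/eqP; rewrite -subr_eq0; apply/eqP.
transitivity ((D - A) * (n.+1%:R + j%:R) - D * j%:R); last by rewrite E subrr.
by ring.
Qed.

(** The Gaussian moment is known, and it equals the moment over the ball times a Gamma value by
    [integral_homog_gauss]; [sphere_ball_moment] passes from the ball to the sphere. *)
Lemma surface_moment (k : nat) u :
  \int[sigma]_w (dot u w ^+ k.*2) / k.*2`!%:R =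
  2 * G0 * ((nsq u / 4) ^+ k / (k`!%:R * Gamma ((n + k.*2).+1%:R / 2))).
Proof.
have mB := @measurable_unit_ball R n.+1.
have mG : measurable_fun setT (fun x => dot u x ^+ k.*2).
  by apply: measurable_funX; exact: measurable_dot.
have Gpos x : 0 <= dot u x ^+ k.*2 by rewrite exprn_even_ge0// odd_double.
have GZ r x : 0 < r -> dot u (r *: x) ^+ k.*2 = r ^+ k.*2 * dot u x ^+ k.*2.
  by move=> _; rewrite dotZr exprMn.
have := integral_homog_gauss mG Gpos GZ.
rewrite (EFin_Rintegral measurableT (integrable_gauss_moment u k.*2)).
have iG : lebn.-integrable B (EFin \o (fun x => dot u x ^+ k.*2)).
  apply: (bounded_ball_integrable (C := (\sum_i `|u ord0 i|) ^+ k.*2) mG) => x Bx.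
  rewrite normrX lerXn2r ?nnegrE// ?(le_trans (dot_le u x)) ?ler_piMr//; by apply: sumr_ge0.
rewrite (EFin_Rintegral mB iG).
rewrite (_ : (n.+1 + k.*2)%:R / 2 + 1 = (n + k.*2).+3%:R / 2); last first.
  by rewrite addSn -(addn2 (n + k.*2).+1) natrD; field.
rewrite eGamma_halfE -EFinM => -[].
rewrite (_ : (n + k.*2).+3%:R / 2 = (n + k.*2).+1%:R / 2 + 1); last first.
  by rewrite -(addn2 (n + k.*2).+1) natrD; field.
rewrite Gamma_halfS => E.
have := gauss_moment u k.*2; rewrite odd_double doubleK E => {}E.
have g0 := Gamma_half_gt0 (R := R) (n + k.*2).
rewrite Rintegral_surface_even sphere_ball_moment addSn.
move: E g0; set N2 := (n + k.*2).+1%:R; set Ga := Gamma _; set A := \int[lebn]_(x in B) _.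
move=> E g0.
have : A * (N2 / 2 * Ga) / k.*2`!%:R * (2 / Ga) =
  G0 * ((nsq u / 4) ^+ k / k`!%:R) * (2 / Ga) by rewrite E.
move: (k.*2`!%:R^-1) (k`!%:R) => F F2 h.
transitivity (A * (N2 / 2 * Ga) * F * (2 / Ga)); first by field; rewrite gt_eqF.
by rewrite h invfM; ring.
Qed.

Lemma sphere_areaE : area = 2 * G0 / Gamma (n.+1%:R / 2).
Proof.
have := surface_moment 0 0; rewrite !expr0 fact0 invr1 mulr1 addn0 !mul1r.
move=> <-; rewrite /Rintegral; under eq_integral do rewrite expr0.
by rewrite integral_cst// mul1e.
Qed.

Lemma sphere_area_gt0 : 0 < area.
Proof.
rewrite sphere_areaE divr_gt0 ?Gamma_half_gt0// mulr_gt0// exprn_gt0// sqrtr_gt0 pi_gt0//.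
Qed.

Lemma integrable_surface (h : 'rV[R]_n.+1 -> R) (C : R) : measurable_fun setT h ->
  (forall w, enorm w <= 1 -> `|h w| <= C) -> sigma.-integrable setT (EFin \o h).
Proof.
move=> mh hC; apply/integrableP; split; first exact/measurable_EFinP.
have mh1 : measurable_fun setT (fun w => `|(h w)%:E|%E).
  by apply: measurableT_comp => //; exact/measurable_EFinP.
rewrite ge0_integral_surface//.
have md := @measurable_direction R n.+1.
have := bounded_ball_integrable (C := C) (measurableT_comp mh md) _.
case/(_ _)/integrableP => [x _|_ lty]; first exact/hC/enorm_direction_le1.
by rewrite lte_mul_pinfty.
Qed.

Lemma integrable_surface_cosh u :
  sigma.-integrable setT (EFin \o (fun w => (expR (dot u w) + expR (- dot u w)) * cst 1 w)).
Proof.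
have md := measurable_dot u.
apply: (integrable_surface (C := expR (\sum_i `|u ord0 i|) *+ 2)).
  apply: measurable_funM => //; apply: measurable_funD; apply: measurableT_comp => //.
  exact: measurableT_comp.
move=> w w1; have : `|dot u w| <= \sum_i `|u ord0 i|.
  rewrite (le_trans (dot_le u w))// ler_piMr//; exact: sumr_ge0.
rewrite ler_norml => /andP[h1 h2].
rewrite mulr1 ger0_norm ?addr_ge0 ?expR_ge0// mulr2n lerD// ler_expR//.
by rewrite lerNl.
Qed.

(** The Fourier transform of the sphere is a Bessel function: odd powers are absent from the cosine
    series, and the even moments reproduce [bcoef]. *)
Lemma surface_cos u : \int[sigma]_w cos (dot u w) = area * bP n (nsq u).
Proof.
have m1 : measurable_fun setT (cst 1 : 'rV[R]_n.+1 -> R) by exact: measurable_cst.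
have [_ [_]] := @Rintegral_exp_series R _ _ sigma cos_sgn cos (dot u) (cst 1)
  cos_sgn_le1 cos_series (measurable_dot _) (fun=> ler01) m1 (integrable_surface_cosh _).
under eq_Rintegral do rewrite mulr1.
move=> /cvg_lim <- //; apply/cvg_lim => //.
have /series_even : series (fun k => area * (bcoef n k * nsq u ^+ k)) @ \oo --> area * bP n (nsq u).
  by rewrite series_mulC; apply: cvgMr; exact: entire_bcoef.
apply: cvg_trans; apply: near_eq_cvg; apply: nearW => N; congr (series _ N).
apply/funext => i; rewrite /cos_sgn; case: (boolP (odd i)) => oi; first by rewrite !mul0r.
under eq_Rintegral do rewrite mulr1.
transitivity ((-1) ^ i./2 * (\int[sigma]_x dot u x ^+ i./2.*2 / i./2.*2`!%:R)); last first.
  by rewrite (even_halfK oi) mul1r.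
rewrite surface_moment -bcoef_Gamma -exprnP sphere_areaE subrK.
rewrite (_ : i./2%:R + (n.+1%:R / 2 - 1) + 1 = (n + i./2.*2).+1%:R / 2); last first.
  by rewrite -addSn natrD -mul2n natrM; field.
rewrite expr_div_n.
have g1 := Gamma_half_gt0 (R := R) n.
have Q0 : 4 ^+ i./2 != 0 :> R by rewrite expf_neq0// pnatr_eq0.
have g0 := Gamma_half_gt0 (R := R) (n + i./2.*2).
have F0 : i./2`!%:R != 0 :> R by rewrite pnatr_eq0 -lt0n fact_gt0.
move: (Gamma _) g1 (Gamma _) g0 (4 ^+ _) Q0 (i./2`!%:R) F0 => Ga g1 Gb g2 Q Q0 F F0.
by field; rewrite Q0 F0 !gt_eqF.
Qed.

Lemma measurable_rV_set0 : measurable [set (0 : 'rV[R]_n.+1)].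
Proof.
rewrite (_ : [set 0] = setT `&` (@nsq R n.+1) @^-1` [set 0]).
  by apply: measurable_nsq => //; exact: measurable_set1.
rewrite setTI; apply/seteqP; split => x /=.
  by move=> ->; rewrite /nsq big1// => i _; rewrite mxE expr0n.
move=> x0; apply/rowP => i; rewrite mxE; apply/eqP; rewrite -normr_le0.
by rewrite (le_trans (coord_le_enorm x i))// -sqrtr0 -x0.
Qed.

(** The origin is invariant under dilation by 2, so its measure m is finite with m = 2^(n+1) m. *)
Lemma lebesgue_rV_set1 : lebn [set 0] = 0%E.
Proof.
have m0 := measurable_rV_set0.
have fin : lebn [set 0] \is a fin_num.
  rewrite ge0_fin_numE ?measure_ge0// (le_lt_trans _ (@unit_ball_lty R n.+1))//.
  apply: le_measure; rewrite ?inE//; first exact: measurable_unit_ball.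
  by move=> x ->; rewrite /unit_ball/= /enorm -/(nsq _) /nsq big1 ?sqrtr0// => i _; rewrite mxE expr0n.
have E : (lebn [set 0%R] = (2 ^+ n.+1)%:E * lebn [set 0%R])%E.
  rewrite -(setIT [set 0]) -!integral_indic//.
  rewrite [LHS](ge0_integral_affine 0 (h := fun x => (\1_[set 0] x)%:E) (ltr0n R 2))//; last first.
    by apply/measurable_EFinP; exact: measurable_indic.
  congr (_ * _)%E; apply: eq_integral => x _; rewrite !indicE; congr ((nat_of_bool _)%:R%:E).
  rewrite addr0; apply/idP/idP => /set_mem/= x0; apply/mem_set => /=; last by rewrite x0 scaler0.
  by move/eqP: x0; rewrite scaler_eq0 pnatr_eq0/= => /eqP.
move: E; rewrite -(fineK fin) -EFinM => -[] /eqP.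
rewrite -subr_eq0 -{1}[fine _]mul1r -mulrBl mulf_eq0 subr_eq0 => /orP[|/eqP->//].
by rewrite lt_eqF// exprn_egt1// ltr1n.
Qed.

(** [surface_measure] lives on the whole space. A direction x/|x| is a unit vector except at x = 0,
    which is a null set. *)
Lemma surface_ae_unit : {ae sigma, forall w, nsq w = 1}.
Proof.
have mA : measurable [set w : 'rV[R]_n.+1 | nsq w <> 1].
  rewrite (_ : [set w | _] = setT `&` (@nsq R n.+1) @^-1` (~` [set 1])).
    by apply: measurable_nsq => //; apply: measurableC; exact: measurable_set1.
  by rewrite setTI.
exists [set w | nsq w <> 1]; split => //.
rewrite -(setIT [set w : 'rV[R]_n.+1 | nsq w <> 1]) -integral_indic//.
rewrite ge0_integral_surface//; last first.
  by apply/measurable_EFinP; exact: measurable_indic.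
rewrite [X in (_ * X)%E](_ : _ = 0%E) ?mule0//.
apply/eqP; rewrite eq_le; apply/andP; split; last by apply: integral_ge0 => x _; rewrite lee_fin.
have mB := @measurable_unit_ball R n.+1.
have m0 : measurable [set (0 : 'rV[R]_n.+1)] by exact: measurable_rV_set0.
have mA1 : measurable_fun setT (\1_[set w : 'rV[R]_n.+1 | nsq w <> 1] : _ -> R).
  exact: measurable_indic.
apply: (@le_trans _ _ (\int[lebn]_(x in B) (\1_[set 0] x)%:E)%E).
  apply: ge0_le_integral => //.
  - apply/measurable_EFinP/measurable_funTS.
    exact: (measurableT_comp mA1 (@measurable_direction R n.+1)).
  - by apply/measurable_EFinP; exact: measurable_indic.
  - move=> x _; rewrite lee_fin !indicE ler_nat.
    case: (boolP (x \in [set 0])) => [_|]; first by case: (_ \in _).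
    rewrite notin_setE => /= x0; rewrite (_ : (_ \in _) = false)//; apply/negP; rewrite inE; apply.
    have e0 : enorm x != 0.
      apply: contra_notN x0 => /eqP x0; apply/rowP => i; rewrite mxE; apply/eqP.
      by rewrite -normr_le0 (le_trans (coord_le_enorm x i))// x0.
    by rewrite /direction nsqZ -enorm_sqr exprVn mulVf// expf_neq0.
rewrite integral_indic//; apply: (@le_trans _ _ (lebn [set 0])); last by rewrite lebesgue_rV_set1.
by apply: le_measure; rewrite ?inE//; exact: measurableI.
Qed.

End sphere_means.

(** * Bessel functions paired with Gaussians *)

Section gaussian_pairing.
Context {R : realType} (n : nat).
Implicit Types (x y u v w : 'rV[R]_n.+1).
Local Notation lebn := (@lebesgue_rV R n.+1).
Local Notation sigma := (@surface_measure R n.+1).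
Local Notation G0 := (Num.sqrt pi ^+ n.+1 : R).
Local Notation area := (@sphere_area R n.+1).

Definition gaussian (a : R) y x : R := expR (- (a * nsq (x - y))).

(** This is (pi/a)^((n+1)/2), the total mass of a Gaussian of parameter a > 0. *)
Definition gmass (a : R) : R := G0 / Num.sqrt a ^+ n.+1.

Lemma gmass_gt0 a : 0 < a -> 0 < gmass a.
Proof. by move=> a0; rewrite divr_gt0// exprn_gt0// sqrtr_gt0// pi_gt0. Qed.

Lemma gaussian_ge0 a y x : 0 <= gaussian a y x. Proof. exact: expR_ge0. Qed.

Lemma gaussianE a y x : 0 < a ->
  gaussian a y x = gauss (Num.sqrt a *: x + - (Num.sqrt a *: y)).
Proof.
by move=> a0; rewrite /gaussian /gauss -scalerBr nsqZ sqr_sqrtr// ltW.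
Qed.

Lemma gaussian_affine a y x : 0 < a -> gaussian a y ((Num.sqrt a)^-1 *: x + y) = gauss x.
Proof.
by move=> a0; rewrite /gaussian /gauss addrK nsqZ exprVn sqr_sqrtr ?(ltW a0)// mulVKf// gt_eqF.
Qed.

Lemma integrable_gaussian a y : 0 < a -> lebn.-integrable setT (EFin \o gaussian a y).
Proof.
move=> a0; have sa : 0 < Num.sqrt a by rewrite sqrtr_gt0.
apply: (eq_integrable measurableT _ _ _
  (integrable_affine (- (Num.sqrt a *: y)) sa integrable_gauss)) => x _ /=.
by rewrite gaussianE.
Qed.

Lemma measurable_gaussian a y : measurable_fun setT (gaussian a y).
Proof.
apply: measurableT_comp => //; apply: measurableT_comp => //.
apply: measurable_funM => //; apply: (measurableT_comp (@measurable_nsq R n.+1)).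
apply: (eq_measurable_fun (fun x => 1 *: x + - y)); last exact: measurable_affine_rV.
by move=> x _; rewrite scale1r.
Qed.

Lemma gaussian_cos a y u : 0 < a -> \int[lebn]_x (cos (dot u x) * gaussian a y x) =
  gmass a * expR (- (nsq u / (4 * a))) * cos (dot u y).
Proof.
move=> a0; have sa : 0 < Num.sqrt a by rewrite sqrtr_gt0.
have ra : 0 < (Num.sqrt a)^-1 by rewrite invr_gt0.
have mcos v : measurable_fun setT (fun x => cos (dot v x)).
  apply: (measurableT_comp _ (measurable_dot v)); apply: continuous_measurable_fun.
  exact: continuous_cos.
have msin v : measurable_fun setT (fun x => sin (dot v x)).
  apply: (measurableT_comp _ (measurable_dot v)); apply: continuous_measurable_fun.
  exact: continuous_sin.
have ih : lebn.-integrable setT (EFin \o (fun x => cos (dot u x) * gaussian a y x)).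
  apply: (integrable_le measurableT _ (integrable_gaussian y a0)).
    by apply: measurable_funM => //; exact: measurable_gaussian.
  move=> x _; rewrite normrM [X in _ * X]ger0_norm ?gaussian_ge0// ler_piMl ?gaussian_ge0//.
  by rewrite ler_norml cos_geN1 cos_le1.
have ic v : lebn.-integrable setT (EFin \o (fun x => cos (dot v x) * gauss x)).
  apply: (integrable_le measurableT _ integrable_gauss).
    by apply: measurable_funM => //; exact: measurable_gauss.
  move=> x _; rewrite normrM [X in _ * X]ger0_norm ?gauss_ge0// ler_piMl ?gauss_ge0//.
  by rewrite ler_norml cos_geN1 cos_le1.
have is_ v : lebn.-integrable setT (EFin \o (fun x => sin (dot v x) * gauss x)).
  apply: (integrable_le measurableT _ integrable_gauss).
    by apply: measurable_funM => //; exact: measurable_gauss.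
  move=> x _; rewrite normrM [X in _ * X]ger0_norm ?gauss_ge0// ler_piMl ?gauss_ge0//.
  by rewrite ler_norml sin_geN1 sin_le1.
rewrite (Rintegral_affine y ra ih).
set r := (Num.sqrt a)^-1.
transitivity (r ^+ n.+1 * \int[lebn]_x (cos (dot u y) * (cos (dot (r *: u) x) * gauss x) +
    - sin (dot u y) * (sin (dot (r *: u) x) * gauss x))).
  congr (_ * _); apply: eq_Rintegral => x _.
  by rewrite gaussian_affine// dotDr dotZr dotZl cosD; ring.
rewrite RintegralD//; first last.
- exact: integrable_mulC.
- exact: integrable_mulC.
rewrite !RintegralZl// gauss_cos gauss_sin mulr0 addr0 nsqZ /gmass.
have -> : r ^+ 2 = a^-1 by rewrite /r exprVn sqr_sqrtr// ltW.
have -> : a^-1 * nsq u / 4 = nsq u / (4 * a) by field; rewrite gt_eqF.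
by rewrite /r exprVn; ring.
Qed.

Lemma eq_Rintegral_surface (h1 h2 : 'rV[R]_n.+1 -> R) : measurable_fun setT h1 ->
  measurable_fun setT h2 -> (forall w, nsq w = 1 -> h1 w = h2 w) ->
  \int[sigma]_w h1 w = \int[sigma]_w h2 w.
Proof.
move=> m1 m2 E; congr fine; apply: ae_eq_integral => //; try exact/measurable_EFinP.
by apply: filterS (@surface_ae_unit R n) => w /= w1 _; rewrite E.
Qed.

(** By [surface_cos] the Bessel function is a spherical mean of cosines. Fubini leads to
    [gaussian_cos], whose factor e^(-|s w|^2/4a) is constant on the unit sphere, and the remaining
    mean of cosines is again a Bessel function. *)
Lemma bP_gaussian a y s : 0 < a ->
  lebn.-integrable setT (EFin \o (fun x => bP n (s ^+ 2 * nsq x) * gaussian a y x)) /\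
  \int[lebn]_x (bP n (s ^+ 2 * nsq x) * gaussian a y x) =
  gmass a * expR (- (s ^+ 2 / (4 * a))) * bP n (s ^+ 2 * nsq y).
Proof.
move=> a0; have ar0 := @sphere_area_gt0 R n.
have mcos : measurable_fun setT (@cos R) by apply: continuous_measurable_fun; exact: continuous_cos.
pose f (z : 'rV[R]_n.+1 * 'rV[R]_n.+1) := cos (dot (s *: z.1) z.2) * gaussian a y z.1.
have mdot2 : measurable_fun setT (fun z : 'rV[R]_n.+1 * 'rV[R]_n.+1 => dot (s *: z.1) z.2).
  apply: measurable_sum => i; apply: measurable_funM.
    apply: (eq_measurable_fun (fun z : 'rV[R]_n.+1 * 'rV[R]_n.+1 => s * z.1 ord0 i)).
      by move=> z _; rewrite mxE.
    apply: measurable_funM => //; exact: (measurableT_comp (measurable_coord i) measurable_fst).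
  exact: (measurableT_comp (measurable_coord i) measurable_snd).
have mf : measurable_fun setT f.
  apply: measurable_funM; first exact: measurableT_comp.
  exact: (measurableT_comp (measurable_gaussian a y) measurable_fst).
have intf : (lebn \x sigma)%E.-integrable setT (EFin \o f).
  apply: (integrable_prod_le (g := gaussian a y) (h := cst 1) mf).
  - exact: integrable_gaussian.
  - exact: finite_measure_integrable_cst.
  - move=> x w; rewrite mulr1 /f/= normrM [X in _ * X]ger0_norm ?gaussian_ge0//.
    by rewrite ler_piMl ?gaussian_ge0// ler_norml cos_geN1 cos_le1.
have [i1 E1] := Rintegral_fubini intf.
have inner x : \int[sigma]_w f (x, w) = area * (bP n (s ^+ 2 * nsq x) * gaussian a y x).
  rewrite /f/= mulrA -nsqZ -surface_cos mulrC.
  rewrite -RintegralZl//.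
    by apply: eq_Rintegral => w _; rewrite mulrC.
  apply: (integrable_surface (C := 1)); first exact: (measurableT_comp mcos (measurable_dot _)).
  by move=> w _; rewrite ler_norml cos_geN1 cos_le1.
split.
  apply: (eq_integrable measurableT _ _ _ (integrable_mulC area^-1 measurableT i1)) => x _ /=.
  by rewrite inner mulKf// gt_eqF.
apply: (mulfI (lt0r_neq0 ar0)).
rewrite -RintegralZl//; last first.
  apply: (eq_integrable measurableT _ _ _ (integrable_mulC area^-1 measurableT i1)) => x _ /=.
  by rewrite inner mulKf// gt_eqF.
transitivity (\int[lebn]_x \int[sigma]_w f (x, w)).
  by apply: eq_Rintegral => x _; rewrite inner.
rewrite E1.
transitivity (\int[sigma]_w (gmass a * expR (- (s ^+ 2 / (4 * a))) * cos (dot (s *: y) w))).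
  transitivity (\int[sigma]_w (gmass a * expR (- (nsq (s *: w) / (4 * a))) * cos (dot (s *: w) y))).
    apply: eq_Rintegral => w _; rewrite -gaussian_cos//.
    by apply: eq_Rintegral => x _; rewrite /f/= !dotZl dotC.
  apply: eq_Rintegral_surface.
  - apply: measurable_funM.
      apply: measurable_funM => //; apply: measurableT_comp => //; apply: measurableT_comp => //.
      apply: measurable_funM => //; apply: (eq_measurable_fun (fun w => s ^+ 2 * nsq w)).
        by move=> w _; rewrite nsqZ.
      by apply: measurable_funM => //; exact: measurable_nsq.
    apply: (measurableT_comp mcos).
    apply: (eq_measurable_fun (dot (s *: y))); last exact: measurable_dot.
    by move=> w _; rewrite !dotZl dotC.
  - by apply: measurable_funM => //; exact: (measurableT_comp mcos (measurable_dot _)).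
  - by move=> w w1; rewrite nsqZ w1 mulr1 !dotZl dotC.
rewrite RintegralZl// ?surface_cos ?nsqZ; first by ring.
apply: (integrable_surface (C := 1)); first exact: (measurableT_comp mcos (measurable_dot _)).
by move=> w _; rewrite ler_norml cos_geN1 cos_le1.
Qed.

End gaussian_pairing.

(** * Functions of bounded variation *)

Section bounded_variation_extra.
Context {R : realType}.
Local Notation leb := (@lebesgue_measure R).
Implicit Types (F : R -> R) (a b : R).

Lemma homo_itv_measurable (f : R -> R) a b : a <= b ->
  {in `[a, b] &, {homo f : x y / x <= y}} -> measurable_fun (`[a, b] : set R) f.
Proof.
(* Clamping the argument to [a, b] makes the function monotone on the whole line. *)
move=> ab fh; pose cl (x : R) := Num.max a (Num.min x b).
have clab x : cl x \in `[a, b].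
  by rewrite in_itv/= /cl le_max lexx/= ge_max ab/= ge_min lexx orbT.
apply: (eq_measurable_fun (f \o cl)).
  move=> x; rewrite inE/= in_itv/= => /andP[ax xb].
  by rewrite /cl min_l// max_r.
apply: nondecreasing_measurable; first exact: measurable_itv.
move=> x y xy /=; apply: fh => //.
rewrite /cl ge_max le_max lexx/= le_max; apply/orP; right.
by rewrite le_min ge_min xy/= ge_min lexx orbT.
Qed.

Lemma bounded_variation_measurable F a b : a <= b -> bounded_variation a b F ->
  measurable_fun (`[a, b] : set R) F.
Proof.
move=> ab bv.
have bvN : bounded_variation a b (\- F) by exact: bounded_variationN.
apply: (eq_measurable_fun ((fine \o pos_tv a F) \- (fine \o neg_tv a F))).
  by move=> x /set_mem/= xab; rewrite [RHS](bounded_variation_pos_neg_tvE bv).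
apply: measurable_funB; apply: homo_itv_measurable => //.
- by move=> x y xab yab xy; apply: (fine_neg_tv_nondecreasing bvN).
- by move=> x y xab yab xy; apply: (fine_neg_tv_nondecreasing bv).
Qed.

Lemma locally_bv_measurable F : (forall a b, 0 < a -> a <= b -> bounded_variation a b F) ->
  measurable_fun (`]0, +oo[ : set R) F.
Proof.
move=> bv.
have -> : (`]0, +oo[ : set R)%classic = \bigcup_k exhaust k.
  apply/seteqP; split => [x|x [k _]]; last first.
    rewrite /exhaust /= !in_itv/= andbT => /andP[kx _].
    by rewrite (lt_le_trans _ kx).
  rewrite /= in_itv/= andbT => x0.
  have := truncnS_gt (Num.max x x^-1).
  exists (Num.truncn (Num.max x x^-1)) => //.
  rewrite /exhaust /= in_itv/=; move: H; rewrite gt_max => /andP[x1 x2].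
  by rewrite (ltW x1) andbT invf_ple ?posrE// ltW.
apply/measurable_fun_bigcup => [k|k]; first exact: measurable_itv.
have kk : k.+1%:R^-1 <= k.+1%:R :> R.
  by rewrite (@le_trans _ _ 1)// ?ler1n// invf_le1// ler1n.
by apply: bounded_variation_measurable => //; apply: bv => //; rewrite invr_gt0.
Qed.

Lemma variation_ge F a b x : bounded_variation a b F -> a <= x <= b ->
  `|F x - F a| <= fine (total_variation a b F).
Proof.
move=> bv /andP[ax xb]; have ab := le_trans ax xb.
have tf : total_variation a b F \is a fin_num by apply/bounded_variationP.
rewrite -lee_fin fineK// (le_trans (total_variation_ge F ax))//.
by rewrite (total_variationD F ax xb) leeDl// total_variation_ge0.
Qed.

(* One step of summation by parts, [K] being a primitive of [k]. *)
Lemma abel_step F (K k : R -> R) a b L : a < b -> bounded_variation a b F ->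
  (forall x, a <= x <= b -> is_derive x (1 : R) K (k x)) ->
  {within `[a, b], continuous k} -> (forall x, a <= x <= b -> `|k x| <= L) ->
  leb.-integrable `[a, b] (EFin \o (fun x => F x * k x)) /\
  `|\int[leb]_(x in `[a, b]) (F x * k x) - (F b * K b - F a * K a)| <=
  fine (total_variation a b F) * (L * (b - a) + `|K b|).
Proof.
move=> ab bv dK ck kL; set V := fine _.
have mab : measurable (`[a, b] : set (measurableTypeR R))%classic by exact: measurable_itv.
have mF := bounded_variation_measurable (ltW ab) bv.
have ik := continuous_itv_integrable ck.
have mk := integrable_measurable ik.
have Vx x : a <= x <= b -> `|F x - F a| <= V by exact: variation_ge.
have V0 : 0 <= V by apply: le_trans (normr_ge0 _) (Vx a _); rewrite lexx ltW.
have leb_ab : leb (`[a, b] : set R)%classic = (b - a)%:E.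
  by rewrite lebesgue_measure_itv/= lte_fin ab.
have ic c : leb.-integrable `[a, b] (EFin \o cst c).
  apply/integrableP; split; first exact/measurable_EFinP/measurable_cst.
  rewrite [X in (X < _)%E](_ : _ = (`|c|%:E * leb (`[a, b] : set R)%classic)%E); last by rewrite -integral_cst.
  by rewrite [X in (_ * X)%E]leb_ab -EFinM ltry.
have L0 : 0 <= L by apply: le_trans (normr_ge0 _) (kL a _); rewrite lexx ltW.
have id : leb.-integrable `[a, b] (EFin \o (fun x => (F x - F a) * k x)).
  apply: (integrable_le mab _ (ic (V * L))).
    by apply: measurable_funM => //; apply: measurable_funB.
  by move=> x /=; rewrite in_itv/= => xab; rewrite normrM ler_pM// ?Vx// kL.
have iFa : leb.-integrable `[a, b] (EFin \o (fun x => F a * k x)) by exact: integrable_mulC.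
split.
  apply: (eq_integrable mab _ _ _ (integrableD mab id iFa)) => x _ /=.
  by rewrite -EFinD; congr EFin; ring.
have -> : \int[leb]_(x in `[a, b]) (F x * k x) =
    \int[leb]_(x in `[a, b]) ((F x - F a) * k x) + F a * (K b - K a).
  rewrite -(RFTC_itv ab dK ck) -RintegralZl// -RintegralD//.
  by apply: eq_Rintegral => x _; ring.
set I := \int[leb]_(x in `[a, b]) _.
have -> : I + F a * (K b - K a) - (F b * K b - F a * K a) = I - (F b - F a) * K b by ring.
rewrite (le_trans (ler_normB _ _))// mulrDr lerD//; last first.
  by rewrite normrM ler_wpM2r// Vx// lexx ltW.
rewrite (le_trans (le_normr_Rintegral mab id))//.
apply: (@le_trans _ _ (\int[leb]_(x in `[a, b]) (cst (V * L) x))).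
  apply: le_Rintegral => //.
    exact: integrable_norm.
  by move=> x /=; rewrite in_itv/= => xab; rewrite normrM ler_pM// ?Vx// kL.
by rewrite Rintegral_cst// [X in _ * fine X]leb_ab /= mulrA.
Qed.

End bounded_variation_extra.

(** * Integration by parts under a weighted variation bound *)

Section weighted_variation.
Context {R : realType} (F : R -> R) (n : nat) (T : R).
Local Notation leb := (@lebesgue_measure R).
Local Notation g := (fun s : R => s `^ (n%:R / 2)).
Hypothesis bvF : forall a b, 0 < a -> a <= b -> bounded_variation a b F.
Hypothesis F0 : F s @[s --> +oo] --> 0.
Hypothesis FT : (tail_int_variation g F 1 <= T%:E)%E.

Lemma pow_half_homo (s t : R) : 0 <= s -> s <= t -> g s <= g t.
Proof. by move=> s0 st; apply: ge0_ler_powR => //; rewrite nnegrE// (le_trans s0). Qed.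

Lemma inf_pow_half (s t : R) : 0 <= s -> s <= t -> g s <= inf [set g x | x in `[s, t]].
Proof.
move=> s0 st; apply: lb_le_inf; first by exists (g s); exists s => //=; rewrite in_itv/= lexx.
move=> _ [x /=] + <-; rewrite in_itv/= => /andP[sx _]; exact: pow_half_homo.
Qed.

Lemma partition_sum_le (s : seq R) (b : R) : itv_partition 1 b s -> 1 <= b ->
  \sum_(i < size s) g (nth b (1 :: s) i) * fine (total_variation (nth b (1 :: s) i) (nth b s i) F) <= T.
Proof.
move=> sb b1; rewrite -lee_fin (le_trans _ FT)//.
apply: (@le_trans _ _ (int_variation g F 1 b)); last first.
  by apply: ereal_sup_ubound; exists b => //=; rewrite in_itv/= b1.
rewrite /int_variation -sumEFin; apply: (@le_trans _ _ (\sum_(i < size s)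
      ((inf [set g x | x in `[nth b (1%R :: s) i, nth b s i]])%:E
        * total_variation (nth b (1%R :: s) i) (nth b s i) F)%E)%R); last first.
  by apply: ereal_sup_ubound; exists s.
apply: lee_sum => i _.
have pos : 1 <= nth b (1 :: s) i.
  by apply: (itv_partition_nth_ge (b := b)) => //; rewrite ltnS ltnW.
have st : nth b (1 :: s) i <= nth b s i.
  by have [/(pathP b)/(_ i (ltn_ord i))/ltW] := sb.
have tf : total_variation (nth b (1 :: s) i) (nth b s i) F \is a fin_num.
  by apply/bounded_variationP => //; apply: bvF => //; rewrite (lt_le_trans ltr01).
rewrite EFinM fineK// lee_wpmul2r ?total_variation_ge0// lee_fin.
by apply: inf_pow_half => //; rewrite (le_trans ler01).
Qed.

(** |F N| is at most the variation on [N, b] plus |F b|, and F b becomes negligible as b grows; the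
    weight on [N, b] is at least [g N], so that variation is already counted in T. *)
Lemma pow_half_F_le (N : R) : 1 <= N -> g N * `|F N| <= T.
Proof.
move=> N1; rewrite leNgt; apply/negP => lt.
have gN : 0 < g N by rewrite powR_gt0// (lt_le_trans ltr01).
have e0 : 0 < (g N * `|F N| - T) / g N by rewrite divr_gt0// subr_gt0.
have [b [Nb Fb]] : exists b, N < b /\ `|F b| < (g N * `|F N| - T) / g N.
  have /cvgrPdist_lt/(_ _ e0) near_b := F0.
  have near_b2 : \forall b \near (pinfty_nbhs R), N < b by apply: nbhs_pinfty_gt; exact: num_real.
  have [b [h1 h2]] := filter_ex (filterI near_b2 near_b).
  by exists b; split => //; move: h2; rewrite sub0r normrN.
have b1 : 1 <= b by rewrite (le_trans N1)// ltW.
have VT : g N * fine (total_variation N b F) <= T.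
  (* A partition is strictly increasing, so N can be inserted as an intermediate point only if it
     differs from 1. *)
  move: N1; rewrite le_eqVlt => /predU1P[E|N1].
    have := @partition_sum_le [:: b] b _ b1; rewrite big_ord1/= -E; apply.
    by split => //=; rewrite andbT E.
  have := @partition_sum_le [:: N; b] b _ b1; rewrite !big_ord_recl big_ord0/= addr0.
  move=> h; rewrite (le_trans _ (h _))//; last by split => //=; rewrite N1 Nb.
  rewrite lerDr mulr_ge0 ?powR_ge0// fine_ge0// total_variation_ge0// ltW//.
have bvNb : bounded_variation N b F by apply: bvF; [exact: lt_le_trans ltr01 N1|exact: ltW].
have : `|F N| <= fine (total_variation N b F) + `|F b|.
  have := variation_ge bvNb (x := b); rewrite lexx ltW//= => /(_ isT) h.
  have -> : F N = F b - (F b - F N) by rewrite opprB addrC subrK.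
  by rewrite (le_trans (ler_normB _ _))// addrC lerD2r.
rewrite -(ler_pM2l gN) mulrDr => h.
move: Fb; rewrite ltr_pdivlMr// mulrC => Fb.
have : g N * `|F N| < g N * `|F N|.
  rewrite {1}(le_lt_trans h)// (@lt_le_trans _ _ (T + (g N * `|F N| - T)))//.
    exact: ler_ltD.
  by rewrite addrC subrK.
by rewrite ltxx.
Qed.

Lemma uniform_partition (delta : R) (M : nat) : 0 < delta ->
  let s := [seq 1 + i.+1%:R * delta | i <- iota 0 M] in
  itv_partition 1 (1 + M%:R * delta) s.
Proof.
move=> d0 s; have sz : size s = M by rewrite size_map size_iota.
have nE i : (i <= M)%N -> nth 0 (1 :: s) i = 1 + i%:R * delta.
  case: i => [|i] iM /=; first by rewrite mul0r addr0.
  by rewrite (nth_map 0%N) ?size_iota// nth_iota.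
split.
  apply/(pathP 0) => i; rewrite sz => iM; rewrite nE ?(ltnW iM)//.
  have -> : nth 0 s i = 1 + i.+1%:R * delta by rewrite -(nE i.+1).
  by rewrite ltrD2l ltr_pM2r// ltr_nat.
by rewrite (last_nth 0) sz nE.
Qed.

Lemma uniform_sum_le (delta : R) (M : nat) : 0 < delta ->
  \sum_(0 <= i < M) g (1 + i%:R * delta) *
    fine (total_variation (1 + i%:R * delta) (1 + i.+1%:R * delta) F) <= T.
Proof.
move=> d0; have P := uniform_partition M d0.
have b1 : 1 <= 1 + M%:R * delta by rewrite lerDl mulr_ge0// ltW.
rewrite (le_trans _ (partition_sum_le P b1))// size_map size_iota big_mkord.
apply: ler_sum => i _; have iM := ltn_ord i.
have -> : nth (1 + M%:R * delta) [seq 1 + i.+1%:R * delta | i <- iota 0 M] i = 1 + i.+1%:R * delta.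
  by rewrite (nth_map 0%N) ?size_iota// nth_iota.
rewrite (_ : nth _ (1 :: _) i = 1 + i%:R * delta)//.
case: (i : nat) iM => [|j] jM /=; first by rewrite mul0r addr0.
by rewrite (nth_map 0%N) ?size_iota ?(ltnW jM)// nth_iota// ltnW.
Qed.

Lemma Rintegral_itv_split (h : R -> R) (a c b : R) : a <= c -> c <= b ->
  leb.-integrable `[a, b] (EFin \o h) ->
  \int[leb]_(x in `[a, b]) h x = \int[leb]_(x in `[a, c]) h x + \int[leb]_(x in `[c, b]) h x.
Proof.
move=> ac cb ih; apply/eqP; rewrite addrC -subr_eq; apply/eqP.
rewrite Rintegral_itvB// ?bnd_simp// Rintegral_itv_obnd_cbnd//.
apply: (integrableS _ _ _ ih) => //; try exact: measurable_itv.
by move=> x /=; rewrite !in_itv/= => /andP[cx ->]; rewrite (le_trans ac (ltW cx)).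
Qed.

(** The bound is free of N and L, which only decide how fine the partition is. In 2^n + 3, one unit
    comes from [L * delta <= C1], 2^n from the growth of g between neighbouring points (x_(i+1) <= 2
    x_i), and 2 from the boundary terms at 1 and N. *)
Lemma integral_by_parts_le (K k : R -> R) (N C1 L : R) : 1 < N -> 0 < C1 ->
  (forall x, 1 <= x <= N -> is_derive x (1 : R) K (k x)) ->
  {within `[1, N], continuous k} -> (forall x, 1 <= x <= N -> `|k x| <= L) ->
  (forall x, 1 <= x <= N -> `|K x| <= C1 * g x) ->
  `|\int[leb]_(x in `[1, N]) (F x * k x)| <= C1 * (2 ^+ n + 3) * T.
Proof.
move=> N1 C0 dK ck kL KC.
have L0 : 0 <= L by apply: le_trans (normr_ge0 _) (kL 1 _); rewrite lexx ltW.
(* Large enough to give both [delta <= 1] and [L * delta <= C1]. *)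
pose M := (Num.truncn ((N - 1) * (1 + L / C1))).+1.
pose delta := (N - 1) / M%:R.
have M0 : 0 < M%:R :> R by rewrite ltr0n.
have d0 : 0 < delta by rewrite divr_gt0// subr_gt0.
have MB : (N - 1) * (1 + L / C1) <= M%:R by rewrite ltW// truncnS_gt.
have LC : 0 <= L / C1 by rewrite divr_ge0// ltW.
have d1 : delta <= 1.
  rewrite ler_pdivrMr// mul1r (le_trans _ MB)// ler_peMr ?lerDl//.
  by rewrite subr_ge0 ltW.
have Ld : L * delta <= C1.
  rewrite /delta mulrA ler_pdivrMr// -ler_pdivrMl// (le_trans _ MB)//.
  by rewrite [L * _]mulrC mulrCA [C1^-1 * _]mulrC ler_wpM2l ?subr_ge0 ?(ltW N1)// lerDr.
have NE : 1 + M%:R * delta = N by rewrite /delta mulrC divfK ?gt_eqF// addrC subrK.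
pose x_ i : R := 1 + i%:R * delta.
have x1 i : 1 <= x_ i by rewrite lerDl mulr_ge0// ltW.
have xS i : x_ i < x_ i.+1 by rewrite ltrD2l ltr_pM2r// ltr_nat.
have xN i : (i <= M)%N -> x_ i <= N.
  by move=> iM; rewrite -NE lerD2l ler_pM2r// ler_nat.
have x0 i : 0 < x_ i by rewrite (lt_le_trans ltr01).
pose V i := fine (total_variation (x_ i) (x_ i.+1) F).
have V0 i : 0 <= V i by rewrite fine_ge0// total_variation_ge0// ltW.
have cks a b : 1 <= a -> b <= N -> {within `[a, b], continuous k}.
  move=> a1 bN; apply: continuous_subspaceW ck => y /=; rewrite !in_itv/= => /andP[ay yb].
  by rewrite (le_trans a1 ay) (le_trans yb bN).
have step j : (j <= M)%N ->
    `|\int[leb]_(x in `[1, x_ j]) (F x * k x) - (F (x_ j) * K (x_ j) - F 1 * K 1)| <=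
    \sum_(0 <= i < j) C1 * (2 ^+ n + 1) * (g (x_ i) * V i).
  elim: j => [_|j IH jM].
    by rewrite /x_ mul0r addr0 set_itv1 Rintegral_set1 subrr subrr normr0 big_geq.
  rewrite big_nat_recr//=.
  have jN : x_ j.+1 <= N by exact: xN.
  have sub y : x_ j <= y <= x_ j.+1 -> 1 <= y <= N.
    by move=> /andP[jy yj]; rewrite (le_trans (x1 j) jy) (le_trans yj jN).
  have [ij Ej] := abel_step (xS j) (bvF (x0 j) (ltW (xS j))) (fun y h => dK y (sub y h))
    (cks _ _ (x1 j) jN) (fun y h => kL y (sub y h)).
  have x1S : 1 < x_ j.+1 by rewrite (le_lt_trans (x1 j)).
  have sub1 y : 1 <= y <= x_ j.+1 -> 1 <= y <= N.
    by move=> /andP[-> yj]; rewrite (le_trans yj jN).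
  have [i1 _] := abel_step x1S (bvF ltr01 (ltW x1S)) (fun y h => dK y (sub1 y h))
    (cks _ _ (lexx 1) jN) (fun y h => kL y (sub1 y h)).
  rewrite (Rintegral_itv_split (x1 j) (ltW (xS j)) i1).
  move: (IH (ltnW jM)) Ej; rewrite -/(V j).
  set I1 := \int[leb]_(x in `[1, x_ j]) _; set I2 := \int[leb]_(x in `[x_ j, x_ j.+1]) _.
  move=> {}IH Ej.
  have -> : I1 + I2 - (F (x_ j.+1) * K (x_ j.+1) - F 1 * K 1) =
    (I1 - (F (x_ j) * K (x_ j) - F 1 * K 1)) +
    (I2 - (F (x_ j.+1) * K (x_ j.+1) - F (x_ j) * K (x_ j))) by ring.
  rewrite (le_trans (ler_normD _ _))// lerD// (le_trans Ej)//.
  rewrite [V j * _]mulrC mulrA ler_wpM2r//.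
  have dE : x_ j.+1 - x_ j = delta by rewrite /x_ -natr1; ring.
  have g1 : 1 <= g (x_ j) by rewrite -[X in X <= _](powRr0 (x_ j)) ler_powR.
  rewrite dE -mulrA mulrDl mul1r mulrDr addrC lerD//.
    rewrite (le_trans (KC _ _)) ?jN ?(ltW x1S)// ler_wpM2l ?(ltW C0)//.
    apply: (@le_trans _ _ (g (2 * x_ j))).
      apply: pow_half_homo; first exact: ltW.
      have := x1 j; move: dE => /eqP; rewrite subr_eq => /eqP ->; lra.
    rewrite powRM ?(ltW (x0 j))// ler_wpM2r ?powR_ge0// -powR_mulrn// ler_powR ?ler1n//.
    by rewrite ler_pdivrMr// ler_peMr ?ler1n.
  by rewrite (le_trans Ld)// ler_peMr// ltW.
have xM : x_ M = N by [].
have := step M (leqnn M); rewrite xM -mulr_sumr => {}step.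
have T0 : 0 <= T by rewrite (le_trans _ (pow_half_F_le (lexx 1)))// mulr_ge0 ?powR_ge0.
have FK y : 1 <= y <= N -> `|F y * K y| <= C1 * T.
  move=> yN; rewrite normrM mulrC (le_trans (ler_wpM2r _ (KC y yN)))//.
  rewrite -mulrA ler_wpM2l ?(ltW C0)//.
  by apply: pow_half_F_le; case/andP: yN.
set I := \int[leb]_(x in `[1, N]) _ in step *.
have -> : I = (I - (F N * K N - F 1 * K 1)) + (F N * K N - F 1 * K 1) by ring.
rewrite (le_trans (ler_normD _ _))//.
apply: (@le_trans _ _ (C1 * (2 ^+ n + 1) * T + (C1 * T + C1 * T))); last by lra.
apply: lerD.
  rewrite (le_trans step)// ler_wpM2l ?mulr_ge0 ?addr_ge0 ?exprn_ge0 ?(ltW C0)//.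
  exact: uniform_sum_le.
by rewrite (le_trans (ler_normB _ _))// lerD// FK// ?lexx ltW.
Qed.

End weighted_variation.

Lemma integrable_setU_disj {d} {X : measurableType d} {R : realType}
    (mu : {measure set X -> \bar R}) (A B : set X) (f : X -> R) :
  measurable A -> measurable B -> [disjoint A & B] ->
  mu.-integrable A (EFin \o f) -> mu.-integrable B (EFin \o f) ->
  mu.-integrable (A `|` B) (EFin \o f).
Proof.
move=> mA mB AB /integrableP[mfA iA] /integrableP[mfB iB].
have mf : measurable_fun (A `|` B) (EFin \o f) by apply/measurable_funU.
apply/integrableP; split=> //; rewrite ge0_integral_setU//.
  by rewrite lte_add_pinfty.
exact: measurableT_comp.
Qed.

(** * Integrals over the frequency variable *)

Section frequency_side.
Context {R : realType} (F : R -> R) (n : nat) (T : R).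
Local Notation leb := (@lebesgue_measure R).
Local Notation g := (fun s : R => s `^ (n%:R / 2)).
Hypothesis bvF : forall a b, 0 < a -> a <= b -> bounded_variation a b F.
Hypothesis F0 : F s @[s --> +oo] --> 0.
Hypothesis FT : (tail_int_variation g F 1 <= T%:E)%E.
Hypothesis F01 : (\int[leb]_(s in `]0%R, 1%R]) (s ^+ n * `|F s|)%:E < +oo)%E.
Hypothesis Fy : forall z, 0 < z -> (\int[leb]_(u in `]z, +oo[) (`|F u| / u)%:E < +oo)%E.

Let mF : measurable_fun (`]0, +oo[ : set R) F.
Proof. exact: locally_bv_measurable. Qed.

Let subset_0y (i : interval R) : (forall x, x \in i -> 0 < x) -> [set` i] `<=` (`]0, +oo[ : set R).
Proof. by move=> i0 x /= /i0; rewrite in_itv/= andbT. Qed.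

Lemma integrable_F_near0 : leb.-integrable `]0, 1] (EFin \o (fun s => F s * s ^+ n)).
Proof.
apply/integrableP; split.
  apply/measurable_EFinP; apply: measurable_funM; last exact: measurable_funX.
  apply: measurable_funS mF => //; apply: subset_0y => x; rewrite in_itv/=; by case/andP.
apply: le_lt_trans F01; rewrite le_eqVlt; apply/orP; left; apply/eqP.
apply: eq_integral => s; rewrite inE/= in_itv/= => /andP[s0 _].
by rewrite normrM mulrC (ger0_norm (exprn_ge0 _ (ltW s0))).
Qed.

Lemma integrable_F_tail (z : R) : 0 < z -> leb.-integrable `]z, +oo[ (EFin \o (fun s => F s / s)).
Proof.
move=> z0; apply/integrableP; split.
  apply/measurable_EFinP; apply: measurable_funM.
    apply: measurable_funS mF => //; apply: subset_0y => x; rewrite in_itv/= andbT.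
    exact: lt_trans.
  apply: (eq_measurable_fun (fun s : R => s `^ (-1))).
    by move=> s; rewrite inE/= in_itv/= andbT => zs; rewrite powR_inv1// (le_trans (ltW z0))// ltW.
  by apply: measurable_funTS; exact: measurable_powR.
apply: le_lt_trans (Fy z0); rewrite le_eqVlt; apply/orP; left; apply/eqP.
apply: eq_integral => s; rewrite inE/= in_itv/= andbT => zs.
by rewrite normrM [`|s^-1|]ger0_norm// invr_ge0 (le_trans (ltW z0))// ltW.
Qed.

Lemma integrable_bP_mul (D : set (measurableTypeR R)) (h : R -> R) q : measurable D -> 0 <= q ->
  leb.-integrable D (EFin \o h) ->
  leb.-integrable D (EFin \o (fun s => h s * bP n (s ^+ 2 * q))).
Proof.
move=> mD q0 ih; have mh := integrable_measurable ih.
have ih' : leb.-integrable D (EFin \o (fun s => `|h s|)) by exact: integrable_norm.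
apply: (integrable_le mD _ ih').
  apply: measurable_funM => //; apply: measurable_funTS.
  apply: (measurableT_comp (f := bP n)).
    apply: continuous_measurable_fun => x; exact: is_derive_continuous (is_derive_bP n x).
  by apply: measurable_funM => //; exact: measurable_funX.
by move=> s _ /=; rewrite normrM ler_piMr// bP_le1// mulr_ge0// sqr_ge0.
Qed.

(* [- s^n j'(z s) / z] is a primitive of [s^n j(z s)], by the Bessel equation. *)
Lemma is_derive_bessel_primitive (z s : R) : 0 < z -> 0 < s ->
  is_derive s (1 : R) (fun s => - z^-1 * (s ^+ n * bj1 n (z * s))) (s ^+ n * bj n (z * s)).
Proof.
move=> z0 s0; have dz : is_derive s (1 : R) (fun s => z * s) (z * 1).
  exact: (is_derive_mulC (f := id) z (is_derive_id s (1 : R))).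
have := is_derive_mulC (- z^-1) (is_derive_mul (is_derive_exprn n s)
  (is_derive_chain (is_derive_bj1 n (z * s)) dz)).
congr is_derive; rewrite bj_ode /bj1.
have -> : n%:R * s ^+ n.-1 = n%:R * s ^+ n / s.
  by case: (n) => [|k]; rewrite ?mul0r//= exprSr mulrA mulfK// gt_eqF.
by field; rewrite !gt_eqF.
Qed.

(** The point is uniformity in N. On ]0, 1] one uses |j| <= 1; beyond 1, integration by parts with
    the primitive -s^n j'(z s)/z, which grows like s^(n/2) by [bj1_decay]. *)
Lemma truncated_bound : exists2 A : R, 0 <= A & forall z N : R, 0 < z -> 1 < N ->
  `|\int[leb]_(s in `]0, N]) (F s * (s ^+ n * bj n (z * s)))| <= A * (1 + (z ^+ n.+2)^-1).
Proof.
have [B B0 HB] := @bj1_decay R n.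
pose I0 := \int[leb]_(s in `]0, 1]) `|F s * s ^+ n|.
have I00 : 0 <= I0 by apply: Rintegral_ge0.
have T0 : 0 <= T.
  by rewrite (le_trans _ (pow_half_F_le bvF F0 FT (lexx 1)))// mulr_ge0 ?powR_ge0.
exists (I0 + Num.sqrt B * (2 ^+ n + 3) * T).
  by rewrite addr_ge0// !mulr_ge0 ?sqrtr_ge0 ?addr_ge0 ?exprn_ge0.
move=> z N z0 N1.
pose k s := s ^+ n * bj n (z * s).
have i1 : leb.-integrable `]0, 1] (EFin \o (fun s => F s * k s)).
  have := integrable_bP_mul (q := z ^+ 2) _ (sqr_ge0 z) integrable_F_near0.
  move=> /(_ (measurable_itv _)); apply: eq_integrable => // s _ /=.
  by rewrite /k /bj exprMn [z ^+ 2 * _]mulrC mulrA.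
(* The square of s^n j'(z s)/z is (z s)^n j'(z s)^2 times s^n / z^(n+2), and the first product is at
   most B. *)
pose C1 := Num.sqrt (B / z ^+ n.+2).
have C0 : 0 < C1 by rewrite sqrtr_gt0 divr_gt0// exprn_gt0.
have dK s : 1 <= s <= N -> is_derive s (1 : R) (fun s => - z^-1 * (s ^+ n * bj1 n (z * s))) (k s).
  by move=> /andP[s1 _]; apply: is_derive_bessel_primitive => //; rewrite (lt_le_trans ltr01).
have ck : {within `[1, N], continuous k}.
  apply: continuous_subspaceT => s; apply: cvgM; first exact: exprn_continuous.
  have dz : is_derive s (1 : R) (fun s => z * s) (z * 1).
    exact: (is_derive_mulC (f := id) z (is_derive_id s (1 : R))).
  exact: is_derive_continuous (is_derive_chain (is_derive_bj n (z * s)) dz).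
(* A bound growing with N is harmless here, as it does not enter the conclusion of
   [integral_by_parts_le]. *)
have kL s : 1 <= s <= N -> `|k s| <= N ^+ n.
  move=> /andP[s1 sN]; have s0 := le_trans ler01 s1.
  rewrite normrM -[leRHS]mulr1 ler_pM// ?bP_le1 ?sqr_ge0//.
  by rewrite ger0_norm ?exprn_ge0// lerXn2r ?nnegrE// (le_trans s0).
have KC s : 1 <= s <= N -> `|- z^-1 * (s ^+ n * bj1 n (z * s))| <= C1 * g s.
  move=> /andP[s1 _]; have s0 := lt_le_trans ltr01 s1.
  have gE : g s = Num.sqrt (s ^+ n).
    by rewrite powRrM powR12_sqrt ?powR_ge0// powR_mulrn// ltW.
  have r0 : 0 <= C1 * g s by rewrite mulr_ge0 ?powR_ge0// ltW.
  rewrite -ler_sqr ?nnegrE// real_normK ?num_real// gE exprMn [X in _ <= X]exprMn.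
  rewrite /C1 !sqr_sqrtr ?exprn_ge0 ?(ltW s0) ?divr_ge0 ?(ltW B0) ?exprn_ge0 ?(ltW z0)//.
  rewrite sqrrN exprMn.
  have H : (z * s) ^+ n * bj1 n (z * s) ^+ 2 <= B by apply: HB; rewrite mulr_ge0// ltW.
  have -> : z^-1 ^+ 2 * ((s ^+ n) ^+ 2 * bj1 n (z * s) ^+ 2) =
      (z * s) ^+ n * bj1 n (z * s) ^+ 2 * (s ^+ n / z ^+ n.+2).
    move: (bj1 n (z * s)) => b; rewrite (exprMn _ z s) (exprSr z n.+1) (exprSr z n).
    move: (z ^+ n) (expf_neq0 n (lt0r_neq0 z0)) => zn zn0; field.
    by rewrite zn0 lt0r_neq0.
  have -> : B / z ^+ n.+2 * s ^+ n = B * (s ^+ n / z ^+ n.+2) by rewrite mulrAC mulrA.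
  by rewrite ler_wpM2r// divr_ge0// exprn_ge0 ?(ltW s0) ?(ltW z0).
have main := integral_by_parts_le bvF F0 FT N1 C0 dK ck kL KC.
have [i2 _] := abel_step N1 (bvF ltr01 (ltW N1)) dK ck kL.
have i2' : leb.-integrable `]1, N] (EFin \o (fun s => F s * k s)).
  apply: (integrableS _ _ _ i2) => //; try exact: measurable_itv.
  by move=> x /=; rewrite !in_itv/= => /andP[/ltW -> ->].
have -> : \int[leb]_(s in `]0, N]) (F s * k s) =
    \int[leb]_(s in `]0, 1]) (F s * k s) + \int[leb]_(s in `[1, N]) (F s * k s).
  rewrite -(Rintegral_itv_obnd_cbnd i2').
  have -> : (`]0, N]%classic : set R) = `]0, 1] `|` `]1, N].
    apply/seteqP; split => [x|x] /=; rewrite !in_itv/=.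
      by move=> /andP[x0 xN]; case: (leP x 1) => x1; [left; rewrite x0|right].
    move=> [/andP[x0 x1]|/andP[x1 xN]]; first by rewrite x0 (le_trans x1 (ltW N1)).
    by rewrite (lt_trans ltr01 x1).
  have dis : [disjoint (`]0, 1]%classic : set (measurableTypeR R)) & `]1, N]%classic].
    apply/disj_set2P; rewrite -subset0 => x [] /=; rewrite !in_itv/= => /andP[_ x1] /andP[].
    by rewrite ltNge x1.
  by rewrite Rintegral_setU//; exact: integrable_setU_disj.
rewrite (le_trans (ler_normD _ _))//.
have h1 : `|\int[leb]_(s in `]0, 1]) (F s * k s)| <= I0.
  have m01 : measurable (`]0, 1]%classic : set (measurableTypeR R)) by exact: measurable_itv.
  rewrite (le_trans (le_normr_Rintegral m01 i1))//; apply: le_Rintegral => //.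
  - exact: integrable_norm.
  - by apply: integrable_norm => //; exact: integrable_F_near0.
  - by move=> s _; rewrite /k mulrA normrM ler_piMr// bP_le1 ?sqr_ge0.
have z2 : 0 < (z ^+ n.+2)^-1 by rewrite invr_gt0 exprn_gt0.
(* sqrt y <= 1 + y trades the power -(n+2)/2 of z for the integral power -(n+2). *)
have C1le : C1 <= Num.sqrt B * (1 + (z ^+ n.+2)^-1).
  rewrite /C1 sqrtrM ?(ltW B0)// ler_wpM2l ?sqrtr_ge0//.
  by have := sqr_sqrtr (ltW z2); have := sqrtr_ge0 ((z ^+ n.+2)^-1); nra.
have q0 : 0 <= (2 ^+ n + 3) * T by rewrite mulr_ge0// addr_ge0// exprn_ge0.
have := ler_wpM2r q0 C1le; rewrite !mulrA => h2.
rewrite mulrDl; apply: lerD.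
  by rewrite (le_trans h1)// ler_peMr// lerDl ltW.
by rewrite (le_trans main)// (le_trans h2)// le_eqVlt; apply/orP; left; apply/eqP; ring.
Qed.

(** The majorant for all dominated limits in the frequency; it does not involve the Gaussian
    parameter, which varies along some of these limits. *)
Lemma freq_bound_integrable (G M : R) :
  leb.-integrable `]0, +oo[
    (EFin \o (fun s => `|F s| * (if s <= 1 then G * s ^+ n else M / s))).
Proof.
have -> : (`]0, +oo[%classic : set R) = `]0, 1] `|` `]1, +oo[.
  apply/seteqP; split => [x|x] /=; rewrite !in_itv/= ?andbT.
    by move=> x0; case: (leP x 1) => x1; [left; rewrite x0|right].
  by move=> [/andP[x0 x1]//|x1]; rewrite (lt_trans ltr01 x1).
have dis : [disjoint (`]0, 1]%classic : set (measurableTypeR R)) & `]1, +oo[%classic].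
  apply/disj_set2P; rewrite -subset0 => x [] /=; rewrite !in_itv/= => /andP[_ x1].
  by rewrite andbT ltNge x1.
apply: integrable_setU_disj => //.
- have m01 : measurable (`]0, 1]%classic : set (measurableTypeR R)) by exact: measurable_itv.
  have h : leb.-integrable `]0, 1] (EFin \o (fun s => G * `|F s * s ^+ n|)).
    by apply: integrable_mulC => //; apply: integrable_norm => //; exact: integrable_F_near0.
  apply: eq_integrable h => // s; rewrite inE/= in_itv/= => /andP[s0 s1] /=.
  by rewrite s1 normrM (ger0_norm (exprn_ge0 _ (ltW s0))) mulrCA.
- have m1 : measurable (`]1, +oo[%classic : set (measurableTypeR R)) by exact: measurable_itv.
  have h : leb.-integrable `]1, +oo[ (EFin \o (fun s => M * `|F s / s|)).
    by apply: integrable_mulC => //; apply: integrable_norm => //; exact: integrable_F_tail.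
  apply: eq_integrable h => // s; rewrite inE/= in_itv/= andbT => s1 /=.
  have s0 := lt_trans ltr01 s1; rewrite leNgt s1/= normrM.
  by rewrite [`|s^-1|]ger0_norm ?invr_ge0 ?ltW// mulrCA.
Qed.

Let m0y : measurable (`]0, +oo[%classic : set (measurableTypeR R)).
Proof. exact: measurable_itv. Qed.

Definition freq_weight (A s : R) : R := gmass n A * expR (- (s ^+ 2 / (4 * A))) * s ^+ n.

(** Up to [fourier_const], this will be the Gaussian mean of f about a centre y with |y|^2 = q. *)
Definition freq_integral (A q : R) : R :=
  \int[leb]_(s in `]0, +oo[) (F s * (freq_weight A s * bP n (s ^+ 2 * q))).

Lemma freq_weight_ge0 (A s : R) : 0 < A -> 0 <= s -> 0 <= freq_weight A s.
Proof. by move=> A0 s0; rewrite !mulr_ge0 ?expR_ge0 ?exprn_ge0// ltW// gmass_gt0. Qed.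

Lemma freq_weight_le (A s : R) : 0 < A -> 0 <= s -> freq_weight A s <= gmass n A * s ^+ n.
Proof.
move=> A0 s0; rewrite ler_wpM2r ?exprn_ge0// ler_piMr// ?(ltW (gmass_gt0 _ A0))//.
by rewrite -expR0 ler_expR oppr_le0 divr_ge0 ?sqr_ge0// mulr_ge0// ltW.
Qed.

Definition freq_const : R := Num.sqrt pi ^+ n.+1 * 2 ^+ n.+1 * (1 + n.+1`!%:R).

(* Uniform in [A], since [s^(n+1) A^(-(n+1)/2)] is a power of [s^2/4A]. *)
Lemma freq_weight_le_inv (A s : R) : 0 < A -> 0 < s -> freq_weight A s <= freq_const / s.
Proof.
move=> A0 s0; rewrite ler_pdivlMr//.
have sA0 : 0 < Num.sqrt A by rewrite sqrtr_gt0.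
pose r := s / (2 * Num.sqrt A).
have r0 : 0 <= r by rewrite divr_ge0 ?mulr_ge0// ltW.
have rE : s ^+ 2 / (4 * A) = r ^+ 2.
  rewrite /r exprMn exprVn exprMn sqr_sqrtr ?ltW//.
  by have -> : (2 : R) ^+ 2 = 4 by ring.
have sE : s = r * (2 * Num.sqrt A) by rewrite /r divfK// mulf_neq0// gt_eqF.
have -> : freq_weight A s * s = Num.sqrt pi ^+ n.+1 * 2 ^+ n.+1 * (r ^+ n.+1 * expR (- r ^+ 2)).
  rewrite /freq_weight rE -mulrA -exprSr /gmass {1}sE !exprMn.
  move: (expR _) (expf_neq0 n.+1 (lt0r_neq0 sA0)) => e.
  move: (Num.sqrt A ^+ n.+1) (2 ^+ n.+1) (r ^+ n.+1) (Num.sqrt pi ^+ n.+1) => x1 x2 x3 x4 x10.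
  by field.
rewrite /freq_const ler_wpM2l ?mulr_ge0 ?exprn_ge0 ?sqrtr_ge0//.
rewrite expRN ler_pdivrMr ?expR_gt0//.
have q0 : 0 <= r ^+ 2 by exact: sqr_ge0.
have h1 : r ^+ n.+1 <= 1 + (r ^+ 2) ^+ n.+1.
  rewrite exprAC; move: (r ^+ n.+1) (exprn_ge0 n.+1 r0) => w w0; nra.
have h2 := expR_ge1Dxn n q0.
have f0 : 0 < (n.+1`!%:R : R) by rewrite ltr0n fact_gt0.
have h3 : (r ^+ 2) ^+ n.+1 <= n.+1`!%:R * expR (r ^+ 2).
  by rewrite -ler_pdivrMl// (le_trans _ h2)// mulrC lerDr.
rewrite (le_trans h1)// mulrDl mul1r lerD// (le_trans _ h2)// lerDl.
by rewrite divr_ge0 ?exprn_ge0// ltW.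
Qed.

Lemma freq_integrand_le (G A q s : R) : 0 < A -> 0 <= q -> gmass n A <= G -> 0 < s ->
  `|F s * (freq_weight A s * bP n (s ^+ 2 * q))| <=
  `|F s| * (if s <= 1 then G * s ^+ n else freq_const / s).
Proof.
move=> A0 q0 AG s0; rewrite normrM ler_wpM2l// normrM.
rewrite (ger0_norm (freq_weight_ge0 A0 (ltW s0))).
apply: (@le_trans _ _ (freq_weight A s)).
  by rewrite ler_piMr ?freq_weight_ge0 ?(ltW s0)// bP_le1// mulr_ge0// sqr_ge0.
case: ifP => _; last exact: freq_weight_le_inv.
by rewrite (le_trans (freq_weight_le A0 (ltW s0)))// ler_wpM2r// exprn_ge0// ltW.
Qed.

Lemma measurable_freq_weight (A q : R) :
  measurable_fun (setT : set (measurableTypeR R)) (fun s => freq_weight A s * bP n (s ^+ 2 * q)).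
Proof.
apply: continuous_measurable_fun => s; apply: cvgM.
  apply: cvgM; last exact: exprn_continuous.
  apply: cvgM; first exact: cvg_cst.
  apply: (continuous_comp (f := fun s : R => - (s ^+ 2 / (4 * A))) (g := @expR R)); last exact: continuous_expR.
  by apply: cvgN; apply: cvgM; [exact: exprn_continuous|exact: cvg_cst].
apply: (continuous_comp (f := fun s : R => s ^+ 2 * q) (g := bP n)).
  by apply: cvgM; [exact: exprn_continuous|exact: cvg_cst].
exact: is_derive_continuous (is_derive_bP n _).
Qed.

Lemma measurable_freq_integrand (A q : R) :
  measurable_fun (`]0, +oo[ : set (measurableTypeR R))
    (fun s => F s * (freq_weight A s * bP n (s ^+ 2 * q))).
Proof. by apply: measurable_funM => //; apply: measurable_funTS; exact: measurable_freq_weight. Qed.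

Lemma integrable_freq (A q : R) : 0 < A -> 0 <= q ->
  leb.-integrable `]0, +oo[ (EFin \o (fun s => F s * (freq_weight A s * bP n (s ^+ 2 * q)))).
Proof.
move=> A0 q0; apply: (integrable_le m0y _ (freq_bound_integrable (gmass n A) freq_const)).
  exact: measurable_freq_integrand.
by move=> s /=; rewrite in_itv/= andbT => s0; apply: freq_integrand_le.
Qed.

(** The integrand tends to 0 with [gmass]. A common majorant exists because the weight is controlled
    by the first mass for s <= 1 and, uniformly in A, by [freq_const / s] beyond. *)
Lemma freq_integral_cvg0 (A q : nat -> R) : (forall k, 0 < A k) -> (forall k, 0 <= q k) ->
  (forall k, gmass n (A k) <= gmass n (A 0%N)) -> (fun k => gmass n (A k)) @ \oo --> 0 ->
  (fun k => freq_integral (A k) (q k)) @ \oo --> 0.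
Proof.
move=> A0 q0 AG A_0.
have -> : (0 : R) = \int[leb]_(s in `]0, +oo[) (cst 0 s) by rewrite Rintegral_cst//= mul0r.
apply: (dominated_Rintegral_cvg m0y _ _
  (freq_bound_integrable (gmass n (A 0%N)) freq_const) _).2 => [k|s|k s] /=.
- exact: measurable_freq_integrand.
- rewrite in_itv/= andbT => s0.
  apply/norm_cvg0P.
  apply: (@squeeze_cvgr _ _ _ _ (cst 0) (fun k => `|F s| * (gmass n (A k) * s ^+ n))).
  + apply: nearW => k /=; rewrite normr_ge0/= normrM ler_wpM2l// normrM.
    rewrite (ger0_norm (freq_weight_ge0 (A0 k) (ltW s0))).
    apply: le_trans (freq_weight_le (A0 k) (ltW s0)).
    by rewrite ler_piMr ?freq_weight_ge0 ?(ltW s0)// bP_le1// mulr_ge0// sqr_ge0.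
  + exact: cvg_cst.
  + rewrite (_ : 0 = `|F s| * (0 * s ^+ n)); last by rewrite mul0r mulr0.
    by apply: cvgM; [exact: cvg_cst|apply: cvgM => //; exact: cvg_cst].
- by rewrite in_itv/= andbT => s0; apply: freq_integrand_le.
Qed.

(** The shift to N + 2 keeps the cut-off above 1, as [truncated_bound] requires for the same
    truncation. *)
Lemma truncated_freq_cvg (A q : R) : 0 < A -> 0 <= q ->
  (fun N : nat => \int[leb]_(s in `]0, N.+2%:R]) (F s * (freq_weight A s * bP n (s ^+ 2 * q))))
    @ \oo --> freq_integral A q.
Proof.
move=> A0 q0.
pose h s := F s * (freq_weight A s * bP n (s ^+ 2 * q)).
have -> : (fun N : nat => \int[leb]_(s in `]0, N.+2%:R]) h s) =
   (fun N : nat => \int[leb]_(s in `]0, +oo[) (\1_`]0, N.+2%:R] s * h s)).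
  apply/funext => N; rewrite Rintegral_indic [RHS]Rintegral_indic.
  apply: eq_Rintegral => s _; rewrite !indicE mulrA; congr (_ * _).
  case: (boolP (s \in _)) => [|_]; last by rewrite mulr0.
  by rewrite inE/= in_itv/= => /andP[s0 _]; rewrite mem_set ?mul1r//= in_itv/= s0.
apply: (dominated_Rintegral_cvg m0y _ _
  (freq_bound_integrable (gmass n A) freq_const) _).2 => [k|s|k s] /=.
- apply: measurable_funM; last exact: measurable_freq_integrand.
  by apply: measurable_funTS; exact: measurable_indic.
- rewrite in_itv/= andbT => s0.
  apply: cvg_trans (cvg_cst (F := \oo) (h s)); apply: near_eq_cvg; near=> N.
  rewrite indicE mem_set ?mul1r//= in_itv/= s0/=.
  have := truncnS_gt s => /ltW/le_trans; apply; rewrite ler_nat.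
  by apply: (@leq_trans N) => //; [near: N; exact: nbhs_infty_ge|rewrite -addn2 leq_addr].
- rewrite in_itv/= andbT => s0.
  apply: le_trans (freq_integrand_le A0 q0 (lexx _) s0).
  by rewrite indicE normrM ler_piMl//; case: (_ \in _); rewrite ?normr1 ?normr0.
Unshelve. all: by end_near. Qed.

End frequency_side.

(** * Gaussians damped at the origin *)

Section damped_gaussian.
Context {R : realType} (n : nat).
Implicit Types (x y : 'rV[R]_n.+1) (a b k : R).
Local Notation lebn := (@lebesgue_rV R n.+1).

Definition fourier_const : R := sphere_area (R := R) n.+1 / (2 * pi) ^+ n.+1.

Lemma fourier_const_gt0 : 0 < fourier_const.
Proof. by rewrite divr_gt0 ?sphere_area_gt0// exprn_gt0// mulr_gt0// pi_gt0. Qed.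

Lemma enorm_gt0 x : x != 0 -> 0 < enorm x.
Proof.
move=> x0; rewrite lt_neqAle enorm_ge0 andbT eq_sym; apply: contra x0 => /eqP e0.
have : nsq x = 0 by rewrite -enorm_sqr e0 expr0n.
move=> /eqP; rewrite psumr_eq0 => [/allP h|i _]; last exact: sqr_ge0.
apply/eqP/rowP => i; rewrite mxE.
by have := h i (mem_index_enum _); rewrite sqrf_eq0 => /eqP.
Qed.

Lemma gmass_nincr a b : 0 < a -> a <= b -> gmass n b <= gmass n a.
Proof.
move=> a0 ab; have b0 := lt_le_trans a0 ab.
rewrite ler_pM2l ?exprn_gt0 ?sqrtr_gt0 ?pi_gt0//.
rewrite lef_pV2 ?posrE ?exprn_gt0 ?sqrtr_gt0//.
by rewrite lerXn2r ?nnegrE ?sqrtr_ge0//; exact: ler_wsqrtr.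
Qed.

Lemma gmass_cvg0 a b : 0 < a -> 1 <= b -> (fun m : nat => gmass n (a + m.+1%:R * b)) @ \oo --> (0 : R).
Proof.
(* One of the n + 1 square roots in the denominator provides the decay m^(-1/2); the others are
   bounded below by sqrt a. *)
move=> a0 b1; pose G : R := Num.sqrt pi ^+ n.+1 / Num.sqrt a ^+ n.
have sa : 0 < Num.sqrt a by rewrite sqrtr_gt0.
apply: (@squeeze_cvgr _ _ _ _ (cst 0) (fun m => G * Num.sqrt m.+1%:R^-1)).
- apply: nearW => m; have m0 : 0 < m.+1%:R :> R by [].
  have mb : m.+1%:R <= a + m.+1%:R * b.
    by rewrite -[leLHS]add0r lerD ?(ltW a0)// ler_peMr.
  have ab : a <= a + m.+1%:R * b by rewrite lerDl mulr_ge0// (le_trans ler01).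
  have A0 := lt_le_trans a0 ab.
  rewrite ltW ?gmass_gt0//= /gmass /G -mulrA ler_wpM2l ?exprn_ge0 ?sqrtr_ge0//.
  rewrite sqrtrV ?ler0n// -invfM lef_pV2 ?posrE ?mulr_gt0 ?exprn_gt0 ?sqrtr_gt0//.
  rewrite exprSr ler_pM ?exprn_ge0 ?sqrtr_ge0//; last exact: ler_wsqrtr.
  by rewrite lerXn2r ?nnegrE ?sqrtr_ge0//; exact: ler_wsqrtr.
- exact: cvg_cst.
- rewrite -(mulr0 G) -(@sqrtr0 R); apply: cvgM; first exact: cvg_cst.
  by apply: (continuous_cvg _ (@sqrt_continuous R 0)); exact: cvg_harmonic.
Qed.

Lemma gaussian_mul a b y x : 0 < a -> 0 <= b ->
  gaussian a y x * expR (- (b * nsq x)) =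
  expR (- (a * b / (a + b) * nsq y)) * gaussian (a + b) (a / (a + b) *: y) x.
Proof.
move=> a0 b0; rewrite /gaussian -!expRD; congr expR.
have ab : a + b != 0 by rewrite gt_eqF// ltr_pwDl.
have -> : x - y = x + -1 *: y by rewrite scaleN1r.
have -> : x - (a / (a + b)) *: y = x + (- (a / (a + b))) *: y by rewrite scaleNr.
by rewrite !nsqD !nsqZ !dotZl; field.
Qed.

(* The second factor vanishes to the order 2 (n + 1) at the origin, which absorbs
   the singularity |x|^-(n+2) in the bound for the truncated Fourier integrals. *)
Definition damped a y (k : R) x : R := gaussian a y x * (1 - expR (- (k * nsq x))) ^+ n.+1.

Definition damped_coef a y k (i : nat) : R :=
  (-1) ^+ i * 'C(n.+1, i)%:R * expR (- (a * (k * i%:R) / (a + k * i%:R) * nsq y)).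

(** Binomial expansion of the damping factor; completing the square makes each term a Gaussian
    again, sharper and with its centre pulled towards the origin. *)
Lemma dampedE a y k x : 0 < a -> 0 <= k -> damped a y k x =
  \sum_(i < n.+2) damped_coef a y k i *
     gaussian (a + k * i%:R) (a / (a + k * i%:R) *: y) x.
Proof.
move=> a0 k0; rewrite /damped exprBn mulr_sumr; apply: eq_bigr => i _.
rewrite expr1n mulr1 /damped_coef -[RHS]mulrA -gaussian_mul ?mulr_ge0//.
rewrite -expRM_natl mulrN -mulr_natr [i%:R * _]mulrCA mulrA [k * i%:R]mulrC; ring.
Qed.

Lemma damped_itv a y k x : 0 <= k -> 0 <= damped a y k x <= gaussian a y x.
Proof.
move=> k0; have e1 : 0 <= 1 - expR (- (k * nsq x)) <= 1.
  by rewrite subr_ge0 gerBl expR_ge0 andbT -expR0 ler_expR oppr_le0 mulr_ge0// nsq_ge0.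
case/andP: e1 => e0 e1; rewrite /damped mulr_ge0 ?gaussian_ge0 ?exprn_ge0//=.
by rewrite ler_piMr ?gaussian_ge0// exprn_ile1.
Qed.

Lemma measurable_damped a y k : measurable_fun setT (damped a y k).
Proof.
apply: measurable_funM; first exact: measurable_gaussian.
apply: measurable_funX; apply: measurable_funB => //.
apply: measurableT_comp => //; apply: measurableT_comp => //.
by apply: measurable_funM => //; exact: measurable_nsq.
Qed.

End damped_gaussian.

(** * The Gaussian transform of f *)

Section transform.
Context {R : realType} (n : nat) (c C : R) (F : R -> R) (f : 'rV[R]_n.+1 -> R).
Implicit Types (x y : 'rV[R]_n.+1).
Local Notation leb := (@lebesgue_measure R).
Local Notation lebn := (@lebesgue_rV R n.+1).
Local Notation g := (fun s : R => s `^ (n%:R / 2)).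
Hypothesis hf : GMhat c C F f.
Hypothesis c1 : 1 < c.

Lemma GMhat_bv a b : 0 < a -> a <= b -> bounded_variation a b F.
Proof. by case: hf => -[+ _ _ _ _]; exact. Qed.

Lemma GMhat_cvg0 : F s @[s --> +oo] --> 0.
Proof. by case: hf => -[_ + _ _ _]; exact. Qed.

Lemma GMhat_tail z : 0 < z -> (\int[leb]_(u in `]z, +oo[) (`|F u| / u)%:E < +oo)%E.
Proof.
have c0 := lt_trans ltr01 c1.
(* The GM condition speaks of the integral from z/c, so it is applied at z c. *)
move=> z0; case: hf => -[_ _ /(_ (z * c) (mulr_gt0 z0 c0))[_ +] _ _].
by rewrite (mulfK (lt0r_neq0 c0)).
Qed.

Lemma tail_int_variation_ge0 (h : R -> R) z : (0 <= tail_int_variation h F z)%E.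
Proof.
apply: (@le_trans _ _ (int_variation h F z z)); last first.
  by apply: ereal_sup_ubound; exists z => //=; rewrite in_itv/= lexx.
by apply: ereal_sup_ubound; exists [::] => /=; rewrite ?big_ord0.
Qed.

Lemma GMhat_near0 : (\int[leb]_(s in `]0%R, 1%R]) (s ^+ n * `|F s|)%:E < +oo)%E.
Proof.
case: hf => _ + _; apply: le_lt_trans => /=.
by rewrite leeDl// tail_int_variation_ge0.
Qed.

Let T := fine (tail_int_variation g F 1).

Let FT : (tail_int_variation g F 1 <= T%:E)%E.
Proof.
have i0 : (0 <= \int[leb]_(s in `]0%R, 1%R]) (s ^+ n * `|F s|)%:E)%E.
  apply: integral_ge0 => s /=; rewrite in_itv/= => /andP[s0 _].
  by rewrite lee_fin mulr_ge0// exprn_ge0// ltW.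
rewrite /T fineK// ge0_fin_numE ?tail_int_variation_ge0//.
by case: hf => _ + _; apply: le_lt_trans => /=; rewrite leeDr.
Qed.

Local Notation area := (@fourier_const R n).

Definition truncated (N : R) x : R :=
  area * \int[leb]_(s in `]0, N]) (F s * (s ^+ n * bj n (enorm x * s))).

Lemma truncated_cvg x : x != 0 -> truncated k.+2%:R x @[k --> \oo] --> f x.
Proof.
move=> x0; case: hf => _ _ [f0 -> // /(_ _ (enorm_gt0 x0)) h].
have cy : (k.+2%:R : R) @[k --> \oo] --> +oo.
  apply/cvgryPge => M; exists (Num.truncn M).+1 => // k /= hk.
  by rewrite (le_trans (ltW (truncnS_gt M)))// ler_nat (leq_trans hk)// -addn2 leq_addr.
have := cvg_comp _ _ cy h; apply: cvg_trans; apply: near_eq_cvg; apply: nearW => k /=.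
congr (_ * _); apply: eq_Rintegral => s; rewrite inE/= in_itv/= => /andP[s0 _].
by rewrite besseljE ?mulr_gt0 ?enorm_gt0// /bj mulrA mulrAC.
Qed.

Lemma integrable_F_pow N : leb.-integrable `]0, N] (EFin \o (fun s => F s * s ^+ n)).
Proof.
have m01 : measurable (`]0, 1]%classic : set (measurableTypeR R)) by exact: measurable_itv.
have m1 : measurable (`]1, N]%classic : set (measurableTypeR R)) by exact: measurable_itv.
have dis : [disjoint (`]0, 1]%classic : set (measurableTypeR R)) & `]1, N]%classic].
  apply/disj_set2P; rewrite -subset0 => x [] /=; rewrite !in_itv/= => /andP[_ x1] /andP[].
  by rewrite ltNge x1.
have i1 := integrable_F_near0 GMhat_bv GMhat_near0.
have i2 : leb.-integrable `]1, N] (EFin \o (fun s => F s * s ^+ n)).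
  have i3 : leb.-integrable `]1, N] (EFin \o (fun s => N ^+ n.+1 * `|F s / s|)).
    apply: integrable_mulC => //; apply: integrable_norm => //.
    apply: (integrableS _ _ _ (integrable_F_tail GMhat_bv GMhat_tail ltr01)) => //; try exact: measurable_itv.
    by move=> x /=; rewrite !in_itv/= => /andP[-> _].
  apply: (integrable_le m1 _ i3).
    apply: measurable_funM; last exact: measurable_funX.
    apply: measurable_funS (locally_bv_measurable GMhat_bv); first exact: measurable_itv.
    by move=> x /=; rewrite !in_itv/= andbT => /andP[/(lt_trans ltr01)].
  move=> s /=; rewrite in_itv/= => /andP[s1 sN]; have s0 := lt_trans ltr01 s1.
  rewrite normrM [`|F s / s|]normrM mulrCA ler_wpM2l// !ger0_norm ?exprn_ge0 ?invr_ge0 ?(ltW s0)//.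
  by rewrite ler_pdivlMr// -exprSr lerXn2r ?nnegrE ?(ltW s0)// (le_trans (ltW s0)).
have := integrable_setU_disj m01 m1 dis i1 i2; apply: integrableS.
- exact: measurableU.
- exact: measurable_itv.
- move=> x /=; rewrite !in_itv/= => /andP[x0 xN].
  by case: (leP x 1) => x1; [left; rewrite x0|right].
Qed.

(** At fixed N the function F(s) s^n is integrable on ]0, N], so Fubini applies, and the integral in
    x is given by [bP_gaussian]. *)
Lemma truncated_gaussian N a y : 0 < a ->
  lebn.-integrable setT (EFin \o (fun x => truncated N x * gaussian a y x)) /\
  \int[lebn]_x (truncated N x * gaussian a y x) =
  area * \int[leb]_(s in `]0, N]) (F s * (freq_weight n a s * bP n (s ^+ 2 * nsq y))).
Proof.
move=> a0; have m0N : measurable (`]0, N]%classic : set (measurableTypeR R)) by exact: measurable_itv.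
pose k (p : 'rV[R]_n.+1 * measurableTypeR R) := gaussian a y p.1 *
  ((\1_(`]0, N]) p.2 * (F p.2 * p.2 ^+ n)) * bP n (p.2 ^+ 2 * nsq p.1)).
have iF : leb.-integrable setT (EFin \o (fun s => \1_(`]0, N]) s * (F s * s ^+ n))).
  by apply: (integrable_indic_mul _ _ m0N).1; exact: integrable_F_pow.
have mk : measurable_fun setT k.
  apply: measurable_funM.
    exact: (measurableT_comp (measurable_gaussian a y) measurable_fst).
  apply: measurable_funM.
    exact: (measurableT_comp (integrable_measurable iF) measurable_snd).
  apply: (measurableT_comp (f := bP n)).
    apply: continuous_measurable_fun => z; exact: is_derive_continuous (is_derive_bP n z).
  apply: measurable_funM; first by apply: measurable_funX; exact: measurable_snd.
  exact: (measurableT_comp (@measurable_nsq R n.+1) measurable_fst).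
have ik : (lebn \x leb)%E.-integrable setT (EFin \o k).
  have iF' : leb.-integrable setT (EFin \o (fun s => `|\1_(`]0, N]) s * (F s * s ^+ n)|)).
    exact: integrable_norm.
  apply: (integrable_prod_le mk (integrable_gaussian y a0) iF') => x s.
  rewrite normrM ger0_norm ?gaussian_ge0// ler_wpM2l ?gaussian_ge0// normrM ler_piMr//.
  by rewrite bP_le1// mulr_ge0 ?sqr_ge0 ?nsq_ge0.
have [i1 E] := Rintegral_fubini ik.
have inner x : \int[leb]_s k (x, s) = gaussian a y x *
    \int[leb]_(s in `]0, N]) (F s * (s ^+ n * bj n (enorm x * s))).
  rewrite [in RHS]Rintegral_indic -RintegralZl//=.
    apply: eq_Rintegral => s _; rewrite /k /= /bj exprMn enorm_sqr.
    by rewrite [nsq x * _]mulrC; ring.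
  apply: (integrable_indic_mul _ _ m0N).1.
  have := integrable_bP_mul n m0N (nsq_ge0 x) (integrable_F_pow N).
  apply: eq_integrable => // s _ /=.
  by rewrite /bj exprMn enorm_sqr [nsq x * _]mulrC mulrA.
have tE x : truncated N x * gaussian a y x = area * \int[leb]_s k (x, s).
  by rewrite inner /truncated; ring.
split.
  have := integrable_mulC area measurableT i1.
  by apply: eq_integrable => // x _ /=; rewrite tE.
under eq_Rintegral do rewrite tE.
rewrite RintegralZl// E; congr (_ * _); rewrite [RHS]Rintegral_indic.
apply: eq_Rintegral => s _; rewrite /k /=.
have [ig Eg] := bP_gaussian y s a0.
transitivity (\1_`]0, N] s * (F s * s ^+ n) *
    \int[lebn]_x (bP n (s ^+ 2 * nsq x) * gaussian a y x)).
  rewrite -RintegralZl//; apply: eq_Rintegral => x _; ring.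
by rewrite Eg /freq_weight; ring.
Qed.

(** Only |x| < 1 needs the damping: there (1 - e^(-k|x|^2))^(n+1) <= k^(n+1) |x|^(2n+2) <= k^(n+1)
    |x|^(n+2) cancels the singularity of [truncated_bound]. The majorant is independent of N. *)
Lemma truncated_damped_le : exists2 A, 0 <= A & forall N a y k x, 1 < N -> 0 <= k -> x != 0 ->
  `|truncated N x * damped a y k x| <= A * (2 + k ^+ n.+1) * gaussian a y x.
Proof.
have [A A0 HA] := truncated_bound GMhat_bv GMhat_cvg0 FT GMhat_near0.
have area0 : 0 <= area by rewrite ltW// fourier_const_gt0.
exists (area * A); first exact: mulr_ge0.
move=> N a y k x N1 k0 /enorm_gt0; set z := enorm x => z0.
rewrite normrM /truncated normrM (ger0_norm area0).
have /andP[d0 d1] := damped_itv a y x k0; rewrite (ger0_norm d0) -(mulrA area) -(mulrA area) -(mulrA area) ler_wpM2l// -(mulrA A).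
apply: (@le_trans _ _ (A * (1 + (z ^+ n.+2)^-1) * damped a y k x)).
  by apply: ler_wpM2r => //; apply: HA.
rewrite -mulrA ler_wpM2l// mulrDl mul1r.
have -> : (2 + k ^+ n.+1) * gaussian a y x =
  gaussian a y x + (1 + k ^+ n.+1) * gaussian a y x by ring.
rewrite lerD//.
have kn0 : 0 <= k ^+ n.+1 by exact: exprn_ge0.
have g0 := gaussian_ge0 a y x.
have zi0 : 0 <= (z ^+ n.+2)^-1 by rewrite invr_ge0 exprn_ge0// ltW.
case: (leP 1 z) => z1.
  apply: (@le_trans _ _ (gaussian a y x)); last by rewrite ler_peMl// lerDl.
  by rewrite (le_trans _ d1)// ler_piMl// invf_le1 ?exprn_gt0// exprn_ege1.
rewrite /damped mulrCA mulrC ler_wpM2r//.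
have e0 : 0 <= 1 - expR (- (k * nsq x)).
  by rewrite subr_ge0 -expR0 ler_expR oppr_le0 mulr_ge0// nsq_ge0.
have e1 : 1 - expR (- (k * nsq x)) <= k * z ^+ 2.
  by rewrite enorm_sqr; have := expR_ge1Dx (- (k * nsq x)); lra.
rewrite ler_pdivrMl ?exprn_gt0//.
apply: (@le_trans _ _ ((k * z ^+ 2) ^+ n.+1)).
  by rewrite lerXn2r ?nnegrE// mulr_ge0// sqr_ge0.
rewrite exprMn mulrC; apply: ler_pM => //; first by rewrite exprn_ge0// sqr_ge0.
  rewrite -exprM; apply: ler_wiXn2l; rewrite ?(ltW z0) ?(ltW z1)//.
  by rewrite mul2n -addnn addnS addSn ltnS; exact: leq_addr.
by rewrite lerDr.
Qed.

(** Limits are taken off the origin, where the truncated integrals converge to f and their bound is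
    finite. *)
Let off0 : set 'rV[R]_n.+1 := ~` [set 0].

Let moff0 : measurable off0.
Proof. by apply: measurableC; exact: measurable_rV_set0. Qed.

Let Rintegral_off0 (h : 'rV[R]_n.+1 -> R) : lebn.-integrable setT (EFin \o h) ->
  \int[lebn]_(x in off0) h x = \int[lebn]_x h x.
Proof.
move=> ih; rewrite /Rintegral [in RHS](negligible_integral (@measurable_rV_set0 R n) measurableT ih).
  by rewrite setTD.
exact: lebesgue_rV_set1.
Qed.

Lemma integrable_freq_mul a (m : R -> R) M : 0 < a ->
  measurable_fun (setT : set (measurableTypeR R)) m -> (forall s, `|m s| <= M) ->
  leb.-integrable `]0, +oo[ (EFin \o (fun s => F s * (freq_weight n a s * m s))).
Proof.
move=> a0 mm mM.
have m0y : measurable (`]0, +oo[%classic : set (measurableTypeR R)) by exact: measurable_itv.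
have i0 := integrable_freq GMhat_bv GMhat_near0 GMhat_tail a0 (lexx 0).
have i1 : leb.-integrable `]0, +oo[ (EFin \o (fun s => F s * freq_weight n a s)).
  by apply: eq_integrable i0 => // s _ /=; rewrite mulr0 bP0 mulr1.
have i2 : leb.-integrable `]0, +oo[ (EFin \o (fun s => M * `|F s * freq_weight n a s|)).
  by apply: integrable_mulC => //; exact: integrable_norm.
apply: (integrable_le m0y _ i2).
  apply: (eq_measurable_fun (fun s => F s * freq_weight n a s * m s)).
    by move=> s _; rewrite mulrA.
  by apply: measurable_funM; [exact: integrable_measurable i1|exact: measurable_funTS].
by move=> s _ /=; rewrite mulrA normrM mulrC ler_wpM2r.
Qed.

(** N tends to infinity on both sides: on the left with the majorant of [truncated_damped_le], on
    the right in each of the finitely many terms. *)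
Lemma damped_transform a y k : 0 < a -> 0 <= k ->
  \int[lebn]_(x in off0) (f x * damped a y k x) =
  area * \sum_(i < n.+2) damped_coef a y k i *
    freq_integral F n (a + k * i%:R) (nsq ((a / (a + k * i%:R)) *: y)).
Proof.
move=> a0 k0; have ai0 (i : 'I_n.+2) : 0 < a + k * i%:R by rewrite ltr_pwDl// mulr_ge0.
pose J (N : nat) (i : 'I_n.+2) := area * \int[leb]_(s in `]0, N.+2%:R])
  (F s * (freq_weight n (a + k * i%:R) s * bP n (s ^+ 2 * nsq ((a / (a + k * i%:R)) *: y)))).
have step N : lebn.-integrable setT (EFin \o (fun x => truncated N.+2%:R x * damped a y k x)) /\
    \int[lebn]_x (truncated N.+2%:R x * damped a y k x) =
    \sum_(i < n.+2) damped_coef a y k i * J N i.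
  pose h (i : 'I_n.+2) x := damped_coef a y k i *
    (truncated N.+2%:R x * gaussian (a + k * i%:R) ((a / (a + k * i%:R)) *: y) x).
  have ih i : lebn.-integrable setT (EFin \o h i).
    by apply: integrable_mulC => //; have [] := truncated_gaussian N.+2%:R ((a / (a + k * i%:R)) *: y) (ai0 i).
  have hE x : truncated N.+2%:R x * damped a y k x = \sum_(i < n.+2) h i x.
    by rewrite dampedE// mulr_sumr; apply: eq_bigr => i _; rewrite /h; ring.
  have [i1 i2] := Rintegral_sum (index_enum 'I_n.+2) measurableT ih.
  split; first by apply: eq_integrable i1 => // x _ /=; rewrite hE.
  under eq_Rintegral do rewrite hE.
  rewrite i2; apply: eq_bigr => i _.
  have [j1 j2] := truncated_gaussian N.+2%:R ((a / (a + k * i%:R)) *: y) (ai0 i).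
  by rewrite RintegralZl// j2.
have [A A0 HA] := truncated_damped_le.
have ig : lebn.-integrable off0 (EFin \o (fun x => A * (2 + k ^+ n.+1) * gaussian a y x)).
  apply: integrable_mulC => //; apply: (integrableS measurableT _ _ (integrable_gaussian y a0)) => //.
have lim1 : (fun N => \int[lebn]_(x in off0) (truncated N.+2%:R x * damped a y k x)) @ \oo
    --> \int[lebn]_(x in off0) (f x * damped a y k x).
  apply: (dominated_Rintegral_cvg moff0 _ _ ig _).2 => [N|x x0|N x x0].
  - apply: measurable_funTS; exact: integrable_measurable (step N).1.
  - by apply: cvgM; [apply: truncated_cvg; exact/eqP|exact: cvg_cst].
  - by apply: HA => //; [rewrite ltr1n|exact/eqP].
have lim2 : (fun N => \int[lebn]_(x in off0) (truncated N.+2%:R x * damped a y k x)) @ \oo -->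
    \sum_(i < n.+2) damped_coef a y k i * (area *
      freq_integral F n (a + k * i%:R) (nsq ((a / (a + k * i%:R)) *: y))).
  rewrite (_ : (fun N => _) = (fun N => \sum_(i < n.+2) damped_coef a y k i * J N i)).
    apply: (cvg_big add_continuous) => i _; apply: cvgM; first exact: cvg_cst.
    apply: cvgM; first exact: cvg_cst.
    by apply: (truncated_freq_cvg GMhat_bv GMhat_near0 GMhat_tail) => //; exact: nsq_ge0.
  by apply/funext => N; rewrite Rintegral_off0 ?(step N).2//; exact: (step N).1.
rewrite (cvg_unique _ lim1 lim2)// mulr_sumr; apply: eq_bigr => i _; ring.
Qed.

(** The damping is removed by k = m + 1 tending to infinity. On the left |f| times the Gaussian
    dominates; on the right the terms with i > 0 vanish, since the parameter a + k i grows and its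
    mass tends to 0. *)
Lemma gaussian_transform a y : 0 < a ->
  lebn.-integrable setT (EFin \o (fun x => f x * gaussian a y x)) ->
  \int[lebn]_x (f x * gaussian a y x) = area * freq_integral F n a (nsq y).
Proof.
move=> a0 ifg; have ifg' := integrableS measurableT moff0 (@subsetT _ _) ifg.
have ig : lebn.-integrable off0 (EFin \o (fun x => `|f x * gaussian a y x|)).
  exact: integrable_norm.
(* Measurability of f is recovered from the integrable product by dividing the Gaussian out. *)
have mf : measurable_fun off0 f.
  apply: (eq_measurable_fun (fun x => (f x * gaussian a y x) * expR (a * nsq (x - y)))).
    by move=> x _; rewrite -mulrA /gaussian -expRD addNr expR0 mulr1.
  apply: measurable_funM; first exact: integrable_measurable ifg'.
  apply: measurable_funTS; apply: measurableT_comp => //.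
  apply: measurable_funM => //; apply: (measurableT_comp (@measurable_nsq R n.+1)).
  apply: (eq_measurable_fun (fun x => 1 *: x + - y)); last exact: measurable_affine_rV.
  by move=> x _; rewrite scale1r.
have lim1 : (fun m : nat => \int[lebn]_(x in off0) (f x * damped a y m.+1%:R x)) @ \oo
    --> \int[lebn]_(x in off0) (f x * gaussian a y x).
  apply: (dominated_Rintegral_cvg moff0 _ _ ig _).2 => [m|x x0|m x x0].
  - apply: measurable_funM => //; apply: measurable_funTS; exact: measurable_damped.
  - rewrite (_ : f x * gaussian a y x = f x * (gaussian a y x * (1 - 0) ^+ n.+1)); last first.
      by rewrite subr0 expr1n mulr1.
    apply: cvgM; first exact: cvg_cst.
    apply: cvgM; first exact: cvg_cst.
    apply: (continuous_cvg _ (@exprn_continuous R n.+1 _)).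
    apply: cvgB; first exact: cvg_cst.
    have x2 : 0 < nsq x.
      by rewrite -enorm_sqr exprn_gt0// enorm_gt0//; exact/eqP.
    apply: (@squeeze_cvgr _ _ _ _ (cst 0) (fun m : nat => (nsq x)^-1 * m.+1%:R^-1)).
    + apply: nearW => m; rewrite expR_ge0/= expRN -invfM lef_pV2 ?posrE ?expR_gt0 ?mulr_gt0//.
      by rewrite mulrC (le_trans _ (expR_ge1Dx _))// lerDr.
    + exact: cvg_cst.
    + rewrite -(mulr0 (nsq x)^-1); apply: cvgM; first exact: cvg_cst.
      exact: cvg_harmonic.
  - rewrite normrM [leRHS]normrM ler_wpM2l//; have /andP[d0 d1] := damped_itv a y x (ler0n R m.+1).
    by rewrite !ger0_norm ?gaussian_ge0.
have lim2 : (fun m : nat => \int[lebn]_(x in off0) (f x * damped a y m.+1%:R x)) @ \oo -->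
    area * freq_integral F n a (nsq y).
  (* The term i = 0 is the undamped Gaussian and does not depend on m. *)
  rewrite (_ : (fun m => _) = (fun m : nat => area * (freq_integral F n a (nsq y) +
     \sum_(i < n.+1) damped_coef a y m.+1%:R i.+1 *
    freq_integral F n (a + m.+1%:R * i.+1%:R) (nsq ((a / (a + m.+1%:R * i.+1%:R)) *: y))))); last first.
    apply/funext => m; rewrite damped_transform// big_ord_recl/=.
    rewrite {1}/damped_coef !mulr0 !addr0 mul0r mul0r oppr0 expR0 expr0 bin0 !mulr1 mul1r.
    by rewrite (divff (lt0r_neq0 a0)) scale1r.
  rewrite -[X in _ --> area * X]addr0; apply: cvgM; first exact: cvg_cst.
  apply: cvgD; first exact: cvg_cst.
  rewrite -[X in _ --> X](_ : \sum_(i < n.+1) (0 : R) = 0); last by rewrite big1.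
  apply: (cvg_big add_continuous) => i _; apply/norm_cvg0P.
  have i1 : 1 <= i.+1%:R :> R by rewrite ler1n.
  have ai m : 0 < a + m.+1%:R * i.+1%:R by rewrite ltr_pwDl// mulr_ge0.
  apply: (@squeeze_cvgr _ _ _ _ (cst 0) (fun m : nat => 'C(n.+1, i.+1)%:R *
    `|freq_integral F n (a + m.+1%:R * i.+1%:R) (nsq ((a / (a + m.+1%:R * i.+1%:R)) *: y))|)).
  - apply: nearW => m; rewrite normr_ge0/= normrM ler_wpM2r// /damped_coef !normrM.
    rewrite normrX normrN1 expr1n mul1r normr_nat ger0_norm ?expR_ge0// ler_piMr//.
    rewrite expR_le1 oppr_le0 mulr_ge0 ?nsq_ge0// divr_ge0 ?(ltW (ai m))//.
    by rewrite !mulr_ge0// ltW.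
  - exact: cvg_cst.
  - rewrite -[X in _ --> X](mulr0 ('C(n.+1, i.+1)%:R : R)); apply: cvgM; first exact: cvg_cst.
    apply/norm_cvg0P; apply: (freq_integral_cvg0 GMhat_bv GMhat_near0 GMhat_tail) => [//|m|m|].
    + exact: nsq_ge0.
    + by apply: gmass_nincr => //; rewrite lerD2l ler_wpM2r// ler_nat.
    + exact: gmass_cvg0.
rewrite -Rintegral_off0//; exact: cvg_unique lim1 lim2.
Qed.

End transform.

(** * Gaussian means, Hoelder's inequality and differences *)

Section gaussian_mean.
Context {R : realType} (n : nat).
Implicit Types (x y v h : 'rV[R]_n.+1) (u : 'rV[R]_n.+1 -> R) (a p q : R).
Local Notation lebn := (@lebesgue_rV R n.+1).

Lemma integral_gaussian a y : 0 < a -> \int[lebn]_x gaussian a y x = gmass n a.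
Proof.
move=> a0; have [_] := bP_gaussian y 0 a0.
rewrite expr0n/= !mul0r oppr0 expR0 !mulr1 bP0 mulr1 => <-.
by apply: eq_Rintegral => x _; rewrite mul0r bP0 mul1r.
Qed.

Lemma Lnorm_gaussian a y q : 0 < a -> 0 < q ->
  'N[lebn]_q%:E[EFin \o gaussian a y]%E = (gmass n (q * a) `^ q^-1)%:E.
Proof.
move=> a0 q0; have qa := mulr_gt0 q0 a0.
rewrite unlock /Lnorm -poweR_EFin -(integral_gaussian y qa); congr (_ `^ _)%E.
rewrite -EFin_Rintegral//; last exact: integrable_gaussian.
apply: eq_integral => x _ /=; rewrite ger0_norm ?gaussian_ge0//; congr EFin.
by rewrite /gaussian -expRM mulrC mulrN mulrA.
Qed.

Definition gaussian_mean a u y : R := \int[lebn]_x (u x * gaussian a y x).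

Definition gaussian_integrable a u :=
  forall y, lebn.-integrable setT (EFin \o (fun x => u x * gaussian a y x)).

(** Hoelder's inequality with the explicit norm of the Gaussian. The bound is the same for every
    centre y, as differences in y require. *)
Lemma gaussian_mean_le a p q u y : 0 < a -> 0 < p -> 0 < q -> p^-1 + q^-1 = 1 ->
  measurable_fun setT u -> ('N[lebn]_p%:E[EFin \o u] < +oo)%E ->
  lebn.-integrable setT (EFin \o (fun x => u x * gaussian a y x)) /\
  \int[lebn]_x `|u x * gaussian a y x| <=
    fine 'N[lebn]_p%:E[EFin \o u]%E * gmass n (q * a) `^ q^-1.
Proof.
move=> a0 p0 q0 pq mu uy.
have Nu : ('N[lebn]_p%:E[EFin \o u] \is a fin_num)%E.
  by rewrite ge0_fin_numE ?Lnorm_ge0.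
have := hoelder lebn mu (measurable_gaussian a y) p0 q0 pq.
rewrite Lnorm1 Lnorm_gaussian// -[X in (_ <= X * _)%E](fineK Nu) -EFinM => H.
have iu : lebn.-integrable setT (EFin \o (fun x => u x * gaussian a y x)).
  apply/integrableP; split.
    by apply/measurable_EFinP; apply: measurable_funM => //; exact: measurable_gaussian.
  by apply: le_lt_trans H _; rewrite ltry.
split=> //; rewrite -lee_fin -EFin_Rintegral//; exact: integrable_norm.
Qed.

Lemma gaussian_mean_shift a u v y : gaussian_integrable a u ->
  lebn.-integrable setT (EFin \o (fun x => u (x + v) * gaussian a y x)) /\
  \int[lebn]_x (u (x + v) * gaussian a y x) = gaussian_mean a u (y + v).
Proof.
move=> iu; have E x : u (1 *: x + v) * gaussian a (y + v) (1 *: x + v) =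
    u (x + v) * gaussian a y x.
  by rewrite scale1r /gaussian opprD addrACA subrr addr0.
split.
  by have := integrable_affine v ltr01 (iu (y + v)); apply: eq_integrable => // x _ /=; rewrite E.
rewrite /gaussian_mean (Rintegral_affine v ltr01 (iu (y + v))) expr1n mul1r.
by apply: eq_Rintegral => x _; rewrite E.
Qed.

(** A Gaussian mean is a convolution, so translations of f become translations of the centre. *)
Lemma gaussian_mean_difference a h u l : gaussian_integrable a u ->
  gaussian_integrable a (iter l (difference h) u) /\
  gaussian_mean a (iter l (difference h) u) = iter l (difference h) (gaussian_mean a u).
Proof.
move=> iu; elim: l => // l [IH1 IH2].
have i y := gaussian_mean_shift h y IH1.
have E x y : difference h (iter l (difference h) u) x * gaussian a y x =
  iter l (difference h) u (x + h) * gaussian a y x - iter l (difference h) u x * gaussian a y x.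
  by rewrite /difference mulrBl.
split=> [y|].
  have := integrableB measurableT (i y).1 (IH1 y).
  by apply: eq_integrable => // x _ /=; rewrite E EFinB.
apply/funext => y; rewrite !iterS -IH2 /gaussian_mean.
under eq_Rintegral do rewrite E.
by rewrite (RintegralB measurableT (i y).1 (IH1 y)) (i y).2.
Qed.

Lemma iter_difference_le l h u M : (forall y, `|u y| <= M) ->
  forall y, `|iter l (difference h) u y| <= 2 ^+ l * M.
Proof.
move=> uM; elim: l => [|l IH] y; first by rewrite expr0 mul1r.
rewrite iterS /difference (le_trans (ler_normB _ _))// exprS -mulrA mulr_natl mulr2n.
exact: lerD.
Qed.

Lemma iter_differenceN l h u : iter l (difference (- h)) (iter l (difference h) u) =
  iter l (fun u => difference (- h) (difference h u)) u.
Proof.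
have comm w : difference (- h) (difference h w) = difference h (difference (- h) w).
  by apply/funext => x; rewrite /difference subrK addrK; ring.
have comml k w : difference (- h) (iter k (difference h) w) = iter k (difference h) (difference (- h) w).
  by elim: k => // k IH; rewrite !iterS comm IH.
elim: l u => // l IH u.
by rewrite iterSr comml [iter l.+1 (difference h) _]iterSr IH -comm [RHS]iterSr.
Qed.

End gaussian_mean.

Lemma bP_cos {R : realType} (v : R) : bP 0 (v ^+ 2) = cos v.
Proof.
have c (k : nat) : bcoef 0 k = (-1) ^+ k / (k.*2)`!%:R :> R.
  elim: k => [|k IH]; first by rewrite expr0 fact0 divr1.
  rewrite bcoefS IH doubleS !factS !natrM exprS.
  have := fact_gt0 k.*2; rewrite -(ltr0n R) => /lt0r_neq0.
  move: (k.*2)`!%:R ((-1) ^+ k) => X Y X0.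
  have -> : (k.*2.+2%:R : R) = 2 * (k%:R + 1) by rewrite -natr1 -natr1 -mul2n natrM; ring.
  have -> : (k.*2.+1%:R : R) = 2 * k%:R + 1 by rewrite -natr1 -mul2n natrM.
  by field; have k0 := ler0n R k; rewrite X0 !gt_eqF//; lra.
have h1 := @cos_series R v.
have h2 : series (fun k => bcoef 0 k * (v ^+ 2) ^+ k) @ \oo --> bP 0 (v ^+ 2).
  exact: (@entire_bcoef R 0 (v ^+ 2)).
have h3 := series_even h2.
suff : series (fun k => if odd k then 0 else bcoef 0 k./2 * (v ^+ 2) ^+ k./2) @ \oo --> cos v.
  exact: cvg_unique h3.
apply: cvg_trans h1; apply: near_eq_cvg; apply: nearW => N.
congr (series _ N); apply/funext => k; rewrite /cos_sgn.
case: ifPn => ok; first by rewrite /= !mul0r.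
rewrite c -exprM mul2n halfK (negbTE ok) subn0 mul1r -exprnP.
by rewrite mulrA mulrAC.
Qed.

(** * The multiplier of differences in dimension one *)

Section one_dimension.
Context {R : realType} (c C : R) (F : R -> R) (f : 'rV[R]_1 -> R).
Local Notation leb := (@lebesgue_measure R).
Hypothesis hf : GMhat c C F f.
Hypothesis c1 : 1 < c.

(** The differences with steps h and -h combine to 2 u(y) - u(y+h) - u(y-h), which multiplies cos(s
    y) by 2 - 2 cos(s h) >= 0. At y = 0 the cosine itself becomes 1. *)
Lemma difference_transform a (h : R) l : 0 < a -> gaussian_integrable a f ->
  iter l (difference (- const_mx h)) (iter l (difference (const_mx h)) (gaussian_mean a f)) 0 =
  fourier_const 0 *
  \int[leb]_(s in `]0, +oo[) (F s * (freq_weight 0 a s * (2 - 2 * cos (s * h)) ^+ l)).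
Proof.
move=> a0 ifa.
have m0y : measurable (`]0, +oo[%classic : set (measurableTypeR R)) by exact: measurable_itv.
pose m k y s := (2 - 2 * cos (s * h)) ^+ k * cos (s * y).
have im k y : leb.-integrable `]0, +oo[ (EFin \o (fun s => F s * (freq_weight 0 a s * m k y s))).
  apply: (integrable_freq_mul hf c1 (M := 4 ^+ k) a0).
    have mc (z : R) : measurable_fun (setT : set (measurableTypeR R)) (fun s => cos (s * z)).
      apply: (measurableT_comp (f := @cos R)).
        by apply: continuous_measurable_fun; exact: continuous_cos.
      exact: measurable_funM.
    apply: measurable_funM => //; apply: measurable_funX; apply: measurable_funB => //.
    exact: measurable_funM.
  move=> s; rewrite normrM normrX -[leRHS]mulr1 ler_pM ?exprn_ge0// ?cos_le1//.
    rewrite lerXn2r ?nnegrE//; have := cos_max (s * h); rewrite !ler_norml; lra.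
  exact: cos_max.
pose Psi k (y : 'rV[R]_1) := \int[leb]_(s in `]0, +oo[) (F s * (freq_weight 0 a s * m k (y ord0 ord0) s)).
have step k : difference (- const_mx h) (difference (const_mx h) (Psi k)) = Psi k.+1.
  apply/funext => y; rewrite /difference /Psi !mxE.
  rewrite -RintegralB// -RintegralB// -RintegralB//.
  - apply: eq_Rintegral => s _; rewrite /m exprS.
    have -> : y ord0 ord0 - h + h = y ord0 ord0 by ring.
    have -> : s * (y ord0 ord0 - h) = s * y ord0 ord0 - s * h by ring.
    have -> : s * (y ord0 ord0 + h) = s * y ord0 ord0 + s * h by ring.
    rewrite cosB cosD; ring.
  - have := integrableB m0y (im k (y ord0 ord0 - h + h)) (im k (y ord0 ord0 - h)).
    by apply: eq_integrable => // s _ /=; rewrite EFinB.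
  - have := integrableB m0y (im k (y ord0 ord0 + h)) (im k (y ord0 ord0)).
    by apply: eq_integrable => // s _ /=; rewrite EFinB.
have E : gaussian_mean a f = (fun y => fourier_const 0 * Psi 0%N y).
  apply/funext => y; rewrite /gaussian_mean (gaussian_transform hf c1 a0 (ifa y)).
  congr (_ * _); apply: eq_Rintegral => s _; congr (_ * (_ * _)).
  rewrite /m expr0 mul1r -bP_cos; congr bP.
  by rewrite exprMn /nsq big_ord1.
rewrite iter_differenceN E.
have -> : iter l (fun u => difference (- const_mx h) (difference (const_mx h) u))
    (fun y => fourier_const 0 * Psi 0%N y) = (fun y => fourier_const 0 * Psi l y).
  elim: l => // l IH; rewrite iterS IH -step.
  by apply/funext => y; rewrite /difference; ring.
congr (_ * _); apply: eq_Rintegral => s _.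
by rewrite /m mxE mulr0 cos0 mulr1.
Qed.

End one_dimension.

(** * The trigonometric identity behind V_(l,t) *)

Section cosine_sums.
Context {R : realType}.
Implicit Types (theta phi : R) (m l k : nat).

(** The real part of e^(i phi) (1 - e^(i theta))^m. *)
Definition cos_difference theta m phi : R :=
  \sum_(0 <= k < m.+1) (-1) ^+ k * 'C(m, k)%:R * cos (phi + k%:R * theta).

Lemma cos_differenceS theta m phi :
  cos_difference theta m.+1 phi = cos_difference theta m phi - cos_difference theta m (phi + theta).
Proof.
rewrite /cos_difference big_nat_recl// [X in _ = X - _]big_nat_recl// [X in _ = _ - X]big_nat_recr//=.
rewrite !bin0 expr0 !mul1r !mul0r !addr0.
under eq_bigr do rewrite binS natrD mulrDr mulrDl.
rewrite big_split/= [X in _ + (X + _) = _]big_nat_recr//= binn bin_small// mulr0 mul0r addr0.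
rewrite opprD addrA -!addrA; congr (_ + (_ + _)).
rewrite [in LHS]big_nat_recr//= -sumrN; congr (_ + _).
  apply: eq_bigr => k _; rewrite exprS !mulN1r !mulNr; congr (- (_ * cos _)).
  by rewrite -natr1; ring.
rewrite exprS mulN1r !mulNr binn; congr (- (_ * cos _)).
by rewrite -natr1; ring.
Qed.

Lemma cos_differenceD2 theta m phi :
  cos_difference theta m phi + cos_difference theta m (phi + 2 * theta) =
  2 * cos theta * cos_difference theta m (phi + theta).
Proof.
rewrite /cos_difference mulr_sumr -big_split/=; apply: eq_bigr => k _.
rewrite -mulrDr [RHS]mulrCA; congr (_ * _).
have -> : phi + k%:R * theta = phi + theta + k%:R * theta - theta by ring.
have -> : phi + 2 * theta + k%:R * theta = phi + theta + k%:R * theta + theta by ring.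
by move: (phi + theta + _) => A; rewrite cosB cosD; ring.
Qed.

(** The complex identity behind it is (1 - e^(i theta))^2 = -e^(i theta) (2 - 2 cos theta). *)
Lemma cos_difference_double theta l phi :
  cos_difference theta l.*2 phi = (-1) ^+ l * (2 - 2 * cos theta) ^+ l * cos (phi + l%:R * theta).
Proof.
elim: l phi => [|l IH] phi.
  by rewrite /cos_difference big_nat1 !expr0 bin0 !mul1r.
rewrite doubleS !cos_differenceS.
have -> : phi + theta + theta = phi + 2 * theta by ring.
have := cos_differenceD2 theta l.*2 phi; rewrite !IH => E.
have -> : phi + l.+1%:R * theta = phi + theta + l%:R * theta by rewrite -natr1; ring.
rewrite !exprS; move: E; set X := cos (phi + l%:R * theta).
set Y := cos (phi + 2 * theta + _); set Z := cos (phi + theta + _).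
move: ((-1) ^+ l) ((2 - 2 * cos theta) ^+ l) => e1 e2 E.
transitivity (e1 * e2 * X + e1 * e2 * Y - 2 * (e1 * e2 * Z)); first by ring.
by rewrite E; ring.
Qed.

(** With phi = -l theta the sum in [cos_difference] is symmetric about its middle term C(2l, l), and
    equal terms pair up. The coefficients of V_(l,t) owe their form to this identity: on cosines, f
    - V_(l,t) f acts as a power of 2 - 2 cos. *)
Lemma cos_sum_expn theta l :
  1 + 2 / 'C(2 * l, l)%:R *
    (\sum_(0 <= j < l) (-1) ^+ j.+1 * 'C(2 * l, l - j.+1)%:R * cos (j.+1%:R * theta)) =
  (2 - 2 * cos theta) ^+ l / 'C(2 * l, l)%:R.
Proof.
have C0 : 'C(2 * l, l)%:R != 0 :> R.
  by rewrite pnatr_eq0 -lt0n bin_gt0 mul2n -addnn leq_addr.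
have sgn0 : ((-1) ^+ l * (-1) ^+ l = 1 :> R) by rewrite -exprD addnn -mul2n exprM sqrrN expr1n expr1n.
set S := \sum_(_ <= _ < _) _.
suff E : (2 - 2 * cos theta) ^+ l = 'C(2 * l, l)%:R + 2 * S by rewrite E; field.
have := cos_difference_double theta l (- (l%:R * theta)).
rewrite addNr cos0 mulr1 -mul2n => /(congr1 (fun x => (-1) ^+ l * x)).
rewrite mulrA sgn0 mul1r => <-.
rewrite /cos_difference (@big_cat_nat _ _ _ l)//=; last by rewrite mul2n -addnn leqW// leq_addr.
rewrite [X in _ + X]big_ltn; last by rewrite ltnS mul2n -addnn leq_addr.
have -> : cos (- (l%:R * theta) + l%:R * theta) = 1 by rewrite addNr cos0.
rewrite !mulrDr mulr1 mulrA sgn0 mul1r.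
have E1 : (-1) ^+ l * (\sum_(0 <= i < l) (-1) ^+ i * 'C(2 * l, i)%:R *
    cos (- (l%:R * theta) + i%:R * theta)) = S.
  rewrite big_nat_rev/= mulr_sumr; apply: eq_big_nat => i /andP[_ il].
  rewrite add0n; have il' : (i.+1 <= l)%N by [].
  have lE : l%:R = (l - i.+1)%:R + i.+1%:R :> R by rewrite -natrD subnK.
  rewrite -[cos _]cosN !mulrA; congr (_ * _ * cos _).
    rewrite -{1}(subnK il') exprD -mulrA [X in _ * X]mulrC mulrA.
    by rewrite -exprD addnn -mul2n exprM sqrrN expr1n expr1n mul1r.
  by rewrite lE; ring.
have E2 : (-1) ^+ l * (\sum_(l.+1 <= i < (2 * l).+1) (-1) ^+ i * 'C(2 * l, i)%:R *
    cos (- (l%:R * theta) + i%:R * theta)) = S.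
  rewrite -{1}[l.+1]add0n big_addn mul2n -addnn subSS addnK mulr_sumr.
  apply: eq_big_nat => i /andP[_ il].
  have iE : (i + l.+1 = l + i.+1)%N by rewrite addnC addSn addnS.
  rewrite iE exprD natrD !mulrA sgn0 mul1r; congr (_ * _%:R * cos _); last by ring.
  by rewrite -bin_sub ?leq_add2l// subnDl mul2n addnn.
by rewrite E1 E2; ring.
Qed.

End cosine_sums.

(** By convexity a power lies above its tangent at m; integrated, this is Jensen's inequality. *)
Lemma expn_tangent_le (R : realType) (x m : R) k : 0 <= x -> 0 <= m ->
  m ^+ k.+1 + k.+1%:R * m ^+ k * (x - m) <= x ^+ k.+1.
Proof.
move=> x0 m0; elim: k => [|k IH]; first by rewrite expr0 !expr1; lra.
rewrite [leRHS]exprS; apply: le_trans (ler_wpM2l x0 IH).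
rewrite -subr_ge0 (exprS _ k.+1) (exprS _ k) -(natr1 k.+1).
have -> : x * (m * m ^+ k + k.+1%:R * m ^+ k * (x - m)) -
  (m * (m * m ^+ k) + (k.+1%:R + 1) * (m * m ^+ k) * (x - m)) =
  k.+1%:R * m ^+ k * (x - m) ^+ 2 by ring.
by rewrite mulr_ge0 ?sqr_ge0// mulr_ge0// exprn_ge0.
Qed.

(** * The multiplier of f - V_(l,t) f *)

Section spherical_symbol.
Context {R : realType} (n : nat).
Implicit Types (v theta : R) (l j : nat).
Local Notation sigma := (@surface_measure R n.+1).
Local Notation area := (@sphere_area R n.+1).

(** The multiplier of f - V_(l,t) f at frequency s, with v = s t. *)
Definition spherical_symbol l v : R :=
  1 + 2 / 'C(2 * l, l)%:R *
    (\sum_(0 <= j < l) (-1) ^+ j.+1 * 'C(2 * l, l - j.+1)%:R * bP n (j.+1%:R ^+ 2 * v ^+ 2)).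

(* Jensen's inequality for the mean of [(2 - 2 cos)^l] over the sphere. *)
Lemma spherical_symbol_ge l v :
  (2 - 2 * bP n (v ^+ 2)) ^+ l / 'C(2 * l, l)%:R <= spherical_symbol l v.
Proof.
have A0 := @sphere_area_gt0 R n.
(* Any vector of length |v| serves, since [surface_cos] sees only its norm. *)
pose u : 'rV[R]_n.+1 := v *: delta_mx ord0 ord0.
have uE : nsq u = v ^+ 2.
  rewrite nsqZ -[RHS]mulr1; congr (_ * _); rewrite /nsq (bigD1 ord0)//= mxE !eqxx expr1n.
  by rewrite big1 ?addr0// => i /negbTE i0; rewrite mxE i0 andbF expr0n.
have mcos j : measurable_fun setT (fun w : 'rV[R]_n.+1 => cos (j%:R * dot u w)).
  apply: (measurableT_comp (f := @cos R)).
    by apply: continuous_measurable_fun; exact: continuous_cos.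
  by apply: measurable_funM => //; exact: measurable_dot.
have icos j : sigma.-integrable setT (EFin \o (fun w => cos (j%:R * dot u w))).
  by apply: (integrable_surface (C := 1)) => // w _; exact: cos_max.
have Icos j : \int[sigma]_w cos (j%:R * dot u w) = area * bP n (j%:R ^+ 2 * v ^+ 2).
  rewrite -uE -nsqZ -surface_cos; apply: eq_Rintegral => w _; by rewrite dotZl.
have i1 : sigma.-integrable setT (EFin \o (fun=> 1)).
  by apply: (integrable_surface (C := 1)) => // w _; rewrite normr1.
have I1 : \int[sigma]_w (1 : R) = area by rewrite Rintegral_cst// mul1r.
pose h w := (2 - 2 * cos (1%:R * dot u w)).
have h04 w : 0 <= h w <= 4.
  by have := cos_max (1%:R * dot u w); rewrite /h ler_norml; lra.
have mh : measurable_fun setT h by apply: measurable_funB => //; apply: measurable_funM.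
have ih k : sigma.-integrable setT (EFin \o (fun w => h w ^+ k)).
  apply: (integrable_surface (C := 4 ^+ k)); first exact: measurable_funX.
  move=> w _; have /andP[h0 h4] := h04 w.
  by rewrite ger0_norm ?exprn_ge0// lerXn2r ?nnegrE.
have Ih : \int[sigma]_w h w = area * (2 - 2 * bP n (v ^+ 2)).
  rewrite /h RintegralB//; last 2 first.
  - by have := integrable_mulC 2 measurableT i1; apply: eq_integrable => // w _ /=; rewrite mulr1.
  - exact: integrable_mulC.
  rewrite RintegralZl// Icos Rintegral_cst// -/(sphere_area _) expr1n mul1r; ring.
have C0 : 0 < 'C(2 * l, l)%:R :> R by rewrite ltr0n bin_gt0 mul2n -addnn leq_addr.
have symE : area * spherical_symbol l v = (\int[sigma]_w (h w ^+ l)) / 'C(2 * l, l)%:R.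
  pose g j w := (-1) ^+ j.+1 * 'C(2 * l, l - j.+1)%:R * cos (j.+1%:R * dot u w).
  have ig j : sigma.-integrable setT (EFin \o g j) by exact: integrable_mulC.
  have [j1 j2] := Rintegral_sum (index_iota 0 l) measurableT ig.
  have j3 : sigma.-integrable setT
      (EFin \o (fun w => 2 / 'C(2 * l, l)%:R * \sum_(0 <= j < l) g j w)).
    exact: integrable_mulC.
  rewrite [RHS]mulrC -RintegralZl//.
  transitivity (\int[sigma]_w (1 + 2 / 'C(2 * l, l)%:R * \sum_(0 <= j < l) g j w)).
    rewrite RintegralD// I1 RintegralZl// j2 /spherical_symbol mulrDr mulr1; congr (_ + _).
    rewrite mulrCA mulr_sumr; congr (_ * _); apply: eq_bigr => j _.
    by rewrite /g RintegralZl// Icos mulrCA.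
  by apply: eq_Rintegral => w _; rewrite cos_sum_expn /h mul1r mulrC.
have m0 : 0 <= 2 - 2 * bP n (v ^+ 2).
  by have := @bP_le1 R n _ (sqr_ge0 v); rewrite ler_norml; lra.
rewrite -(ler_pM2l A0) symE mulrA ler_pM2r ?invr_gt0//.
case: l {C0 symE} => [|k].
  by rewrite expr0 mulr1; under eq_Rintegral do rewrite expr0; rewrite I1.
set m := 2 - _ in m0 Ih *; clearbody m.
have i2 : sigma.-integrable setT (EFin \o (fun w => m ^+ k.+1 + k.+1%:R * m ^+ k * (h w - m))).
  apply: (integrable_surface (C := m ^+ k.+1 + k.+1%:R * m ^+ k * (4 + m))).
    by apply: measurable_funD => //; apply: measurable_funM => //; apply: measurable_funB.
  move=> w _; have /andP[h0 h4] := h04 w.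
  have mk : 0 <= k.+1%:R * m ^+ k by rewrite mulr_ge0// exprn_ge0.
  rewrite (le_trans (ler_normD _ _))// (ger0_norm (exprn_ge0 _ m0)) lerD2l.
  rewrite normrM (ger0_norm mk) ler_wpM2l//; rewrite ler_norml; lra.
(* As m is the mean of h over the sphere, the linear term of the tangent integrates to 0. *)
apply: le_trans (_ : _ <= \int[sigma]_w (m ^+ k.+1 + k.+1%:R * m ^+ k * (h w - m))) _; last first.
  apply: le_Rintegral => //.
  by move=> w _; apply: expn_tangent_le => //; have /andP[] := h04 w.
have ih1 : sigma.-integrable setT (EFin \o h) by apply: eq_integrable (ih 1%N) => // w _ /=; rewrite expr1.
have ic z : sigma.-integrable setT (EFin \o cst z).
  by have := integrable_mulC z measurableT i1; apply: eq_integrable => // w _ /=; rewrite mulr1.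
have Ic z : \int[sigma]_w (cst z w) = z * area by rewrite Rintegral_cst.
rewrite le_eqVlt; apply/orP; left; apply/eqP.
rewrite RintegralD//; last 2 first.
- exact: ic.
- apply: integrable_mulC => //; have := integrableB measurableT ih1 (ic m).
  by apply: eq_integrable.
rewrite RintegralZl//; last first.
  by have := integrableB measurableT ih1 (ic m); apply: eq_integrable.
rewrite RintegralB//; last exact: ic.
by rewrite Ih (Ic m) (Ic (m ^+ k.+1)) exprS; ring.
Qed.

Lemma spherical_symbol_ge0 l v : 0 <= spherical_symbol l v.
Proof.
apply: le_trans (spherical_symbol_ge l v); rewrite divr_ge0// exprn_ge0//.
by have := @bP_le1 R n _ (sqr_ge0 v); rewrite ler_norml; lra.
Qed.

End spherical_symbol.

(** No integrability is assumed: for k > 0 a divergent integral stays divergent, and both sides then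
    take the default value 0. This is needed for spheres on which f may fail to be integrable. *)
Lemma Rintegral_posZ {d} {T : measurableType d} {R : realType}
    (mu : {measure set T -> \bar R}) (k : R) (f : T -> R) : 0 < k -> measurable_fun setT f ->
  \int[mu]_x (k * f x) = k * \int[mu]_x f x.
Proof.
move=> k0 mf; have k00 := ltW k0.
have mEf : measurable_fun setT (EFin \o f) by exact/measurable_EFinP.
rewrite /Rintegral integralE [in RHS]integralE.
have -> : (\int[mu]_x (fun x => (k * f x)%:E)^\+ x = k%:E * \int[mu]_x (EFin \o f)^\+ x)%E.
  rewrite -ge0_integralZl//; last exact: measurable_funepos.
  by apply: eq_integral => x _; rewrite !funeposE /= -!EFin_max -EFinM maxr_pMr// mulr0.
have -> : (\int[mu]_x (fun x => (k * f x)%:E)^\- x = k%:E * \int[mu]_x (EFin \o f)^\- x)%E.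
  rewrite -ge0_integralZl//; last exact: measurable_funeneg.
  by apply: eq_integral => x _; rewrite !funenegE /= -!EFin_max -EFinM maxr_pMr// mulr0 mulrN.
have : (0 <= \int[mu]_x (EFin \o f)^\+ x)%E by exact: integral_ge0.
have : (0 <= \int[mu]_x (EFin \o f)^\- x)%E by exact: integral_ge0.
move: (\int[mu]_x _)%E (\int[mu]_x _)%E => [y| |] [x| |] //= _ _.
- by rewrite mulrBr.
- by rewrite gt0_muley ?lte_fin//= mulr0.
- by rewrite gt0_muley ?lte_fin//= mulr0.
- by rewrite gt0_muley ?lte_fin//= mulr0.
Qed.

(** * Spherical means of f tested against Gaussians *)

Section spherical_means.
Context {R : realType} (n : nat).
Implicit Types (x y w : 'rV[R]_n.+1) (f : 'rV[R]_n.+1 -> R).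
Local Notation leb := (@lebesgue_measure R).
Local Notation lebn := (@lebesgue_rV R n.+1).
Local Notation sigma := (@surface_measure R n.+1).
Local Notation area := (@sphere_area R n.+1).

(** f is known only through its L^p norm, so the integral in x is taken first: a translation turns
    it into a Gaussian mean about -- equivalently, centred at -- r w, bounded by Hoelder's
    inequality uniformly in w, and the sphere has finite measure. *)
Lemma integrable_sphere_gaussian a p q f r : 0 < a -> 0 < p -> 0 < q -> p^-1 + q^-1 = 1 ->
  measurable_fun setT f -> ('N[lebn]_p%:E[EFin \o f] < +oo)%E ->
  (lebn \x sigma)%E.-integrable setT
    (EFin \o (fun z : 'rV[R]_n.+1 * 'rV[R]_n.+1 => f (z.1 + r *: z.2) * gaussian a 0 z.1)).
Proof.
move=> a0 p0 q0 pq mf fy.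
have mk : measurable_fun setT
    (fun z : 'rV[R]_n.+1 * 'rV[R]_n.+1 => f (z.1 + r *: z.2) * gaussian a 0 z.1).
  apply: measurable_funM; last exact: (measurableT_comp (measurable_gaussian a 0) measurable_fst).
  apply: (measurableT_comp mf); apply: measurable_fun_coordP => i.
  apply: (eq_measurable_fun (fun z : 'rV[R]_n.+1 * 'rV[R]_n.+1 => z.1 ord0 i + r * z.2 ord0 i)).
    by move=> z _; rewrite !mxE.
  apply: measurable_funD; first exact: (measurableT_comp (measurable_coord i) measurable_fst).
  apply: measurable_funM => //; exact: (measurableT_comp (measurable_coord i) measurable_snd).
apply/integrable21ltyP; first exact/measurable_EFinP.
pose M := fine 'N[lebn]_p%:E[EFin \o f]%E * gmass n (q * a) `^ q^-1.
apply: (@le_lt_trans _ _ (\int[sigma]_w (cst M%:E w))%E); last first.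
  rewrite integral_cst//.
  apply: lte_mul_pinfty; rewrite ?surface_lty//.
  by rewrite lee_fin mulr_ge0 ?powR_ge0// fine_ge0// Lnorm_ge0.
have le w : (\int[lebn]_x `|(f (x + r *: w) * gaussian a 0 x)%:E| <= M%:E)%E.
  have [i1 i2] := gaussian_mean_le (r *: w) a0 p0 q0 pq mf fy.
  apply: le_trans (_ : (_ <= (\int[lebn]_x `|f x * gaussian a (r *: w) x|)%:E)%E) _; last first.
    by rewrite lee_fin.
  have i3 : lebn.-integrable setT (EFin \o (fun x => `|f x * gaussian a (r *: w) x|)).
    exact: integrable_norm.
  rewrite -(EFin_Rintegral measurableT i3).
  rewrite [in leRHS](@ge0_integral_affine R n.+1 1 (r *: w) _ ltr01)//; last first.
    by apply/measurable_EFinP; apply: measurableT_comp => //; exact: integrable_measurable i1.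
  rewrite expr1n mul1e le_eqVlt; apply/orP; left; apply/eqP; apply: eq_integral => x _.
  by rewrite scale1r /= /gaussian addrK subr0.
apply: ge0_le_integral => //.
- by move=> w _; exact: integral_ge0.
- apply: (measurable_fun_fubini_tonelli_G
    (fun z : 'rV[R]_n.+1 * 'rV[R]_n.+1 => `|(f (z.1 + r *: z.2) * gaussian a 0 z.1)%:E|)%E) => //.
  by apply: measurableT_comp => //; exact/measurable_EFinP.
- by move=> w _; exact: le.
Qed.

Lemma sphere_meanE f r x : 0 < r ->
  sphere_mean r f x = area^-1 * \int[sigma]_w f (x + r *: w).
Proof.
move=> r0; have rn : r ^+ n != 0 by rewrite expf_neq0 ?gt_eqF.
rewrite /sphere_mean /sphere_integral /= Rintegral_cst// mul1r -/(sphere_area n.+1).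
have := @sphere_area_gt0 R n; move: (sphere_area _) (Rintegral _ _ _) => A I A0.
by field; rewrite rn gt_eqF.
Qed.

Section transform.
Context (c C : R) (F : R -> R) (f : 'rV[R]_n.+1 -> R) (a p q : R).
Hypotheses (hf : GMhat c C F f) (c1 : 1 < c).
Hypotheses (a0 : 0 < a) (p0 : 0 < p) (q0 : 0 < q) (pq : p^-1 + q^-1 = 1).
Hypotheses (mf : measurable_fun setT f) (fy : ('N[lebn]_p%:E[EFin \o f] < +oo)%E).

(** After Fubini one averages over w the Gaussian means of f centred at r w. By [gaussian_transform]
    these depend only on |r w|, which is r for almost every w. *)
Lemma sphere_mean_transform r : 0 < r ->
  lebn.-integrable setT (EFin \o (fun x => sphere_mean r f x * gaussian a 0 x)) /\
  \int[lebn]_x (sphere_mean r f x * gaussian a 0 x) =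
  fourier_const n * freq_integral F n a (r ^+ 2).
Proof.
move=> r0; have ik := integrable_sphere_gaussian r a0 p0 q0 pq mf fy.
have A0 := lt0r_neq0 (@sphere_area_gt0 R n).
have [i1 E] := Rintegral_fubini ik.
have maff x : measurable_fun setT (fun w => f (x + r *: w)).
  apply: (measurableT_comp mf); apply: (eq_measurable_fun (fun w => r *: w + x)).
    by move=> w _; rewrite addrC.
  exact: measurable_affine_rV.
have kE x : \int[sigma]_w (f (x + r *: w) * gaussian a 0 x) =
    area * (sphere_mean r f x * gaussian a 0 x).
  under eq_Rintegral do rewrite mulrC.
  by rewrite Rintegral_posZ ?expR_gt0// sphere_meanE// mulrA mulVKf// mulrC.
have inner w : \int[lebn]_x (f (x + r *: w) * gaussian a 0 x) =
    fourier_const n * freq_integral F n a (r ^+ 2 * nsq w).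
  have ig y : lebn.-integrable setT (EFin \o (fun x => f x * gaussian a y x)).
    by have [] := gaussian_mean_le y a0 p0 q0 pq mf fy.
  rewrite (gaussian_mean_shift _ 0 ig).2 add0r /gaussian_mean.
  by rewrite (gaussian_transform hf c1 a0 (ig _)) nsqZ.
split.
  have := integrable_mulC area^-1 measurableT i1.
  by apply: eq_integrable => // x _ /=; rewrite kE mulKf.
apply: (mulfI A0); rewrite -RintegralZl//; last first.
  have := integrable_mulC area^-1 measurableT i1.
  by apply: eq_integrable => // x _ /=; rewrite kE mulKf.
under eq_Rintegral do rewrite -kE.
rewrite E /=.
have mi : measurable_fun setT (fun w => \int[lebn]_x (f (x + r *: w) * gaussian a 0 x)).
  by apply: measurableT_comp => //; exact: (measurable_fubini_G ik).
rewrite (eq_Rintegral_surface (h2 := cst (fourier_const n * freq_integral F n a (r ^+ 2)))) => [||//|w w1].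
- by rewrite Rintegral_cst// mulrC.
- exact: mi.
- by rewrite inner w1 mulr1.
Qed.

Lemma sphere_mean_comb_transform l t : 0 < t ->
  [/\ measurable_fun setT (f \- sphere_mean_comb l t f),
   lebn.-integrable setT
     (EFin \o (fun x => (f x - sphere_mean_comb l t f x) * gaussian a 0 x)),
   leb.-integrable `]0, +oo[
     (EFin \o (fun s => F s * (freq_weight n a s * spherical_symbol n l (s * t)))) &
   \int[lebn]_x ((f x - sphere_mean_comb l t f x) * gaussian a 0 x) = fourier_const n *
   \int[leb]_(s in `]0, +oo[) (F s * (freq_weight n a s * spherical_symbol n l (s * t)))].
Proof.
move=> t0; pose b j : R := (-1) ^+ j.+1 * 'C(2 * l, l - j.+1)%:R.
have jt j : 0 < j.+1%:R * t by rewrite mulr_gt0.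
have m0y : measurable (`]0, +oo[%classic : set (measurableTypeR R)) by exact: measurable_itv.
have H j := sphere_mean_transform (jt j).
have [if0 _] := gaussian_mean_le 0 a0 p0 q0 pq mf fy.
pose g j x := b j * (sphere_mean (j.+1%:R * t) f x * gaussian a 0 x).
have ig j : lebn.-integrable setT (EFin \o g j) by apply: integrable_mulC => //; exact: (H j).1.
have [i1 i2] := Rintegral_sum (index_iota 0 l) measurableT ig.
have i3 := integrable_mulC (2 / 'C(2 * l, l)%:R) measurableT i1.
have E x : (f x - sphere_mean_comb l t f x) * gaussian a 0 x =
    f x * gaussian a 0 x + 2 / 'C(2 * l, l)%:R * \sum_(0 <= j < l) g j x.
  (* The factor -2 in V_(l,t) becomes +2 in f - V_(l,t) f, and the summation index is shifted to
     start at 0. *)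
  have VE : sphere_mean_comb l t f x =
      - (2 / 'C(2 * l, l)%:R) * \sum_(0 <= j < l) b j * sphere_mean (j.+1%:R * t) f x.
    by rewrite /sphere_mean_comb big_add1/= !mulNr.
  rewrite mulrBl VE mulNr mulNr opprK; congr (_ + _).
  rewrite -[LHS]mulrA mulr_suml; congr (_ * _).
  by apply: eq_bigr => j _; rewrite -mulrA.
have iu : lebn.-integrable setT
     (EFin \o (fun x => (f x - sphere_mean_comb l t f x) * gaussian a 0 x)).
  by have := integrableD measurableT if0 i3; apply: eq_integrable => // x _ /=; rewrite E EFinD.
pose k j s := b j * (F s * (freq_weight n a s * bP n (s ^+ 2 * (j.+1%:R * t) ^+ 2))).
have ifr r : 0 <= r -> leb.-integrable `]0, +oo[
    (EFin \o (fun s => F s * (freq_weight n a s * bP n (s ^+ 2 * r)))).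
  by move=> r0; apply: (integrable_freq (GMhat_bv hf) (GMhat_near0 hf) (GMhat_tail hf c1)).
have ik j : leb.-integrable `]0, +oo[ (EFin \o k j).
  by apply: integrable_mulC => //; apply: ifr; exact: sqr_ge0.
have [k1 k2] := Rintegral_sum (index_iota 0 l) m0y ik.
have k3 := integrable_mulC (2 / 'C(2 * l, l)%:R) m0y k1.
have S s : F s * (freq_weight n a s * bP n (s ^+ 2 * 0)) +
    2 / 'C(2 * l, l)%:R * \sum_(0 <= j < l) k j s =
    F s * (freq_weight n a s * spherical_symbol n l (s * t)).
  rewrite mulr0 bP0 /spherical_symbol /k !mulr_sumr mulrDr mulrDr !mulr1; congr (_ + _).
  rewrite [in RHS]mulr_sumr mulr_sumr; apply: eq_bigr => j _.
  have -> : s ^+ 2 * (j.+1%:R * t) ^+ 2 = j.+1%:R ^+ 2 * (s * t) ^+ 2 by ring.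
  by rewrite /b; ring.
split=> //.
  apply: (eq_measurable_fun (fun x =>
      ((f x - sphere_mean_comb l t f x) * gaussian a 0 x) * expR (a * nsq (x - 0)))).
    by move=> x _; rewrite -mulrA /gaussian -expRD addNr expR0 mulr1.
  apply: measurable_funM; first exact: integrable_measurable iu.
  apply: measurableT_comp => //; apply: measurable_funM => //.
  apply: (eq_measurable_fun (@nsq R n.+1)); last exact: measurable_nsq.
  by move=> x _; rewrite subr0.
  have := integrableD m0y (ifr 0 (lexx 0)) k3.
  by apply: eq_integrable => // s _ /=; rewrite -EFinD S.
under eq_Rintegral do rewrite E.
rewrite RintegralD// RintegralZl// i2 (gaussian_transform hf c1 a0 if0).
have -> : nsq (0 : 'rV[R]_n.+1) = 0 by rewrite /nsq big1// => i _; rewrite mxE expr0n.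
transitivity (fourier_const n * (freq_integral F n a 0 + 2 / 'C(2 * l, l)%:R *
    \sum_(0 <= j < l) \int[leb]_(s in `]0, +oo[) k j s)).
  rewrite mulrDr [in RHS]mulrCA; congr (_ + _ * _); rewrite [RHS]mulr_sumr; apply: eq_bigr => j _.
  rewrite /g RintegralZl//; last exact: (H j).1.
  rewrite (H j).2 /k RintegralZl//; last by apply: ifr; exact: sqr_ge0.
  by rewrite mulrCA.
congr (_ * _).
transitivity (\int[leb]_(s in `]0, +oo[) (F s * (freq_weight n a s * bP n (s ^+ 2 * 0)) +
    2 / 'C(2 * l, l)%:R * \sum_(0 <= j < l) k j s)).
  by rewrite RintegralD//; [rewrite RintegralZl// k2|exact: ifr].
by apply: eq_Rintegral => s _; exact: S.
Qed.

End transform.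

End spherical_means.

(** * Dyadic blocks of the frequency axis *)

Section dyadic_blocks.
Context {R : realType}.
Local Notation leb := (@lebesgue_measure R).
Implicit Types (h F m : R -> R) (T B beta delta : R).

Lemma le_Rintegral_subset (D E : set (measurableTypeR R)) h : measurable D -> measurable E ->
  D `<=` E -> leb.-integrable E (EFin \o h) -> (forall x, E x -> 0 <= h x) ->
  \int[leb]_(x in D) h x <= \int[leb]_(x in E) h x.
Proof.
move=> mD mE DE ih h0; rewrite Rintegral_indic [leRHS]Rintegral_indic.
apply: le_Rintegral => //.
- by apply: (integrable_indic_mul _ _ mD).1; apply: integrableS ih.
- exact: (integrable_indic_mul _ _ mE).1.
move=> x _; rewrite !indicE; case: (boolP (x \in D)) => xD.
  by rewrite mem_set ?mul1r//; apply: DE; exact: set_mem.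
by rewrite mul0r; case: (boolP (x \in E)) => xE; rewrite ?mul0r// mul1r h0//; exact: set_mem.
Qed.

(** The blocks ]2^k T0, 2^(k+1) T0] contribute a geometric series of ratio 2^(-beta) < 1; the
    partial integrals tend to the whole one by dominated convergence. *)
Lemma dyadic_integral_le h T0 B beta : 0 < T0 -> 0 < beta -> 0 <= B ->
  leb.-integrable `]T0, +oo[ (EFin \o h) ->
  (forall T, T0 <= T -> \int[leb]_(s in `]T, 2 * T]) h s <= B * T `^ (- beta)) ->
  \int[leb]_(s in `]T0, +oo[) h s <= B * T0 `^ (- beta) / (1 - 2 `^ (- beta)).
Proof.
move=> T00 b0 B0 ih hB; pose rho : R := 2 `^ (- beta).
have rho0 : 0 < rho by rewrite powR_gt0.
have rho1 : rho < 1.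
  by rewrite /rho /powR gt_eqF// expR_lt1 mulNr oppr_lt0 mulr_gt0// ln_gt0// ltr1n.
have mT0 : measurable (`]T0, +oo[%classic : set (measurableTypeR R)) by exact: measurable_itv.
pose X : R := B * T0 `^ (- beta); have X0 : 0 <= X by rewrite mulr_ge0// powR_ge0.
have ihS (a b : R) : T0 <= a -> leb.-integrable `]a, b] (EFin \o h).
  move=> Ta; apply: (integrableS mT0 _ _ ih); first exact: measurable_itv.
  by move=> x /=; rewrite !in_itv/= andbT => /andP[/(le_lt_trans Ta)].
have two N : T0 <= 2 ^+ N * T0 by rewrite ler_peMl ?(ltW T00)// exprn_ege1// ler1n.
have part N : \int[leb]_(s in `]T0, 2 ^+ N * T0]) h s <= X * ((1 - rho ^+ N) / (1 - rho)).
  elim: N => [|N IH].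
    by rewrite !expr0 mul1r subrr mul0r mulr0 set_itvoc0 Rintegral_set0.
  have N2 : 2 ^+ N * T0 <= 2 ^+ N.+1 * T0.
    by rewrite exprS -mulrA ler_peMl ?ler1n// (le_trans (ltW T00)).
  have -> : (`]T0, 2 ^+ N.+1 * T0]%classic : set (measurableTypeR R)) =
      `]T0, 2 ^+ N * T0] `|` `]2 ^+ N * T0, 2 ^+ N.+1 * T0].
    apply/seteqP; split => [x|x] /=; rewrite !in_itv/=.
      by move=> /andP[x0 xN]; case: (leP x (2 ^+ N * T0)) => x1; [left; rewrite x0|right].
    move=> [/andP[x0 x1]|/andP[x1 xN]]; first by rewrite x0 (le_trans x1).
    by rewrite (le_lt_trans _ x1).
  have dis : [disjoint (`]T0, 2 ^+ N * T0]%classic : set (measurableTypeR R)) &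
      `]2 ^+ N * T0, 2 ^+ N.+1 * T0]%classic].
    apply/disj_set2P; rewrite -subset0 => x [] /=; rewrite !in_itv/= => /andP[_ x1] /andP[].
    by rewrite ltNge x1.
  rewrite Rintegral_setU//; last first.
    by apply: integrable_setU_disj => //; exact: ihS.
  have -> : X * ((1 - rho ^+ N.+1) / (1 - rho)) = X * ((1 - rho ^+ N) / (1 - rho)) + X * rho ^+ N.
    by rewrite exprS; move: (rho ^+ N) => r; field; rewrite subr_eq0 gt_eqF.
  apply: lerD => //.
  have -> : X * rho ^+ N = B * (2 ^+ N * T0) `^ (- beta).
    rewrite powRM ?exprn_ge0 ?(ltW T00)// -(powR_mulrn N (ler0n R 2)) powRAC.
    by rewrite -/rho powR_mulrn ?(ltW rho0)// [in RHS]mulrCA mulrC.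
  have := hB _ (two N); by rewrite exprS mulrA.
have lim : (fun N : nat => \int[leb]_(s in `]T0, +oo[) (\1_(`]T0, 2 ^+ N * T0]) s * h s)) @ \oo
    --> \int[leb]_(s in `]T0, +oo[) h s.
  have ih' : leb.-integrable `]T0, +oo[ (EFin \o (fun s => `|h s|)) by exact: integrable_norm.
  apply: (dominated_Rintegral_cvg mT0 _ _ ih' _).2 => [N|s|N s] /=.
  - apply: measurable_funM; last exact: integrable_measurable ih.
    by apply: measurable_funTS; exact: measurable_indic.
  - rewrite in_itv/= andbT => Ts.
    apply: cvg_trans (cvg_cst (F := \oo) (h s)); apply: near_eq_cvg.
    exists (Num.truncn (s / T0)).+1 => // N /= hN.
    rewrite indicE mem_set ?mul1r//= in_itv/= Ts/= -ler_pdivrMr//.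
    rewrite (le_trans (ltW (truncnS_gt _)))// -natrX ler_nat (leq_trans hN)//.
    by rewrite ltnW// ltn_expl.
  - by move=> _; rewrite indicE normrM ler_piMl//; case: (_ \in _); rewrite ?normr1 ?normr0.
apply: (cvgr_to_le lim); apply: nearW => N.
have -> : \int[leb]_(s in `]T0, +oo[) (\1_(`]T0, 2 ^+ N * T0]) s * h s) =
    \int[leb]_(s in `]T0, 2 ^+ N * T0]) h s.
  rewrite [RHS]Rintegral_indic [LHS]Rintegral_indic; apply: eq_Rintegral => s _.
  rewrite !indicE mulrA; case: (boolP (s \in (`]T0, 2 ^+ N * T0]%classic : set _))) => [|_].
    by rewrite inE/= in_itv/= => /andP[s0 _]; rewrite mem_set ?mul1r//= in_itv/= s0.
  by rewrite mulr0.
apply: le_trans (part N) _; rewrite -/X -/rho; apply: ler_wpM2l => //.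
by rewrite ler_piMl ?invr_ge0 ?subr_ge0 ?(ltW rho1)// gerBl exprn_ge0// ltW.
Qed.

(** For s in [T, 2T] and parameter T^2 the exponent s^2/4T^2 is at most 1, and (s/T)^(n+1) is at
    least 1. *)
Lemma freq_weight_ge n T s : 0 < T -> T <= s <= 2 * T ->
  Num.sqrt pi ^+ n.+1 * expR (- 1) / s <= freq_weight n (T ^+ 2) s.
Proof.
move=> T0 /andP[Ts sT]; have s0 := lt_le_trans T0 Ts.
rewrite ler_pdivrMr// /freq_weight /gmass sqrtr_sqr (gtr0_norm T0).
rewrite -!mulrA ler_wpM2l ?exprn_ge0 ?sqrtr_ge0// mulrCA -exprSr -[leLHS]mulr1.
apply: ler_pM; rewrite ?expR_ge0//.
  rewrite ler_expR lerN2 mulrA -expr2 ler_pdivrMr ?mulr_gt0 ?exprn_gt0// mul1r.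
  have -> : 4 * T ^+ 2 = (2 * T) ^+ 2 by ring.
  by rewrite lerXn2r ?nnegrE ?(ltW s0)// mulr_ge0// ltW.
by rewrite ler_pdivlMl ?exprn_gt0// mulr1 lerXn2r ?nnegrE// ltW.
Qed.

(** Everything under the frequency integral is nonnegative, so it may be restricted to ]T, 2T],
    where the weight is at least a constant over s and the multiplier at least [delta]. *)
Lemma dyadic_block_le n F m T B delta : 0 < T -> 0 < delta ->
  (forall s, 0 < s -> 0 <= F s) -> (forall s, 0 < s -> 0 <= m s) ->
  (forall s, T <= s <= 2 * T -> delta <= m s) ->
  leb.-integrable `]0, +oo[ (EFin \o (fun s => F s * (freq_weight n (T ^+ 2) s * m s))) ->
  leb.-integrable `]T, 2 * T] (EFin \o (fun s => F s / s)) ->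
  fourier_const n * \int[leb]_(s in `]0, +oo[) (F s * (freq_weight n (T ^+ 2) s * m s)) <= B ->
  \int[leb]_(s in `]T, 2 * T]) (F s / s) <=
    (fourier_const n * (Num.sqrt pi ^+ n.+1 * expR (- 1) * delta))^-1 * B.
Proof.
move=> T0 d0 Fp mp md iW iF WB; have k0 := @fourier_const_gt0 R n.
have m0y : measurable (`]0, +oo[%classic : set (measurableTypeR R)) by exact: measurable_itv.
have mT : measurable (`]T, 2 * T]%classic : set (measurableTypeR R)) by exact: measurable_itv.
have T2 : 0 < T ^+ 2 by rewrite exprn_gt0.
set q := Num.sqrt pi ^+ n.+1 * expR (- 1) * delta.
have q0 : 0 < q by rewrite !mulr_gt0 ?expR_gt0 ?exprn_gt0 ?sqrtr_gt0 ?pi_gt0.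
have sub : (`]T, 2 * T]%classic : set (measurableTypeR R)) `<=` `]0, +oo[%classic.
  by move=> s /=; rewrite !in_itv/= andbT => /andP[/(lt_trans T0)].
rewrite ler_pdivlMl ?(mulr_gt0 k0 q0)// -(mulrA (fourier_const n)).
rewrite (le_trans _ WB)// ler_wpM2l ?(ltW k0)//.
rewrite -RintegralZl//.
apply: (@le_trans _ _ (\int[leb]_(s in `]T, 2 * T]) (F s * (freq_weight n (T ^+ 2) s * m s)))).
  apply: le_Rintegral => //.
  - exact: integrable_mulC.
  - exact: integrableS iW.
  move=> s /= /[dup] /sub /=; rewrite !in_itv/= andbT => s0 /andP[Ts sT].
  have TsT : T <= s <= 2 * T by rewrite (ltW Ts).
  rewrite mulrCA ler_wpM2l ?Fp// /q mulrAC ler_pM ?(ltW d0) ?md ?freq_weight_ge//.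
  by rewrite divr_ge0 ?(ltW s0)// mulr_ge0 ?expR_ge0// exprn_ge0// sqrtr_ge0.
apply: le_Rintegral_subset => // s /=; rewrite in_itv/= andbT => s0.
by rewrite mulr_ge0 ?Fp// mulr_ge0 ?mp// freq_weight_ge0// ltW.
Qed.

(** Origin of the power T^(-d/p'): the left-hand side is the L^q norm of a Gaussian of parameter
    T^2. *)
Lemma gmass_powR n q T : 0 < q -> 0 < T ->
  gmass n (q * T ^+ 2) `^ q^-1 = gmass n q `^ q^-1 * T `^ (- (n.+1%:R / q)).
Proof.
move=> q0 T0; rewrite /gmass sqrtrM ?(ltW q0)// sqrtr_sqr (gtr0_norm T0) exprMn invfM mulrA.
rewrite powRM; last 2 first.
- by rewrite divr_ge0 ?exprn_ge0 ?sqrtr_ge0.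
- by rewrite invr_ge0 exprn_ge0 ?ltW.
by rewrite -(powR_invn n.+1 (ltW T0)) -(powRrM T) mulNr.
Qed.

Lemma le_tail_variation F t : 0 < t -> F s @[s --> +oo] --> 0 -> 0 <= F t ->
  ((F t)%:E <= tail_variation F t)%E.
Proof.
move=> t0 F0 Ft.
have V b : t <= b -> ((F t - F b)%:E <= tail_variation F t)%E.
  move=> tb; apply: (@le_trans _ _ (total_variation t b F)).
    by apply: le_trans (total_variation_ge F tb); rewrite lee_fin distrC ler_norm.
  by apply: ereal_sup_ubound; exists b => //=; rewrite in_itv/= tb.
have := V t (lexx t); rewrite subrr.
move: (tail_variation F t) V => [v V _|_ _|//]; last by rewrite leey.
rewrite lee_fin; have h : (fun b => F t - F b) b @[b --> +oo] --> F t - 0.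
  by apply: cvgB => //; exact: cvg_cst.
rewrite -(subr0 (F t)); apply: (cvgr_to_le h); near=> b.
rewrite -lee_fin; apply: V; near: b; apply: nbhs_pinfty_ge; exact: num_real.
Unshelve. all: by end_near. Qed.

End dyadic_blocks.

Lemma measurable_difference {R : realType} d (h : 'rV[R]_d) (u : 'rV[R]_d -> R) l :
  measurable_fun setT u -> measurable_fun setT (iter l (difference h) u).
Proof.
move=> mu; elim: l => // l IH; rewrite iterS; apply: measurable_funB => //.
apply: (measurableT_comp IH); apply: (eq_measurable_fun (fun x : 'rV[R]_d => 1 *: x + h)).
  by move=> x _; rewrite scale1r.
exact: measurable_affine_rV.
Qed.

Lemma Lfun_norm_lty {R : realType} d (p : R) (f : 'rV[R]_d -> R) :
  f \in Lfun (lebesgue_rV d) p%:E ->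
  measurable_fun setT f /\ ('N[lebesgue_rV d]_p%:E[EFin \o f] < +oo)%E.
Proof. by rewrite inE => /andP[/set_mem mf /set_mem fy]. Qed.

(** * The bound for one dyadic block *)

Section block_bound.
Context {R : realType} (n l : nat) (p q c : R).
Local Notation leb := (@lebesgue_measure R).
Hypotheses (p0 : 0 < p) (q0 : 0 < q) (pq : p^-1 + q^-1 = 1) (c1 : 1 < c).

(** The Gaussian mean of the differenced function is bounded above by Hoelder's inequality and below
    by the integral over one block. [K] is chosen before F, f, t, T and B, so that the bounds for
    different blocks can be summed. *)
Lemma block_bound : exists2 K, 0 < K &
  forall C (F : R -> R) (f : 'rV[R]_n.+1 -> R) t T B,
  GMhat c C F f -> f \in Lfun (lebesgue_rV n.+1) p%:E -> (forall s, 0 < s -> 0 <= F s) ->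
  0 < t -> t / c <= T -> (Omega l f t^-1 p <= B%:E)%E ->
  \int[leb]_(s in `]T, 2 * T]) (F s / s) <= K * B * T `^ (- (n.+1%:R / q)).
Proof.
have c0 := lt_trans ltr01 c1.
pose G := gmass n q `^ q^-1; have G0 : 0 < G by rewrite powR_gt0 ?gmass_gt0.
(* Both cases of the dimension are reduced to a nonnegative multiplier [m] that is at least [delta]
   on [T, 2T] and whose frequency integral is controlled by Hoelder's inequality. *)
suff [delta [D [d0 D0 H]]] : exists delta D : R, [/\ 0 < delta, 0 < D &
    forall C (F : R -> R) (f : 'rV[R]_n.+1 -> R) t T B,
    GMhat c C F f -> f \in Lfun (lebesgue_rV n.+1) p%:E ->
    0 < t -> t / c <= T -> (Omega l f t^-1 p <= B%:E)%E ->
    exists m : R -> R, [/\ forall s, 0 < s -> 0 <= m s,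
      forall s, T <= s <= 2 * T -> delta <= m s,
      leb.-integrable `]0, +oo[ (EFin \o (fun s => F s * (freq_weight n (T ^+ 2) s * m s))) &
      fourier_const n * \int[leb]_(s in `]0, +oo[) (F s * (freq_weight n (T ^+ 2) s * m s)) <=
      D * (B * gmass n (q * T ^+ 2) `^ q^-1)]].
  pose X := fourier_const n * (Num.sqrt pi ^+ n.+1 * expR (- 1) * delta) : R.
  have X0 : 0 < X.
    by rewrite mulr_gt0 ?fourier_const_gt0// !mulr_gt0 ?expR_gt0 ?exprn_gt0 ?sqrtr_gt0 ?pi_gt0.
  exists (X^-1 * D * G); first by rewrite !mulr_gt0// invr_gt0.
  move=> C F f t T B hf fL Fp t0 tT OB.
  have T0 : 0 < T by rewrite (lt_le_trans _ tT)// divr_gt0.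
  have [m [mp md im mB]] := H C F f t T B hf fL t0 tT OB.
  have iF : leb.-integrable `]T, 2 * T] (EFin \o (fun s => F s / s)).
    apply: (integrableS _ _ _ (integrable_F_tail (GMhat_bv hf) (GMhat_tail hf c1) T0)).
    - exact: measurable_itv.
    - exact: measurable_itv.
    - by move=> x /=; rewrite !in_itv/= andbT => /andP[].
  apply: le_trans (dyadic_block_le T0 d0 Fp mp md im iF mB) _.
  by rewrite -/X gmass_powR// -/G; rewrite le_eqVlt; apply/orP; left; apply/eqP; ring.
have [n0|n0] := posnP n; last first.
  (* For s >= T >= t/c the argument s/t of the multiplier is at least 1/c. *)
  have [delta d0 hd] := @bj_le1B R n c^-1 n0 (ltac:(by rewrite invr_gt0)).
  have C0 : 0 < 'C(2 * l, l)%:R :> R by rewrite ltr0n bin_gt0 mul2n -addnn leq_addr.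
  exists ((2 * delta) ^+ l / 'C(2 * l, l)%:R), 1; split=> //.
    by rewrite divr_gt0// exprn_gt0// mulr_gt0.
  move=> C F f t T B hf /Lfun_norm_lty[mf fy] t0 tT; rewrite /Omega gtn_eqF ?ltnS// => OB.
  have T0 : 0 < T by rewrite (lt_le_trans _ tT)// divr_gt0.
  have ti0 : 0 < t^-1 by rewrite invr_gt0.
  have T2 : 0 < T ^+ 2 by rewrite exprn_gt0.
  have [mu iu im uE] := sphere_mean_comb_transform hf c1 T2 p0 q0 pq mf fy l ti0.
  exists (fun s => spherical_symbol n l (s * t^-1)); split=> //.
  - by move=> s _; exact: spherical_symbol_ge0.
  - move=> s /andP[Ts _]; apply: le_trans (spherical_symbol_ge n l _).
    have st : c^-1 <= s * t^-1.
      by rewrite ler_pdivlMr// mulrC (le_trans tT).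
    rewrite ler_pM2r ?invr_gt0// lerXn2r ?nnegrE ?mulr_ge0 ?(ltW d0)//.
      by have := @bP_le1 R n _ (sqr_ge0 (s * t^-1)); rewrite ler_norml; lra.
    by have := hd _ st; rewrite /bj; lra.
  have uy : ('N[lebesgue_rV n.+1]_p%:E[EFin \o (f \- sphere_mean_comb l t^-1 f)%R] < +oo)%E.
    by apply: le_lt_trans OB _; rewrite ltry.
  have [iu' uB] := gaussian_mean_le 0 T2 p0 q0 pq mu uy.
  rewrite mul1r -uE (le_trans (ler_norm _))// (le_trans (le_normr_Rintegral measurableT iu))//.
  apply: le_trans uB _; rewrite ler_wpM2r ?powR_ge0// -lee_fin fineK//.
  by rewrite ge0_fin_numE// Lnorm_ge0.
subst n; have ci1 : c^-1 <= 1 by rewrite invf_le1// ltW.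
have ci0 : 0 < c^-1 by rewrite invr_gt0.
have pi2 := @pi_ge2 R.
have cos1 : cos c^-1 < 1.
  by rewrite -cos0 ltr_cos ?in_itv/= ?lexx ?pi_ge0//=; lra.
(* 2^l is the cost of the second l-th difference, the one taken in the centre of the Gaussian. *)
exists ((2 - 2 * cos c^-1) ^+ l), (2 ^+ l); split; rewrite ?exprn_gt0//; first by lra.
move=> C F f t T B hf /Lfun_norm_lty[mf fy] t0 tT; rewrite /Omega eqxx => OB.
have T0 : 0 < T by rewrite (lt_le_trans _ tT)// divr_gt0.
have T2 : 0 < T ^+ 2 by rewrite exprn_gt0.
pose h := (c * T)^-1; have h0 : 0 < h by rewrite invr_gt0 mulr_gt0.
have m0 s : 0 <= 2 - 2 * cos (s * h) by have := cos_max (s * h); rewrite ler_norml; lra.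
have ifT : gaussian_integrable (T ^+ 2) f.
  by move=> y; have [] := gaussian_mean_le y T2 p0 q0 pq mf fy.
exists (fun s => (2 - 2 * cos (s * h)) ^+ l); split.
- by move=> s _; rewrite exprn_ge0.
- move=> s /andP[Ts sT]; rewrite lerXn2r ?nnegrE ?m0//; try by lra.
  have s1 : c^-1 <= s * h by rewrite /h invfM mulrCA ler_peMr ?(ltW ci0)// ler_pdivlMr// mul1r.
  have s2 : s * h <= 2.
    rewrite /h invfM mulrCA mulrC -[leRHS]mulr1 ler_pM ?(ltW ci0)//.
      by rewrite divr_ge0 ?ltW// (lt_le_trans T0).
    by rewrite ler_pdivrMr.
  have : cos (s * h) <= cos c^-1.
    move: s1; rewrite le_eqVlt => /predU1P[<-//|s1]; apply: ltW.
    by rewrite ltr_cos// in_itv/=; lra.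
  lra.
- apply: (integrable_freq_mul hf c1 (M := 4 ^+ l) T2).
    apply: measurable_funX; apply: measurable_funB => //; apply: measurable_funM => //.
    apply: (measurableT_comp (f := @cos R)).
      by apply: continuous_measurable_fun; exact: continuous_cos.
    exact: measurable_funM.
  move=> s; rewrite normrX lerXn2r ?nnegrE//.
  by have := cos_max (s * h); rewrite !ler_norml; lra.
rewrite -(difference_transform hf c1 h l T2 ifT).
pose e : 'rV[R]_1 := const_mx h.
have [idf E] := gaussian_mean_difference e l ifT.
rewrite -/e -E (le_trans (ler_norm _))//; apply: iter_difference_le => y.
have mdf : measurable_fun setT (iter l (difference e) f) by exact: measurable_difference.
have NB : ('N[lebesgue_rV 1]_p%:E[EFin \o iter l (difference e) f] <= B%:E)%E.
  apply: le_trans OB; apply: ereal_sup_ubound; exists e => //=.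
  rewrite /enorm big_ord1 mxE sqrtr_sqr gtr0_norm// /h lef_pV2 ?posrE ?mulr_gt0//.
  by rewrite mulrC -ler_pdivrMr.
have Ny : ('N[lebesgue_rV 1]_p%:E[EFin \o iter l (difference e) f] < +oo)%E.
  by apply: le_lt_trans NB _; rewrite ltry.
have [iu' uB] := gaussian_mean_le y T2 p0 q0 pq mdf Ny.
apply: le_trans (le_normr_Rintegral measurableT iu') _; apply: le_trans uB _.
by rewrite ler_wpM2r ?powR_ge0// -lee_fin fineK// ge0_fin_numE// Lnorm_ge0.
Qed.

End block_bound.

(** * The pointwise bound for F *)

Lemma Omega_ge0 {R : realType} d l (f : 'rV[R]_d -> R) (t p : R) : 0 <= t -> (0 <= Omega l f t p)%E.
Proof.
move=> t0; rewrite /Omega; case: ifP => _; last exact: Lnorm_ge0.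
apply: (@le_trans _ _ ('N[lebesgue_rV d]_p%:E[EFin \o iter l (difference 0) f]%E)).
  exact: Lnorm_ge0.
apply: ereal_sup_ubound; exists 0 => //=.
by rewrite /enorm big1 ?sqrtr0// => i _; rewrite mxE expr0n.
Qed.

Theorem corollary7p1 (R : realType) (d l : nat) (p p' c C : R) :
  (1 <= d)%N -> (1 <= l)%N -> 2 * d%:R / (d%:R + 1) < p ->
  p^-1 + p'^-1 = 1 -> 1 < c -> 0 < C ->
  exists2 K : R, 0 < K &
    forall (F0 : R -> R) (f : 'rV[R]_d -> R),
      GMhat c C F0 f ->
      f \in Lfun (lebesgue_rV d) p%:E ->
      (forall s : R, 0 < s -> 0 <= F0 s) ->
      forall t : R, 0 < t ->
        ((F0 t)%:E <= (K * t `^ (- (d%:R / p')))%:E * Omega l f t^-1 p)%E.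
Proof.
case: d => // n _ _ dp pp c1 C0; have c0 := lt_trans ltr01 c1.
(* For d >= 1 the quotient 2d/(d+1) is at least 1. *)
have p1 : 1 < p.
  apply: le_lt_trans dp; rewrite ler_pdivlMr ?ltr_wpDl//.
  by have : 1 <= n.+1%:R :> R; [rewrite ler1n|lra].
have p0 := lt_trans ltr01 p1.
have q0 : 0 < p'.
  rewrite -invr_gt0; have -> : p'^-1 = 1 - p^-1 by rewrite -pp; ring.
  by rewrite subr_gt0 invf_lt1.
have [K1 K10 H] := @block_bound R n l p p' c p0 q0 pp c1.
set b := n.+1%:R / p'; have b0 : 0 < b by rewrite divr_gt0.
have rho1 : 0 < 1 - 2 `^ (- b) :> R.
  by rewrite subr_gt0 /powR gt_eqF// expR_lt1 mulNr oppr_lt0 mulr_gt0// ln_gt0// ltr1n.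
(* C comes from the GM condition and K1 from a single block; the blocks start at t/c, whence c^b,
   and form a geometric series of ratio 2^(-b). *)
exists (C * (K1 * c `^ b / (1 - 2 `^ (- b)))).
  by rewrite !mulr_gt0 ?powR_gt0// invr_gt0.
move=> F f hf fL Fp t t0; have := Omega_ge0 l f p (ltW (ltac:(by rewrite invr_gt0) : 0 < t^-1)).
(* An infinite Omega makes the right-hand side infinite, as the constant in front is positive; the
   value -oo is excluded by [Omega_ge0]. *)
case E : (Omega l f t^-1 p) => [B| |]// B0; last first.
  by rewrite gt0_muley ?leey// lte_fin !mulr_gt0 ?powR_gt0// invr_gt0.
have tc : 0 < t / c by rewrite divr_gt0.
have iF := integrable_F_tail (GMhat_bv hf) (GMhat_tail hf c1) tc.
have [[_ F0 /(_ t t0)[FV _]] _ _] := hf.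
apply: le_trans (le_tail_variation t0 F0 (Fp t t0)) _; apply: le_trans FV _.
rewrite -EFinM (_ : \int[_]_(u in _) _ = (\int[lebesgue_measure]_(s in `]t / c, +oo[) (F s / s))%:E)%E.
  rewrite -EFinM lee_fin -(mulrA C) -(mulrA C) ler_wpM2l ?(ltW C0)//.
  have := dyadic_integral_le tc b0 _ iF (B := K1 * B).
  have KB0 : 0 <= K1 * B by rewrite mulr_ge0 ?(ltW K10).
  move=> /(_ KB0) h; apply: le_trans (h _) _.
    by move=> T tT; apply: (H C F f t) => //; rewrite E.
  rewrite le_eqVlt; apply/orP; left; apply/eqP.
  rewrite powRM ?invr_ge0 ?(ltW t0) ?(ltW c0)// [c^-1 `^ _](_ : _ = c `^ b); first by ring.
  by rewrite -powR_inv1 ?(ltW c0)// -powRrM mulN1r opprK.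
rewrite -(EFin_Rintegral _ iF); last exact: measurable_itv.
apply: eq_integral => u; rewrite inE/= in_itv/= andbT => tu.
by rewrite ger0_norm// Fp// (lt_trans tc).
Qed.
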